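(* Let $n\in\mathbb{N}$, $d_j\in\mathbb{N}$, $s_j>0$ for $1\le j\le n$, $d=\sum_{j=1}^nd_j$, $2<q<\infty$, and define $s>0$ by $\frac ds=\sum_{j=1}^n\frac{d_j}{s_j}$. Assume $1/q>1/2-s/d$. Let $\{u_l\}_{l\ge1}$ be a bounded sequence in $H^{\bm s}_{\bm d}$. Then, after replacing $\{u_l\}$ by a subsequence, there exist a bounded sequence $\{U^j\}_{j\ge1}$ in $H^{\bm s}_{\bm d}$ and, for each $j\ge1$, a sequence $\{x_l^j\}_{l\ge1}\subset\mathbb{R}^d$ such that, with $r_l^k$ defined for $k\ge1$ by $$u_l(x)=\sum_{j=1}^kU^j(x+x_l^j)+r_l^k(x),$$ the following hold: \begin{itemize} \item $r_l^k(\cdot-x_l^j)\rightharpoonup0$ weakly in $H^{\bm s}_{\bm d}$ as $l\to\infty$, for all $1\le j\le k$; \item $\displaystyle\lim_{k\to\infty}\lim_{l\to\infty}\|r_l^k\|_{L^q}=0$, and $\displaystyle\lim_{l\to\infty}|x_l^j-x_l^k|=\infty$ for all $j\ne k$; \item for every $k\ge1$, $\displaystyle\lim_{l\to\infty}\|u_l\|_{L^q}^q=\lim_{l\to\infty}\|r_l^k\|_{L^q}^q+\sum_{j=1}^k\|U^j\|_{L^q}^q$; \item for every $k\ge1$ and every Fourier multiplier $T_m=\mathscr{F}^{-1}m(\xi)\mathscr{F}$ with $|m(\xi)|\lesssim1+|\xi_1|^{s_1}+\cdots+|\xi_n|^{s_n}$, $$\limsup_{l\to\infty}\|T_mu_l\|_{L^2}^2=\limsup_{l\to\infty}\|T_mr_l^k\|_{L^2}^2+\sum_{j=1}^k\|T_mU^j\|_{L^2}^2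 .$$ \end{itemize}
   Context: Write $x=(x_1,\dots,x_n)$, $\xi=(\xi_1,\dots,\xi_n)\in\mathbb{R}^{d_1}\oplus\cdots\oplus\mathbb{R}^{d_n}=\mathbb{R}^d$, $\bm d=(d_1,\dots,d_n)$, $\bm s=(s_1,\dots,s_n)$, $\mathscr{F}$ the Fourier transform on $\mathbb{R}^d$, and $D_{x_j}^{s_j}=\mathscr{F}^{-1}|\xi_j|^{s_j}\mathscr{F}$. The space is $$H^{\bm s}_{\bm d}=\{u\in L^2(\mathbb{R}^d):D_{x_j}^{s_j}u\in L^2(\mathbb{R}^d),\ j=1,\dots,n\},\qquad \|u\|_{H^{\bm s}_{\bm d}}^2=\|u\|_{L^2}^2+\sum_{j=1}^n\|D_{x_j}^{s_j}u\|_{L^2}^2 .$$ $A\lesssim B$ means $A\le CB$ for some finite constant $C$. Norms without a domain are over $\mathbb{R}^d$. *)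

(* Defs.v *)
From HB Require Import structures.
From mathcomp Require Import all_boot all_order all_algebra.
From mathcomp Require Import complex.
From mathcomp Require Import all_classical all_reals all_analysis.

Set Implicit Arguments.
Unset Strict Implicit.
Unset Printing Implicit Defensive.

Import Order.TTheory GRing.Theory Num.Theory.
Import numFieldNormedType.Exports.

Local Open Scope classical_set_scope.
Local Open Scope ring_scope.

(* Row vectors carry the product sigma-algebra, generated by the coordinates
   (over R this is the Borel sigma-algebra of R^d). *)
Section measurable_rV.
Context {disp} {T : measurableType disp}.
Variable d : nat.

Let coors : 'I_d -> 'rV[T]_d -> T := fun i x => x ord0 i.

Let rV_set0 : g_sigma_preimage coors set0.
Proof. exact: sigma_algebra0. Qed.

Let rV_setC A : g_sigma_preimage coors A -> g_sigma_preimage coors (~` A).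
Proof. exact: sigma_algebraC. Qed.

Let rV_bigcup (F : (set 'rV[T]_d)^nat) :
  (forall i, g_sigma_preimage coors (F i)) ->
  g_sigma_preimage coors (\bigcup_i (F i)).
Proof. exact: sigma_algebra_bigcup. Qed.

HB.instance Definition _ := @isMeasurable.Build (measure_tuple_display disp)
  'rV[T]_d (g_sigma_preimage coors) rV_set0 rV_setC rV_bigcup.

Lemma measurable_coord (i : 'I_d) :
  measurable_fun [set: 'rV[T]_d] (fun x : 'rV[T]_d => x ord0 i).
Proof.
move=> _ Y mY; rewrite setTI; apply: sub_sigma_algebra => /=.
rewrite -bigcup_seq/=; exists i => /=; first by rewrite mem_index_enum.
by exists Y => //; rewrite setTI.
Qed.

Lemma measurable_fun_coordP d1 (T1 : measurableType d1) (f : T1 -> 'rV[T]_d) :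
  (forall i, measurable_fun [set: T1] (fun x => f x ord0 i)) ->
  measurable_fun [set: T1] f.
Proof.
move=> mf _; apply: (@smallest_sub _ _ _ (image_set_system setT f measurable)).
  exact/sigma_algebra_image/sigma_algebra_measurable.
rewrite -bigcup_seq; apply: bigcup_sub => i _ _ [B mB <-].
by rewrite /image_set_system/= setTI; exact: mf.
Qed.

End measurable_rV.


Section lebesgue_rV.
Context {R : realType}.
Notation R1 := (measurableTypeR R).

Definition consv d (p : R1 * 'rV[R]_d) : 'rV[R]_d.+1 :=
  row_mx (p.1 : R)%:M p.2.

Lemma measurable_consv d : measurable_fun setT (@consv d).
Proof.
apply: measurable_fun_coordP => i.
have -> : (fun p => @consv d p ord0 i) =
    (fun p => match fintype.split (i : 'I_(1 + d)) with
              | inl _ => p.1 | inr k => p.2 ord0 k end).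
  apply/funext => x; rewrite /consv !mxE; case: fintype.split => // j.
  by rewrite mxE !ord1 eqxx.
case: fintype.split => [_|k]; first exact: measurable_fst.
by apply: (@measurableT_comp _ _ _ _ _ _ (fun y : 'rV[R]_d => y ord0 k));
  [exact: measurable_coord|exact: measurable_snd].
Qed.

Section step.
Variables (d : nat) (mu : {sigma_finite_measure set 'rV[R]_d -> \bar R}).

Definition lebesgue_rV_succ : set 'rV[R]_d.+1 -> \bar R :=
  pushforward (@lebesgue_measure R \x mu)%E (@consv d).

Let push : {measure set 'rV[R]_d.+1 -> \bar R} :=
  measure_function_pushforward__canonical__measure_function_Measure
    (@lebesgue_measure R \x mu)%E (@measurable_consv d).

HB.instance Definition _ := isMeasure.Build _ _ _ lebesgue_rV_succ
  (measure0 push) (measure_ge0 push) (@measure_semi_sigma_additive _ _ _ push).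

Let succ_sigma_finite : sigma_finite setT lebesgue_rV_succ.
Proof.
have /sigma_finiteP[F [TF ndF Foo]] := sigma_finiteT (@lebesgue_measure R).
have /sigma_finiteP[G [TG ndG Goo]] := sigma_finiteT mu.
pose g (v : 'rV[R]_d.+1) : R1 * 'rV[R]_d :=
  (v ord0 ord0, rsubmx (v : 'rV[R]_(1 + d))).
have gK : cancel (@consv d) g.
  case=> x y; rewrite /g /consv /=; congr (_, _); last by rewrite row_mxKr.
  by rewrite mxE; case: splitP => // j _; rewrite mxE !ord1 eqxx.
have mg : measurable_fun setT g.
  apply/measurable_fun_pair => /=; first exact: measurable_coord.
  apply: measurable_fun_coordP => i.
  rewrite (_ : (fun _ => _) = fun v : 'rV[R]_d.+1 => v ord0 (rshift 1 i)).
    exact: measurable_coord.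
  by apply/funext => v; rewrite mxE.
exists (fun i => g @^-1` (F i `*` G i)).
  apply/esym; rewrite -subTset => v _.
  have [[i _ Fi] [j _ Gj]] : (\bigcup_i F i) (g v).1 /\ (\bigcup_i G i) (g v).2.
    by rewrite -TF -TG.
  exists (maxn i j) => //; split.
    by move: Fi; exact/subsetPset/ndF/leq_maxl.
  by move: Gj; exact/subsetPset/ndG/leq_maxr.
move=> i; have [mF Fi] := Foo i; have [mG Gi] := Goo i; split.
  by rewrite -[X in measurable X]setTI; apply: mg => //; exact: measurableX.
rewrite /lebesgue_rV_succ /pushforward -comp_preimage.
have -> : g \o @consv d = id by apply/funext => p /=; rewrite gK.
by rewrite preimage_id product_measure1E// lte_mul_pinfty// ge0_fin_numE.
Qed.

HB.instance Definition _ := @Measure_isSigmaFinite.Build _ _ _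
  lebesgue_rV_succ succ_sigma_finite.

End step.

(* d-dimensional Lebesgue measure, as an iterated product measure; see
   [lebesgue_rV_box] for its value on boxes. *)
Fixpoint lebesgue_rV d : {sigma_finite_measure set 'rV[R]_d -> \bar R} :=
  match d with
  | 0 => \d_(0 : 'rV[R]_0)
  | d'.+1 => lebesgue_rV_succ (lebesgue_rV d')
  end.

Lemma lebesgue_rV_box d (A : 'I_d -> set R) :
  (forall i, measurable (A i)) ->
  lebesgue_rV d [set x : 'rV[R]_d | forall i, A i (x ord0 i)] =
  (\prod_(i < d) lebesgue_measure (A i))%E.
Proof.
elim: d A => [|d IH] A mA.
  rewrite big_ord0 /= diracE (_ : _ \in _ = true)//.
  by apply/mem_set => -[m lt_m0]; have := lt_m0; rewrite ltn0.
rewrite big_ord_recl -IH => [|i]; last exact: mA.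
have mB : measurable [set x : 'rV[R]_d | forall i, A (lift ord0 i) (x ord0 i)].
  rewrite (_ : [set _ | _] = \big[setI/setT]_(i < d)
      ((fun x : 'rV[R]_d => x ord0 i) @^-1` A (lift ord0 i))).
    apply: bigsetI_measurable => i _; rewrite -[X in measurable X]setTI.
    exact: measurable_coord.
  rewrite -bigcap_seq; apply/seteqP; split => x /= Ax; first by move=> i _; exact: Ax.
  by move=> i; apply: Ax; rewrite /= mem_index_enum.
rewrite -[RHS]product_measure1E//=; last exact: mA.
rewrite /lebesgue_rV_succ /pushforward; congr product_measure1.
apply/seteqP; split => -[a v] /= H.
  split; first by have := H ord0; rewrite mxE; case: splitP => // j _; rewrite mxE !ord1 eqxx mulr1n.
  move=> i; have := H (lift ord0 i).
  rewrite mxE; case: splitP => j ij; first by move: (ltn_ord j); rewrite -ij.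
  by rewrite (_ : i = j)//; apply/val_inj; case: ij.
move=> i; rewrite mxE; case: splitP => j ij.
  have -> : i = ord0 by apply/val_inj => /=; rewrite ij ord1.
  by rewrite mxE !ord1 eqxx mulr1n; exact: H.1.
have -> : i = lift ord0 j by exact/val_inj.
exact: H.2.
Qed.

End lebesgue_rV.

(* Elements of L^p, H^s, ... are represented by Borel functions R^d -> C;
   functions that agree almost everywhere are not identified. *)
Section complex_functions.
Context {R : realType} {d : nat}.
Notation E := 'rV[R]_d.
Notation mu := (@lebesgue_rV R d).
Implicit Types (f g u v w : E -> R[i]) (p : \bar R).

Definition cnorm (z : R[i]) : R := complex.Re `|z|.

Definition dotv (x y : E) : R := \sum_(i < d) x ord0 i * y ord0 i.

(* Not the library norm `|x| of row vectors, which is the sup norm. *)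
Definition enorm (x : E) : R := Num.sqrt (dotv x x).

Definition cmeasurable f : Prop :=
  measurable_fun [set: E] (fun x => complex.Re (f x)) /\
  measurable_fun [set: E] (fun x => complex.Im (f x)).

Definition cLnorm p f : \bar R := 'N[mu]_p[EFin \o (cnorm \o f)]%E.

Definition Lp p f : Prop := cmeasurable f /\ (cLnorm p f < +oo)%E.

Definition cintegral f : R[i] :=
  Complex (\int[mu]_x complex.Re (f x)) (\int[mu]_x complex.Im (f x)).

Definition expNi (t : R) : R[i] := Complex (cos t) (- sin t).

(* (2 pi)^(-d/2) * \int f(x) e^(-i x.xi) dx *)
Definition fourier_integral f (xi : E) : R[i] :=
  (((2 * pi) `^ (- (d%:R / 2)))%:C)%C *
  cintegral (fun x => f x * expNi (dotv x xi)).

(* [is_fourier f g] means g = F f for the unitary Fourier transform F of L^2,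
   i.e. the extension by continuity of [fourier_integral] from the dense
   subspace of functions that are both integrable and square-integrable.
   Being a relation, it determines f and g up to a.e. equality. *)
Definition is_fourier f g : Prop :=
  [/\ Lp 2%:E f, Lp 2%:E g &
   exists w : nat -> E -> R[i],
   [/\ forall k, Lp 1%:E (w k) /\ Lp 2%:E (w k),
       (cLnorm 2%:E (fun x => w k x - f x)%R @[k --> \oo] --> 0)%E &
       (cLnorm 2%:E (fun xi => fourier_integral (w k) xi - g xi)%R
          @[k --> \oo] --> 0)%E]].

(* [is_multiplier m u v] means that F^-1 m F u belongs to L^2 and equals v. *)
Definition is_multiplier (m u v : E -> R[i]) : Prop :=
  exists2 g, is_fourier u g & is_fourier v (fun xi => m xi * g xi).

(* F^-1 m F u, and the junk value 0 when it does not belong to L^2 *)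
Definition multiplier (m u : E -> R[i]) : E -> R[i] :=
  xget (fun=> 0) [set v | is_multiplier m u v].

End complex_functions.

Section anisotropic_sobolev.
Context {R : realType} {n : nat}.
Variables (dd : 'I_n -> nat) (s : 'I_n -> R).
Notation E := 'rV[R]_(\sum_(j < n) dd j).
Implicit Types (u v : E -> R[i]) (xi : E).

(* The Euclidean norm of the component xi_j in R^(d_j); [tagnat.sig1 i] is the
   block to which the coordinate i belongs. *)
Definition block_norm (j : 'I_n) xi : R :=
  Num.sqrt (\sum_(i < \sum_(j < n) dd j | tagnat.sig1 i == j) xi ord0 i ^+ 2).

Definition Dsymbol (j : 'I_n) xi : R[i] := ((block_norm j xi `^ s j)%:C)%C.

Definition Hs u : Prop :=
  Lp 2%:E u /\ forall j, exists v, is_multiplier (Dsymbol j) u v.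

Definition Hs_norm u : \bar R :=
  ((cLnorm 2%:E u ^+ 2 +
    \sum_(j < n) cLnorm 2%:E (multiplier (Dsymbol j) u) ^+ 2) `^ 2^-1)%E.

Definition Hs_bounded (u : nat -> E -> R[i]) : Prop :=
  (forall l, Hs (u l)) /\ exists M : R, forall l, (Hs_norm (u l) <= M%:E)%E.

(* By the bound, such a phi takes equal values on functions that agree almost
   everywhere, so it is an element of the dual of the Hilbert space H^s. *)
Definition Hs_dual (phi : (E -> R[i]) -> R[i]) : Prop :=
  (forall (a : R[i]) u v, Hs u -> Hs v ->
     phi (fun x => a * u x + v x) = a * phi u + phi v) /\
  exists C : R, forall u, Hs u -> ((cnorm (phi u))%:E <= C%:E * Hs_norm u)%E.

Definition Hs_weak_cvg (u : nat -> E -> R[i]) v : Prop :=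
  [/\ forall l, Hs (u l), Hs v &
      forall phi, Hs_dual phi ->
        cnorm (phi (u l) - phi v) @[l --> \oo] --> 0].

Definition admissible_symbol (m : E -> R[i]) : Prop :=
  cmeasurable m /\
  exists C : R, forall xi,
    cnorm (m xi) <= C * (1 + \sum_(j < n) block_norm j xi `^ s j).

End anisotropic_sobolev.

(* Main.v *)
Require Import Defs.
From mathcomp Require Import all_boot all_order all_algebra.
From mathcomp Require Import complex.
From mathcomp Require Import all_classical all_reals all_analysis.
From mathcomp Require Import measurable_realfun ring lra.

(** Why the theorem is true.  Let [wt] be one plus the sum of the squared symbols
[|xi_j|^(2 s_j)] and [W] its square root.  By Plancherel, [u |-> W * u^] identifies
H^s, up to null functions, with L^2 of the frequency space; there the translation
of [u] by [x] becomes the multiplication by a character, an isometry.  So a bounded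
sequence of H^s is a bounded sequence of a Hilbert space on which the translations
act, and profiles are weak limits of translates.

The abstract part ([profile_decomposition]) repeatedly removes from the sequence a
weak limit of translates with nearly the largest possible energy.  Two sequences of
translations that gave different profiles must separate, because the action is
strongly continuous; energies add up, so the profiles tend to zero and the
remainders eventually have no translate with a large weak limit.  All weak limits
are taken along one ultrafilter, and a subsequence is extracted only at the end.

The analytic part ([nq_detects]) says that this makes the remainders small in L^q.
The sublevel sets [wt < 2^k] have measure [O(2^(k theta))], [theta = d / (2 s)], as
they lie in boxes with sides [2^(k / (2 s_j))].  By Bernstein's inequality and
interpolation, the piece of [u] with spectrum in the shell [2^k <= wt < 2^(k+1)] has
L^q norm [O(2^(-gam k))] with [gam = 1/2 - theta (1/2 - 1/q)], which is positive
exactly because [1/q > 1/2 - s/d].  Summing the pieces gives the Sobolev embedding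
and, uniformly on bounded sets, the smallness of high frequencies in L^q
([high_cLnorm]).  What remains is a low-frequency part, bounded in L^2; if it is
large in L^q it is large at some point, and its value there is an inner product of a
translate of the spectrum with a fixed vector.

The identity for L^q norms ([decoupling]) follows from the same splitting: a weakly
null sequence has low-frequency parts that tend to zero on every cube, hence behaves
like a sequence supported far from a fixed profile, and q-th powers of norms of
functions with disjoint supports add.  For a Fourier multiplier, [m / W] is bounded,
so the cross terms are inner products of weakly null sequences with fixed vectors
([symbol_profile]).  Weak convergence in H^s reduces to weak convergence of spectra
through Riesz ([spec_weak0]).

Plancherel is proved from the Abel regularisation [exp (- eps |xi|)] in each
coordinate, whose transform is the Poisson kernel: the multiplication formula and a
Schur test make the Fourier integral a contraction of L^2 ([F_contraction]), and the
convergence of Poisson means of boxes gives Parseval's identity against boxes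
([parseval_boxf]), which is enough to identify the inverse transform because boxes
determine a function almost everywhere. *)

Set Implicit Arguments.
Unset Strict Implicit.
Unset Printing Implicit Defensive.

Import Order.TTheory GRing.Theory Num.Theory.
Import numFieldNormedType.Exports.

Local Open Scope classical_set_scope.
Local Open Scope ring_scope.

Local Notation Re := (@complex.Re _).
Local Notation Im := (@complex.Im _).
Local Notation "z ^*" := (conjc z) : ring_scope.

(** * Semi-Hilbert spaces *)

(** The vectors are functions that are not identified when they agree almost
everywhere, so that the inner product is only positive semi-definite; and they
form a subset [dom] of an ambient additive group.  Only the real part of a
complex inner product is recorded: it determines the norm and it turns
real-linear functionals into vectors. *)
Record semiHilbert (R : realType) (V : zmodType) := SemiHilbert {
  scal : R -> V -> V;
  dom : set V;
  ip : V -> V -> R;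
  dom0 : dom 0;
  domD : forall x y, dom x -> dom y -> dom (x + y);
  domN : forall x, dom x -> dom (- x);
  domZ : forall a x, dom x -> dom (scal a x);
  ipC : forall x y, ip x y = ip y x;
  ipDl : forall x y z, dom x -> dom y -> dom z -> ip (x + y) z = ip x z + ip y z;
  ipZl : forall a x y, dom x -> dom y -> ip (scal a x) y = a * ip x y;
  ip_ge0 : forall x, 0 <= ip x x;
  ip_complete : forall u : nat -> V, (forall n, dom (u n)) ->
    (forall e : R, 0 < e -> exists N, forall m n, (N <= m)%N -> (N <= n)%N ->
       ip (u m - u n) (u m - u n) <= e) ->
    exists2 l, dom l & forall e : R, 0 < e -> exists N, forall n, (N <= n)%N ->
       ip (u n - l) (u n - l) <= e }.

Section semi_hilbert.
Context {R : realType} {V : zmodType} (H : semiHilbert R V).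
Local Notation D := (dom H).
Local Notation ip := (ip H).
Local Notation sc := (scal H).
Implicit Types (x y z : V) (a t : R).
#[local] Hint Resolve dom0 domD domN domZ : core.

Lemma domB x y : D x -> D y -> D (x - y). Proof. by auto. Qed.
#[local] Hint Resolve domB : core.

Lemma ipDr x y z : D x -> D y -> D z -> ip z (x + y) = ip z x + ip z y.
Proof. by move=> *; rewrite ipC ipDl// ![ip z _]ipC. Qed.

Lemma ipZr a x y : D x -> D y -> ip x (sc a y) = a * ip x y.
Proof. by move=> *; rewrite ipC ipZl// ipC. Qed.

Lemma ip0l x : D x -> ip 0 x = 0.
Proof.
by move=> Dx; apply: (@addrI _ (ip 0 x)); rewrite -ipDl ?addr0.
Qed.

Lemma ipNl x y : D x -> D y -> ip (- x) y = - ip x y.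
Proof.
by move=> Dx Dy; apply/eqP; rewrite -addr_eq0 -ipDl ?addNr ?ip0l; auto.
Qed.

Lemma ipNr x y : D x -> D y -> ip x (- y) = - ip x y.
Proof. by move=> *; rewrite ipC ipNl// ipC. Qed.

Definition ipE := (ipDl, ipDr, ipNl, ipNr, ipZl, ipZr).

Lemma ip_sqrD x y : D x -> D y ->
  ip (x + y) (x + y) = ip x x + 2 * ip x y + ip y y.
Proof. by move=> Dx Dy; rewrite !ipE; auto; rewrite [ip y x]ipC; ring. Qed.

Lemma ip_sqrB x y : D x -> D y ->
  ip (x - y) (x - y) = ip x x - 2 * ip x y + ip y y.
Proof. by move=> Dx Dy; rewrite ip_sqrD ?ipE; auto; ring. Qed.

Lemma cauchy_schwarz x y : D x -> D y -> ip x y ^+ 2 <= ip x x * ip y y.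
Proof.
move=> Dx Dy; have P t : 0 <= ip x x + 2 * t * ip x y + t ^+ 2 * ip y y.
  have := ip_ge0 H (x + sc t y).
  by rewrite ip_sqrD ?ipE; auto; move=> h; lra.
have := ip_ge0 H y; rewrite le_eqVlt => /predU1P[y0|y0].
  suff -> : ip x y = 0 by rewrite -y0 mulr0 expr0n.
  apply/eqP/negP => /negP xy0.
  have := P (- (ip x x + 1) / (2 * ip x y)); rewrite -y0 mulr0 addr0.
  have -> : 2 * (- (ip x x + 1) / (2 * ip x y)) * ip x y = - (ip x x + 1).
    by field.
  by lra.
have := P (- ip x y / ip y y).
have -> : ip x x + 2 * (- ip x y / ip y y) * ip x y +
    (- ip x y / ip y y) ^+ 2 * ip y y = (ip x x * ip y y - ip x y ^+ 2) / ip y y.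
  by field; lra.
by rewrite pmulr_lge0 ?invr_gt0// subr_ge0.
Qed.

Lemma ip_null x y : D x -> D y -> ip x x = 0 -> ip x y = 0.
Proof.
move=> Dx Dy x0; have := cauchy_schwarz Dx Dy; rewrite x0 mul0r => h.
by apply/eqP; rewrite -sqrf_eq0 eq_le h sqr_ge0.
Qed.

Lemma ip_sqrD_le x y : D x -> D y ->
  ip (x + y) (x + y) <= 2 * ip x x + 2 * ip y y.
Proof.
move=> Dx Dy; have := ip_ge0 H (x - y); rewrite ip_sqrB// ip_sqrD//; lra.
Qed.

(** Minimise the quadratic functional [J x = |x|^2 - 2 phi x]: by the
parallelogram law a minimising sequence is Cauchy. *)
Theorem riesz_representation (phi : V -> R) (C : R) : 0 <= C ->
  (forall x y, D x -> D y -> phi (x + y) = phi x + phi y) ->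
  (forall a x, D x -> phi (sc a x) = a * phi x) ->
  (forall x, D x -> phi x ^+ 2 <= C * ip x x) ->
  exists2 h, D h & forall x, D x -> phi x = ip h x.
Proof.
move=> C0 phiD phiZ phiC.
pose J x := ip x x - 2 * phi x.
have JC x : D x -> - C <= J x.
  move=> Dx; have := phiC _ Dx; have := ip_ge0 H x; rewrite /J.
  move: (phi x) (ip x x) => p i i0 h.
  rewrite leNgt; apply/negP => h2.
  have h3 : 0 <= (i - C) ^+ 2 by exact: sqr_ge0.
  have : (i + C) ^+ 2 < (2 * p) ^+ 2 by rewrite ltr_pXn2r// ?nnegrE; lra.
  by rewrite !expr2 in h h3 *; nra.
have hasi : has_inf (J @` D).
  split; first by exists (J 0); exists 0; auto.
  by exists (- C) => _ [x Dx <-]; exact: JC.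
set m := inf (J @` D).
have mJ x : D x -> m <= J x by move=> Dx; apply: ge_inf (hasi.2) _ _; exists x.
have /choice[u u_m] : forall n, exists x, D x /\ J x < m + n.+1%:R^-1.
  move=> n; have [|_ [x Dx <-] xm] := @inf_adherent _ (J @` D) n.+1%:R^-1 _ hasi.
    by rewrite invr_gt0.
  by exists x.
have Du n : D (u n) by have [] := u_m n.
have Ju n : J (u n) < m + n.+1%:R^-1 by have [] := u_m n.
have small (e : R) : 0 < e -> exists N, forall n, (N <= n)%N -> n.+1%:R^-1 <= e :> R.
  move=> e0; exists (Num.truncn e^-1) => n Nn.
  rewrite -[e]invrK lef_pV2 ?posrE ?invr_gt0//.
  apply/ltW/(lt_le_trans (truncnS_gt _)); by rewrite ler_nat.
have [|l Dl ul] := @ip_complete _ _ H u Du.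
  move=> e e0; have [|N NE] := small (e / 4); first by lra.
  exists N => i j Ni Nj.
  have := mJ _ (domZ 2^-1 (domD (Du i) (Du j))).
  have := Ju i; have := Ju j; have := NE _ Ni; have := NE _ Nj.
  have Dij : D (u i + u j) by auto.
  rewrite ip_sqrB// /J phiZ// phiD// !(ipZl, ipZr); auto.
  by rewrite ip_sqrD//; move: i.+1%:R^-1 j.+1%:R^-1 => *; lra.
exists l => // y Dy.
suff key t : 0 <= 2 * t * (ip l y - phi y) + t ^+ 2 * ip y y.
  apply/esym/eqP; rewrite -subr_eq0; apply/negP => /negP ne0.
  set d := ip l y - phi y in key ne0.
  have y0 := ip_ge0 H y.
  have := key (- d / (ip y y + 1)).
  have -> : 2 * (- d / (ip y y + 1)) * d + (- d / (ip y y + 1)) ^+ 2 * ip y y =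
    - (d ^+ 2 * (ip y y + 2) / (ip y y + 1) ^+ 2) by field; lra.
  rewrite oppr_ge0 leNgt => /negP; apply.
  apply: divr_gt0; last by rewrite exprn_gt0//; lra.
  by apply: mulr_gt0; [rewrite exprn_even_gt0|lra].
rewrite -[leRHS]addr0 -lerBlDl sub0r; apply/ler_addgt0Pl => e e0.
have [|N1 N1E] := small (e / 2); first by lra.
pose K := (2 * t) ^+ 2 * ip y y + 1.
have K0 : 0 < K by rewrite /K ltr_pwDr// mulr_ge0 ?sqr_ge0 ?ip_ge0.
have [|N2 N2E] := ul ((e / 2) ^+ 2 / K).
  by rewrite divr_gt0// exprn_gt0//; lra.
pose n := maxn N1 N2.
have h1 := N1E n (leq_maxl _ _); have h2 := N2E n (leq_maxr _ _).
have Dn := Du n; have Dt : D (sc t y) by auto.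
have h3 := mJ _ (domD Dn Dt); have h4 := Ju n.
have h5 : ip (u n - l) (sc (2 * t) y) <= e / 2.
  have Dl2 : D (u n - l) by auto.
  have Dt2 : D (sc (2 * t) y) by auto.
  rewrite leNgt; apply/negP => h5.
  have := cauchy_schwarz Dl2 Dt2; apply/negP; rewrite -ltNge.
  apply: (@le_lt_trans _ _ ((e / 2) ^+ 2)); last first.
    by rewrite ltr_pXn2r// ?nnegrE; lra.
  rewrite (_ : ip (sc _ _) _ = (2 * t) ^+ 2 * ip y y); last first.
    by rewrite !(ipZl, ipZr); auto; ring.
  apply: (@le_trans _ _ ((e / 2) ^+ 2 / K * K)).
    apply: ler_pM => //; first exact: ip_ge0.
      by rewrite mulr_ge0 ?ip_ge0 ?sqr_ge0.
    by rewrite /K lerDl.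
  by rewrite divfK// gt_eqF.
move: h3 h4 h5; rewrite /J ip_sqrD// phiD// phiZ// !ipE; auto => h3 h4 h5.
by move: n.+1%:R^-1 h1 h4 => *; lra.
Qed.

End semi_hilbert.

(** * Limits along an ultrafilter *)

Lemma cvg_ext {T U : Type} (F : set_system T) (G : set_system U) (f g : T -> U) :
  f @ F `=>` G -> (forall t, f t = g t) -> g @ F `=>` G.
Proof. by move=> + /funext <-. Qed.

Section ultrafilters.
Context {T : Type} (F : set_system T) {FF : UltraFilter F}.

Lemma compact_ultra_cvg (X : topologicalType) (A : set X) (a : T -> X) :
  compact A -> F (a @^-1` A) -> exists2 p, A p & a @ F --> p.
Proof.
move=> cA FA; have [p [Ap cp]] := cA (a @ F) _ FA.
exists p => // N Np; have [//|FN] := in_ultra_setVsetC (a @^-1` N) FF.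
by have [y [ny Ny]] := cp (~` N) N FN Np.
Qed.

Lemma bounded_ultra_cvg (R : realType) (a : T -> R) (B : R) :
  (forall t, `|a t| <= B) -> exists l : R, a @ F --> l.
Proof.
move=> aB; have [|l _ al] := @compact_ultra_cvg R _ a (@segment_compact R (- B) B).
  by apply: filterE => t /=; rewrite in_itv /= -ler_norml.
by exists l.
Qed.

End ultrafilters.

(** The diagonal argument, once for all: a set of the ultrafilter never runs
out, so that one subsequence can follow countably many of them. *)
Lemma ultra_subsequence (R : realType) (F : set_system nat) (I : countType)
    (a : I -> nat -> R) (l : I -> R) :
  ProperFilter F -> \oo `<=` F -> (forall t, a t @ F --> l t) ->
  exists2 sub : nat -> nat, {homo sub : i j / (i < j)%N} &
    forall t, a t (sub i) @[i --> \oo] --> l t.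
Proof.
move=> FF Foo al.
pose S (n : nat) : set nat := match unpickle n : option (I * nat) with
  | Some (t, p) => [set i | `|l t - a t i| < p.+1%:R^-1]
  | None => setT end.
have FS n : F (S n).
  rewrite /S; case: (unpickle n) => [[t p]|]; last exact: filterT.
  by move/cvgrPdist_lt: (al t); apply; rewrite invr_gt0.
have /choice[f fP] : forall nm : nat * nat, exists i, (nm.2 < i)%N /\
    forall k, (k <= nm.1)%N -> S k i.
  move=> [n m] /=.
  have FB : F [set i | forall k, (k < n.+1)%N -> S k i].
    elim: n.+1 => [|j IH]; first by apply: filterE.
    apply: filterS2 IH (FS j) => i iS Sj k.
    by rewrite ltnS leq_eqVlt => /predU1P[->|/iS].
  have Fm : F [set i | (m < i)%N] by apply: Foo; exact: nbhs_infty_gt.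
  have [i [Bi mi]] := filter_ex (filterI FB Fm).
  by exists i; split => // k kn; apply: Bi; rewrite ltnS.
pose sub := fix sub n := match n with 0 => f (0, 0) | k.+1 => f (k.+1, sub k) end.
have subS n : (sub n < sub n.+1)%N by have [] := fP (n.+1, sub n).
have subP n k : (k <= n)%N -> S k (sub n).
  by case: n => [|n] kn; [have [_] := fP (0, 0)|have [_] := fP (n.+1, sub n)]; apply.
exists sub; first exact: homo_ltn ltn_trans subS.
move=> t; apply/cvgrPdist_lt => e e0.
have [p pe] : exists p : nat, p.+1%:R^-1 < e :> R.
  exists (Num.truncn e^-1); rewrite -[ltRHS]invrK ltf_pV2 ?posrE ?invr_gt0//.
  exact: Num.Theory.truncnS_gt.
exists (pickle (t, p)) => // i /= ti.
have := subP _ _ ti; rewrite /S pickleK /= => h; exact: lt_trans h pe.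
Qed.

(** * Profile decomposition under a group of isometries *)

(** Besides the group law, the action is strongly continuous, bounded sequences of
translations converge along ultrafilters, and what is carried to infinity tends
weakly to zero. *)
Record dislocations (R : realType) (V : zmodType) (H : semiHilbert R V)
    (X : zmodType) := Dislocations {
  act : X -> V -> V;
  dist0 : X -> R;
  act_dom : forall x f, dom H f -> dom H (act x f);
  actB : forall x f g, act x (f - g) = act x f - act x g;
  act_comp : forall x y f, act x (act y f) = act (x + y) f;
  act0 : forall f, act 0 f = f;
  act_ip : forall x f g, dom H f -> dom H g -> ip H (act x f) (act x g) = ip H f g;
  dist0_ge0 : forall x, 0 <= dist0 x;
  dist0D : forall x y, dist0 (x + y) <= dist0 x + dist0 y;
  dist0N : forall x, dist0 (- x) = dist0 x;
  dist0_unbounded : forall M : R, exists x, M <= dist0 x;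
  dist0_compact : forall (F : set_system nat), UltraFilter F ->
    forall (y : nat -> X) (M : R), (\forall l \near F, dist0 (y l) <= M) ->
    exists y0, dist0 (y l - y0) @[l --> F] --> (0 : R);
  act_vanish : forall f g, dom H f -> dom H g -> forall e : R, 0 < e ->
    exists M, forall x, M <= dist0 x -> `|ip H (act x f) g| <= e;
  act_continuous : forall f, dom H f -> forall e : R, 0 < e ->
    exists2 delta : R, 0 < delta & forall x, dist0 x < delta ->
      ip H (act x f - f) (act x f - f) <= e }.

Section profiles.
Context {R : realType} {V : zmodType} {H : semiHilbert R V} {X : zmodType}.
Variable G : dislocations H X.
Local Notation D := (dom H).
Local Notation ip := (ip H).
Local Notation act := (act G).
Local Notation dist0 := (dist0 G).
Implicit Types (r : nat -> V) (x : nat -> X) (f g h : V).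
#[local] Hint Resolve dom0 domD domN domZ domB act_dom : core.

Definition hbounded r := (forall l, D (r l)) /\ exists B, forall l, ip (r l) (r l) <= B.

Definition weak_cvg (F : set_system nat) r h := D h /\ forall g, D g -> ip (r l) g @[l --> F] --> ip h g.

Definition back x r : nat -> V := fun l => act (- x l) (r l).

Lemma ip_normr f g (A B : R) : D f -> D g -> ip f f <= A -> ip g g <= B ->
  0 <= B -> `|ip f g| <= A * B + 1.
Proof.
move=> Df Dg fA gB B0; rewrite -sqrtr_sqr -[leRHS]ger0_norm; last first.
  by rewrite addr_ge0// mulr_ge0//; apply: le_trans fA; exact: ip_ge0.
rewrite -sqrtr_sqr ler_wsqrtr//.
have := cauchy_schwarz Df Dg; have := ip_ge0 H f; have := ip_ge0 H g => g0 f0 h.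
have AB : ip f f * ip g g <= A * B by apply: ler_pM.
by rewrite expr2; nra.
Qed.

Lemma ip_small f g (A B e : R) : D f -> D g -> 0 < e -> ip f f <= A ->
  ip g g <= B -> A * B <= e ^+ 2 -> `|ip f g| <= e.
Proof.
move=> Df Dg e0 fA gB AB; rewrite -sqrtr_sqr -[e]gtr0_norm// -sqrtr_sqr.
rewrite ler_wsqrtr//; apply: le_trans (cauchy_schwarz Df Dg) (le_trans _ AB).
by apply: ler_pM; rewrite ?ip_ge0.
Qed.

Section along.
Variable F : set_system nat.
Context {FF : UltraFilter F}.

Lemma weak_compactness r : hbounded r -> exists h, weak_cvg F r h.
Proof.
move=> [Dr [B rB]].
have B0 : 0 <= B by apply: le_trans (rB 0); exact: ip_ge0.
have c g : exists v : R, D g -> ip (r l) g @[l --> F] --> v.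
  have [Dg|] := pselect (D g); last by exists 0.
  have [|v vP] := @bounded_ultra_cvg _ F _ R (fun l => ip (r l) g) (B * ip g g + 1).
    by move=> l; apply: ip_normr; rewrite ?ip_ge0.
  by exists v.
have [phi phiP] := choice c.
have uni (a : nat -> R) (v w : R) : a @ F --> v -> a @ F --> w -> v = w.
  by move=> av aw; exact: cvg_unique av aw.
have [|||h Dh hP] := @riesz_representation _ _ H phi B B0.
- move=> f g Df Dg; apply: uni (phiP _ (domD Df Dg)) _.
  under eq_fun do rewrite ipDr//.
  by apply: cvgD; exact: phiP.
- move=> a f Df; apply: uni (phiP _ (domZ a Df)) _.
  under eq_fun do rewrite ipZr//.
  by apply: cvgMr; exact: phiP.
- move=> f Df.
  have h : ip (r l) f ^+ 2 @[l --> F] --> phi f ^+ 2.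
    under eq_fun do rewrite expr2.
    by rewrite expr2; apply: cvgM; exact: phiP.
  apply: (cvgr_to_le h); apply: filterE => l.
  by apply: le_trans (cauchy_schwarz (Dr l) Df) _; rewrite ler_wpM2r ?ip_ge0.
- exists h; split => // g Dg; rewrite -hP//; exact: phiP.
Qed.

Definition wlim r : V := xget 0 [set h | weak_cvg F r h].

Lemma wlimP r : hbounded r -> weak_cvg F r (wlim r).
Proof. by move=> /weak_compactness hP; exact: xgetPex hP. Qed.

Lemma hbounded_back x r : hbounded r -> hbounded (back x r).
Proof.
by move=> [Dr [B rB]]; split=> [l|]; [rewrite /back; auto|exists B => l; rewrite act_ip].
Qed.

Lemma ip_wlim_le r (B : R) : hbounded r -> (\forall l \near F, ip (r l) (r l) <= B) ->
  ip (wlim r) (wlim r) <= B.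
Proof.
move=> br rB; have [Dh hP] := wlimP br; have [Dr _] := br.
set h := wlim r in Dh hP *.
have : 2 * ip (r l) h - ip h h @[l --> F] --> 2 * ip h h - ip h h.
  by apply: cvgB; [apply: cvgMr; exact: hP|exact: cvg_cst].
move=> /cvgr_to_le c; have -> : ip h h = 2 * ip h h - ip h h by ring.
apply: c; near=> l.
have := ip_ge0 H (r l - h); rewrite ip_sqrB//.
have : ip (r l) (r l) <= B by near: l.
lra.
Unshelve. all: by end_near. Qed.

(** The translations of the next profile: their weak limit is nearly as large as
possible and, when no weak limit is nonzero, they escape from the former ones,
whose sizes [b] bounds. *)
Definition is_near_optimal r (b : nat -> R) x :=
  (forall x', ip (wlim (back x' r)) (wlim (back x' r)) <=
     2 * ip (wlim (back x r)) (wlim (back x r))) /\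
  (ip (wlim (back x r)) (wlim (back x r)) = 0 ->
     forall l, b l + l%:R <= dist0 (x l)).

Lemma near_optimal_exists r (b : nat -> R) : hbounded r -> exists x, is_near_optimal r b x.
Proof.
move=> br; have [Dr [B rB]] := br.
pose v x := ip (wlim (back x r)) (wlim (back x r)).
have vB x : v x <= B.
  apply: ip_wlim_le; first exact: hbounded_back.
  by apply: filterE => l; rewrite act_ip.
have hs : has_sup (range v).
  by split; [exists (v (fun=> 0)); exists (fun=> 0)|exists B => _ [x _ <-]].
have vs x : v x <= sup (range v) by apply: ub_le_sup; [exact: hs.2|exists x].
have [s0|s0] := ltP 0 (sup (range v)).
  have [|_ [x _ <-] xs] := @sup_adherent _ (range v) (sup (range v) / 2) _ hs.
    by rewrite divr_gt0.
  exists x; split => [x'|x0]; last by rewrite -/(v x) in x0; lra.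
  by rewrite -!/(v _); have := vs x'; lra.
have /choice[x xP] : forall l : nat, exists y : X, b l + l%:R <= dist0 y.
  by move=> l; exact: dist0_unbounded.
exists x; split => // x'; apply: (@le_trans _ _ 0).
  exact: le_trans (vs x') s0.
by rewrite mulr_ge0 ?ip_ge0.
Qed.

Definition near_optimal r b : nat -> X := xget (fun=> 0)
  [set x | is_near_optimal r b x].

Lemma near_optimalP r b (x := near_optimal r b) : hbounded r -> is_near_optimal r b x.
Proof.
move=> br; have [x0 x0P] := near_optimal_exists b br.
rewrite {}/x /near_optimal; set P := (X in xget _ X).
by have : P (xget (fun=> 0) P) by apply: xgetPex; exists x0.
Qed.

Section extraction.
Hypothesis Foo : \oo `<=` F.
Variable g0 : nat -> V.
Hypothesis g0b : hbounded g0.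

(** The second component bounds the sizes of the translations chosen so far. *)
Fixpoint stage k : (nat -> V) * (nat -> R) :=
  match k with
  | 0 => (g0, fun=> 0)
  | k'.+1 => let r := (stage k').1 in let b := (stage k').2 in
             let x := near_optimal r b in
             (fun l => r l - act (x l) (wlim (back x r)), fun l => b l + dist0 (x l))
  end.

Definition remainder k := (stage k).1.
Definition translation k := near_optimal (stage k).1 (stage k).2.
Definition profile k := wlim (back (translation k) (remainder k)).

Lemma remainderS k l :
  remainder k.+1 l = remainder k l - act (translation k l) (profile k).
Proof. by []. Qed.

Lemma remainderE k l :
  remainder k l = g0 l - \sum_(j < k) act (translation j l) (profile j).
Proof.
elim: k => [|k IH]; first by rewrite big_ord0 subr0.
by rewrite remainderS IH big_ord_recr /= opprD addrA.
Qed.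

Lemma dist0_translation k j l : (j < k)%N -> dist0 (translation j l) <= (stage k).2 l.
Proof.
have s0 i : 0 <= (stage i).2 l.
  by elim: i => //= i IH; rewrite addr_ge0// dist0_ge0.
elim: k => // k IH; rewrite ltnS leq_eqVlt => /predU1P[->|/IH h] /=.
  by rewrite lerDr.
by rewrite -/(translation k) ler_wpDr// dist0_ge0.
Qed.

Lemma act_adj y f g : D f -> D g -> ip (act (- y) f) g = ip f (act y g).
Proof.
by move=> Df Dg; rewrite -(act_ip G y) ?act_comp ?subrr ?act0; auto.
Qed.

Lemma dom_wlim r : D (wlim r).
Proof. by rewrite /wlim; case: xgetP => [h _ []|] //; auto. Qed.
#[local] Hint Resolve dom_wlim : core.

Lemma hbounded_remainder k : hbounded (remainder k).
Proof.
elim: k => // k [Dr [B rB]]; split => [l|]; first by rewrite remainderS /profile; auto.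
exists (2 * B + 2 * ip (profile k) (profile k)) => l; rewrite remainderS.
apply: le_trans (ip_sqrD_le _ _) _; rewrite ?ipNl ?ipNr ?opprK ?act_ip /profile; auto.
by rewrite lerD2r; have := rB l; lra.
Qed.

Lemma dom_remainder k l : D (remainder k l).
Proof. by have [] := hbounded_remainder k. Qed.
Lemma dom_profile k : D (profile k). Proof. exact: dom_wlim. Qed.
#[local] Hint Resolve dom_remainder dom_profile : core.

Lemma profileP k : weak_cvg F (back (translation k) (remainder k)) (profile k).
Proof. by apply/wlimP/hbounded_back/hbounded_remainder. Qed.

Lemma energy_cvg k :
  ip (remainder k l) (remainder k l) - ip (g0 l) (g0 l) +
    \sum_(j < k) ip (profile j) (profile j) @[l --> F] --> (0 : R).
Proof.
elim: k => [|k IH].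
  under eq_fun do rewrite big_ord0 addr0 subrr.
  exact: cvg_cst.
pose c := ip (profile k) (profile k).
have cP : 2 * c - 2 * ip (back (translation k) (remainder k) l) (profile k)
    @[l --> F] --> 2 * c - 2 * c.
  by apply: cvgB; [exact: cvg_cst|apply: cvgMr; exact: (profileP k).2].
rewrite subrr in cP; pose proof (cvgD IH cP) as h; rewrite addr0 in h.
apply: (cvg_ext h) => l; rewrite !fctE remainderS ip_sqrB ?act_ip; auto.
rewrite big_ord_recr /= -/c /back act_adj; auto; ring.
Qed.

Lemma energy_le (B : R) k : (forall l, ip (g0 l) (g0 l) <= B) ->
  \sum_(j < k) ip (profile j) (profile j) <= B.
Proof.
move=> gB; rewrite -subr_le0.
apply: (cvgr_to_ge (energy_cvg k)); apply: filterE => l.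
have := gB l; have := ip_ge0 H (remainder k l); lra.
Qed.

Lemma remainder_near_le (B : R) k : (forall l, ip (g0 l) (g0 l) <= B) ->
  \forall l \near F, ip (remainder k l) (remainder k l) <= B + 1.
Proof.
move=> gB; have /cvgrPdist_lt/(_ 1 ltr01) := energy_cvg k.
apply: filterS => l; rewrite sub0r normrN ltr_norml => /andP[_].
have := gB l; have : 0 <= \sum_(j < k) ip (profile j) (profile j).
  by apply: sumr_ge0 => j _; exact: ip_ge0.
lra.
Qed.

(** If [x_k - x_j] stayed bounded, it would converge along the ultrafilter, and
then, by strong continuity, translating by [x_k] would give the same weak limit,
zero, as translating by [x_j]. *)
Lemma translation_diverge j k :
  (forall h, D h -> ip (back (translation j) (remainder k) l) h @[l --> F] --> (0:R)) ->
  (j < k)%N -> forall M : R, \forall l \near F, M < dist0 (translation k l - translation j l).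
Proof.
move=> w0 jk M.
have [_ opt2] := near_optimalP (stage k).2 (hbounded_remainder k).
have [U0|U0] := eqVneq (ip (profile k) (profile k)) 0.
  have /= lM : \forall l \near F, M < l%:R :> R.
    by apply: Foo; exact: nbhs_infty_gtr.
  apply: filterS lM => l lM; apply: (lt_le_trans lM).
  have := opt2 U0 l; have := dist0_translation l jk; rewrite -/(translation k).
  have := dist0D G (translation k l - translation j l) (translation j l).
  rewrite subrK; lra.
have [//|FM] := in_ultra_setVsetC [set l | M < dist0 (translation k l - translation j l)] FF.
have [|y0 y0P] := @dist0_compact _ _ _ _ G F FF
    (fun l => translation k l - translation j l) M.
  by apply: filterS FM => l /= /negP; rewrite -leNgt.
case/eqP: U0; set U := profile k.
have DU : D U by rewrite /U; auto.
suff : ip (back (translation k) (remainder k) l) U @[l --> F] --> (0 : R).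
  by apply: cvg_unique => //; exact: (profileP k).2.
have [_ [B rB]] := hbounded_remainder k.
have B0 : 0 <= B by apply: le_trans (rB 0); exact: ip_ge0.
have small : ip (back (translation k) (remainder k) l) U -
    ip (back (translation j) (remainder k) l) (act y0 U) @[l --> F] --> (0 : R).
  apply/cvgr0Pnorm_le => e e0.
  have [|dl dl0 dlP] := act_continuous G DU (e := e ^+ 2 / (B + 1)).
    by rewrite divr_gt0 ?exprn_gt0//; lra.
  move/cvgr0Pnorm_lt: y0P => /(_ _ dl0); apply: filterS => l.
  rewrite ger0_norm ?dist0_ge0// => /dlP.
  pose y := translation k l - translation j l - y0; rewrite -/y => hy.
  have -> : back (translation k) (remainder k) l =
      act (- (y + y0)) (back (translation j) (remainder k) l).
    have -> : y + y0 = translation k l - translation j l by exact: subrK.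
    by rewrite /back act_comp opprB addrC addKr.
  have Db : D (back (translation j) (remainder k) l) by rewrite /back; auto.
  rewrite act_adj// -ipNr; auto; rewrite -ipDr; auto.
  have -> : act (y + y0) U - act y0 U = act y0 (act y U - U).
    by rewrite actB act_comp [y0 + y]addrC.
  apply: (@ip_small _ _ B (e ^+ 2 / (B + 1))); auto.
  - by rewrite act_ip; auto.
  - by rewrite act_ip; auto.
  - rewrite mulrCA ler_piMr ?sqr_ge0// ler_pdivrMr; lra.
pose proof (cvgD small (w0 _ (act_dom G y0 DU))) as h; rewrite addr0 in h.
by apply: (cvg_ext h) => l; exact: subrK.
Qed.

Lemma remainder_weak0 k j : (j < k)%N -> forall h, D h ->
  ip (back (translation j) (remainder k) l) h @[l --> F] --> (0:R).
Proof.
elim: k j => // k IH j jk h Dh.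
have E l : back (translation j) (remainder k.+1) l =
  back (translation j) (remainder k) l -
  act (translation k l - translation j l) (profile k).
  by rewrite /back remainderS actB act_comp [- _ + _]addrC.
have Db l : D (back (translation j) (remainder k) l) by rewrite /back; auto.
have E2 : (fun l => ip (back (translation j) (remainder k.+1) l) h) = fun l =>
  ip (back (translation j) (remainder k) l) h -
  ip (act (translation k l - translation j l) (profile k)) h.
  by apply/funext => l; rewrite E ipDl ?ipNl; auto.
rewrite E2.
move: jk; rewrite ltnS leq_eqVlt => /predU1P[->|jk].
  pose proof (cvgB ((profileP k).2 _ Dh) (cvg_cst (ip (profile k) h))) as c.
  rewrite subrr in c.
  by apply: (cvg_ext c) => l; rewrite !fctE /= subrr act0.
rewrite -[X in _ --> X](subr0 0); apply: cvgB; first exact: IH.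
apply/cvgr0Pnorm_le => e e0.
have [M MP] := act_vanish G (dom_profile k) Dh e0.
have := translation_diverge (IH _ jk) jk M.
by apply: filterS => l /ltW; exact: MP.
Qed.

Lemma translation_cvgy j k : (j < k)%N ->
  forall M : R, \forall l \near F, M < dist0 (translation k l - translation j l).
Proof. by move=> jk; apply: translation_diverge => //; exact: remainder_weak0. Qed.

End extraction.
End along.
End profiles.

Section profile_theorem.
Context {R : realType} {V : zmodType} {H : semiHilbert R V} {X : zmodType}.
Variable G : dislocations H X.
Local Notation D := (dom H).
Local Notation ip := (ip H).
Local Notation act := (act G).
Local Notation dist0 := (dist0 G).
#[local] Hint Resolve dom0 domD domN domZ domB act_dom : core.

(** A weak limit point [e'] of the sequence satisfies
[|e'|^2 = lim_i lim_m <e_i, e_m> = 0]. *)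
Lemma weak0_of_self (e : nat -> V) : hbounded (H := H) e ->
  (forall m, ip (e i) (e m) @[i --> \oo] --> (0 : R)) ->
  forall h, D h -> ip (e i) h @[i --> \oo] --> (0 : R).
Proof.
move=> be e0 h Dh; apply/cvgr0Pnorm_lt => eps eps0.
pose P := [set i | eps <= `|ip (e i) h|].
apply: contrapT => nev.
have PW : ProperFilter (within P \oo).
  apply: Build_ProperFilter_ex => A [N _ NA]; apply: contrapT => nA; apply: nev.
  exists N => // i Ni /=; rewrite ltNge; apply/negP => Pi.
  by apply: nA; exists i; exact: NA.
have [F [FF PF]] := ultraFilterLemma PW.
have Foo : \oo `<=` F.
  by move=> A [N _ NA]; apply: PF; exists N => // i Ni _; exact: NA.
have FP : F P by apply: PF; exists 0 => // i _.
have [e' [De' e'P]] := weak_compactness (F := F) be.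
have [De _] := be.
have ortho m : ip e' (e m) = 0.
  apply: cvg_unique (e'P _ (De m)) _ => //.
  by apply: cvg_trans (e0 m) => A /Foo.
have e'0 : ip e' e' = 0.
  apply: cvg_unique (e'P _ De') _ => //.
  have -> : (fun l => ip (e l) e') = fun=> 0 by apply/funext => l; rewrite ipC ortho.
  exact: cvg_cst.
have := e'P _ Dh; rewrite (ip_null De' Dh e'0) => /cvgr0Pnorm_lt/(_ _ eps0) Fe.
have [i [Pi]] := filter_ex (filterI FP Fe).
by rewrite /= ltNge => /negP; apply.
Qed.

(** [N] detects profiles when a vector on which it is at least [rho] has a
translate on which one of two linear forms is not small; the forms depend on the
size of the vector and on [rho] alone.  Two real forms stand for a complex one. *)
Definition detects (N : V -> R) := forall M rho : R, 0 < rho -> exists c h1 h2,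
  [/\ 0 < c, D h1, D h2 & forall f, D f -> ip f f <= M -> rho <= N f ->
      exists x, c <= ip (act x f) h1 ^+ 2 + ip (act x f) h2 ^+ 2].

(** Repeatedly remove from the sequence a weak limit, along one ultrafilter, of its
translates, chosen with at least half of the largest possible energy.  By
orthogonality the energies of the profiles have sum at most [B].  If [N] stayed
away from zero on the remainders, some translates would have weak limits of
energy bounded below, and so would infinitely many profiles.  All the limits that
matter are countably many, so a subsequence realises them. *)
Theorem profile_decomposition (N : V -> R) (g0 : nat -> V) (B : R) :
  (forall l, D (g0 l)) -> (forall l, ip (g0 l) (g0 l) <= B) ->
  (forall f, 0 <= N f) ->
  (forall M, exists K, forall f, D f -> ip f f <= M -> N f <= K) ->
  detects N ->
  exists (sub : nat -> nat) (U : nat -> V) (x : nat -> nat -> X) (nu : nat -> R),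
  let r k l := g0 (sub l) - \sum_(j < k) act (x j l) (U j) in
  [/\ {homo sub : i j / (i < j)%N},
      forall k, D (U k) /\ \sum_(j < k) ip (U j) (U j) <= B,
      forall j k, (j < k)%N -> forall h, D h ->
        ip (act (- x j l) (r k l)) h @[l --> \oo] --> (0 : R) &
      forall j k, j <> k -> dist0 (x j l - x k l) @[l --> \oo] --> +oo] /\
  (forall k, N (r k l) @[l --> \oo] --> nu k) /\ nu k @[k --> \oo] --> (0 : R).
Proof.
move=> Dg gB N0 Nbd Ndet.
have [F [FF Foo]] := @ultraFilterLemma nat \oo _.
have bg : hbounded (H := H) g0 by split => //; exists B.
pose rem := remainder G F g0; pose x := translation G F g0; pose U := profile G F g0.
have brem k : hbounded (H := H) (rem k) by exact: hbounded_remainder.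
have DU k : D (U k) by exact: dom_profile.
have Nlim k : exists v : R, N (rem k l) @[l --> F] --> v.
  have [Dr [K rK]] := brem k; have [K' K'P] := Nbd K.
  by apply: (@bounded_ultra_cvg _ F _ R _ K') => l; rewrite ger0_norm// K'P.
have [nu nuP] := choice Nlim.
pose a (t : nat * nat * nat + nat * nat + nat) (i : nat) : R := match t with
  | inl (inl (j, k, m)) => if (j < k)%N then
       ip (back G (x j) (rem k) i) (back G (x j) (rem k) m) else 0
  | inl (inr (j, k)) => if (j < k)%N then (1 + dist0 (x k i - x j i))^-1 else 0
  | inr k => N (rem k i) end.
pose lim_a (t : nat * nat * nat + nat * nat + nat) : R :=
  match t with inr k => nu k | _ => 0 end.
have aP t : a t @ F --> lim_a t.
  case: t => [[[[j k] m]|[j k]]|k] /=; last exact: nuP.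
  - rewrite /a /=; have [jk|_] := boolP (j < k)%N; last exact: cvg_cst.
    apply: remainder_weak0 => //; rewrite /back.
    by apply: act_dom; have [] := brem k.
  - rewrite /a /=; have [jk|_] := boolP (j < k)%N; last exact: cvg_cst.
    apply/cvgr0Pnorm_lt => e e0.
    apply: filterS (translation_cvgy G Foo bg jk e^-1) => l le.
    rewrite ger0_norm ?invr_ge0 ?addr_ge0 ?dist0_ge0//.
    rewrite -[ltRHS]invrK ltf_pV2 ?posrE ?invr_gt0 ?ltr_pwDl ?dist0_ge0//.
    exact: ltW.
have [sub subh subP] := ultra_subsequence _ Foo aP.
exists sub, U, (fun j l => x j (sub l)), nu => r.
have rE k l : r k l = rem k (sub l) by rewrite /r /rem remainderE.
split; first split => //.
- by move=> k; split => //; exact: energy_le.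
- move=> j k jk.
  apply: (@weak0_of_self (fun l => act (- x j (sub l)) (r k l))).
    have [Dr [K rK]] := brem k; split => [l|]; first by rewrite rE; auto.
    by exists K => l; rewrite act_ip// rE.
  move=> m; have := subP (inl (inl (j, k, sub m))); rewrite /a /= jk => c.
  by apply: (cvg_ext c) => i /=; rewrite !rE.
- have key j k : (j < k)%N ->
      dist0 (x k (sub l) - x j (sub l)) @[l --> \oo] --> +oo.
    move=> jk; apply/cvgryPgt => M.
    have := subP (inl (inr (j, k))); rewrite /a /= jk => /cvgr0Pnorm_lt.
    have M0 : 0 < (2 + `|M|)^-1 by rewrite invr_gt0 ltr_pwDl.
    move=> /(_ _ M0); apply: filterS => l.
    rewrite ger0_norm ?invr_ge0 ?addr_ge0 ?dist0_ge0//.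
    have d0 := dist0_ge0 G (x k (sub l) - x j (sub l)).
    have M2 : 0 < 2 + `|M| by rewrite ltr_pwDl.
    rewrite ltf_pV2 ?posrE//; last by lra.
    by have := ler_norm M; lra.
  move=> j k /eqP; rewrite neq_ltn => /orP[jk|]; last exact: key.
  by apply: (cvg_ext (key _ _ jk)) => l; rewrite -(dist0N G) opprB.
split => [k|].
  have := subP (inr k); rewrite /a /= => c.
  by apply: (cvg_ext c) => l; rewrite rE.
have nu0 k : 0 <= nu k by apply: (cvgr_to_ge (nuP k)); exact: filterE.
(* each value above [rho] costs the profile at least [c], out of a total of [B] *)
have cost (rho : R) : 0 < rho -> exists2 c : R, 0 < c & forall k, rho < nu k -> c <= ip (U k) (U k).
  move=> rho0; have [c [h1 [h2 [c0 Dh1 Dh2 ch]]]] := Ndet (B + 1) rho rho0.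
  have h0 : 0 <= ip h1 h1 + ip h2 h2 by rewrite addr_ge0 ?ip_ge0.
  exists (c / (2 * (ip h1 h1 + ip h2 h2 + 1))).
    by rewrite divr_gt0// mulr_gt0// ltr_wpDl.
  move=> k rk.
  have [Dr _] := brem k.
  have FN : \forall l \near F, rho <= N (rem k l).
    by have /cvgr_ge := nuP k; exact.
  have FE := remainder_near_le (FF := FF) G bg k gB.
  have /choice[y yP] : forall l, exists y, rho <= N (rem k l) ->
      ip (rem k l) (rem k l) <= B + 1 ->
      c <= ip (act (- y) (rem k l)) h1 ^+ 2 + ip (act (- y) (rem k l)) h2 ^+ 2.
    move=> l; have [r1|] := pselect (rho <= N (rem k l)); last by exists 0.
    have [r2|] := pselect (ip (rem k l) (rem k l) <= B + 1); last by exists 0.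
    by have [y yP] := ch _ (Dr l) r2 r1; exists (- y); rewrite opprK.
  have bb := hbounded_back G y (brem k).
  have [Dw wP] := wlimP (F := F) bb; set w := wlim F _ in Dw wP.
  have cw : c <= ip w h1 ^+ 2 + ip w h2 ^+ 2.
    have cn : ip (back G y (rem k) l) h1 ^+ 2 + ip (back G y (rem k) l) h2 ^+ 2 @[l --> F]
        --> ip w h1 ^+ 2 + ip w h2 ^+ 2.
      rewrite !expr2; under eq_fun do rewrite !expr2.
      by apply: cvgD; apply: cvgM; exact: wP.
    by apply: (cvgr_to_ge cn); apply: filterS2 FN FE => l; exact: yP.
  have wU : ip w w <= 2 * ip (U k) (U k) :=
    (near_optimalP (FF := FF) G (stage G F g0 k).2 (brem k)).1 y.
  rewrite ler_pdivrMr ?mulr_gt0 ?ltr_wpDl//.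
  have := cauchy_schwarz Dw Dh1; have := cauchy_schwarz Dw Dh2.
  have := ip_ge0 H w; have := ip_ge0 H (U k) => *; nra.
apply/cvgr0Pnorm_le => rho rho0; have [c c0 cP] := cost rho rho0.
apply: contrapT => nev.
have often n : exists k, (n <= k)%N /\ rho < nu k.
  apply: contrapT => no; apply: nev; exists n => // k /= nk.
  rewrite ger0_norm// leNgt; apply/negP => rk; apply: no; by exists k.
have grow n : exists k, c *+ n <= \sum_(j < k) ip (U j) (U j).
  elim: n => [|n [k kP]]; first by exists 0; rewrite big_ord0.
  have [k' [kk' rk']] := often k; exists k'.+1.
  rewrite big_ord_recr /= mulrSr lerD ?cP//.
  apply: le_trans kP _; rewrite -(subnK kk') addnC big_split_ord /=.
  by rewrite lerDl sumr_ge0// => j _; exact: ip_ge0.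
have [k kP] := grow (Num.truncn (B / c)).+1.
have := le_trans kP (energy_le (FF := FF) G bg k gB); apply/negP; rewrite -ltNge.
by rewrite -mulr_natr mulrC -ltr_pdivrMr// Num.Theory.truncnS_gt.
Qed.

End profile_theorem.

(** * Integrals of complex functions *)


Section complex_numbers.
Context {R : realType}.
Implicit Types (z w : R[i]) (a b : R).

Lemma complex_ext z w : Re z = Re w -> Im z = Im w -> z = w.
Proof. by case: z w => [a b] [c e] /= -> ->. Qed.

Lemma ReD z w : Re (z + w) = Re z + Re w. Proof. by case: z w => [? ?] []. Qed.
Lemma ImD z w : Im (z + w) = Im z + Im w. Proof. by case: z w => [? ?] []. Qed.
Lemma ReN z : Re (- z) = - Re z. Proof. by case: z. Qed.
Lemma ImN z : Im (- z) = - Im z. Proof. by case: z. Qed.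
Lemma ReM z w : Re (z * w) = Re z * Re w - Im z * Im w.
Proof. by case: z w => [? ?] []. Qed.
Lemma ImM z w : Im (z * w) = Re z * Im w + Im z * Re w.
Proof. by case: z w => [? ?] []. Qed.
Lemma ReJ z : Re (z^*) = Re z. Proof. by case: z. Qed.
Lemma ImJ z : Im (z^*) = - Im z. Proof. by case: z. Qed.
Definition cE := (ReD, ImD, ReN, ImN, ReM, ImM, ReJ, ImJ).

Lemma cnormE z : cnorm z = Num.sqrt (Re z ^+ 2 + Im z ^+ 2).
Proof. by rewrite /cnorm normc_def. Qed.

Lemma cnorm_ge0 z : 0 <= cnorm z. Proof. by rewrite cnormE sqrtr_ge0. Qed.

Lemma sqr_cnorm z : cnorm z ^+ 2 = Re z ^+ 2 + Im z ^+ 2.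
Proof. by rewrite cnormE sqr_sqrtr// addr_ge0 ?sqr_ge0. Qed.

Lemma norm_cnorm z : `|z| = (cnorm z)%:C%C.
Proof. by rewrite cnormE normc_def. Qed.

Lemma cnormM z w : cnorm (z * w) = cnorm z * cnorm w.
Proof. by apply: complexI; rewrite -norm_cnorm normrM !norm_cnorm rmorphM. Qed.

Lemma cnormD z w : cnorm (z + w) <= cnorm z + cnorm w.
Proof. by rewrite -lecR rmorphD /= -!norm_cnorm ler_normD. Qed.

Lemma cnormN z : cnorm (- z) = cnorm z. Proof. by rewrite /cnorm normrN. Qed.
Lemma cnorm0 : cnorm (0 : R[i]) = 0. Proof. by rewrite /cnorm normr0. Qed.
Lemma cnormJ z : cnorm (z^*) = cnorm z.
Proof. by rewrite !cnormE !cE sqrrN. Qed.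
Lemma cnorm_real a : cnorm (a%:C)%C = `|a|.
Proof. by rewrite cnormE /= expr0n addr0 sqrtr_sqr. Qed.

Lemma cnorm_eq0 z : cnorm z = 0 -> z = 0.
Proof. by move=> h; apply/normr0_eq0; rewrite norm_cnorm h. Qed.

Lemma Re_le_cnorm z : `|Re z| <= cnorm z.
Proof. by rewrite cnormE -sqrtr_sqr ler_wsqrtr// lerDl sqr_ge0. Qed.

Lemma Im_le_cnorm z : `|Im z| <= cnorm z.
Proof. by rewrite cnormE -sqrtr_sqr ler_wsqrtr// lerDr sqr_ge0. Qed.

Lemma cnorm_le_ReIm z : cnorm z <= `|Re z| + `|Im z|.
Proof.
rewrite -[leRHS]ger0_norm ?addr_ge0// -sqrtr_sqr cnormE ler_wsqrtr//.
rewrite sqrrD !real_normK ?num_real//.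
by rewrite lerD2r lerDl mulrn_wge0// mulr_ge0.
Qed.

Lemma cnorm_expNi a : cnorm (expNi a) = 1.
Proof. by rewrite cnormE /= sqrrN cos2Dsin2 sqrtr1. Qed.

Lemma expNiD a b : expNi (a + b) = expNi a * expNi b.
Proof. by apply: complex_ext; rewrite /expNi !cE /= ?cosD ?sinD; ring. Qed.

Lemma expNiN a : expNi (- a) = (expNi a)^*.
Proof. by apply: complex_ext; rewrite /expNi !cE /= ?cosN ?sinN. Qed.

Lemma expNi0 : expNi (0 : R) = 1.
Proof. by apply: complex_ext; rewrite /expNi /= ?cos0 ?sin0 ?oppr0. Qed.

Lemma cJM z w : (z * w)^* = z^* * w^*.
Proof. by apply: complex_ext; rewrite !cE; ring. Qed.
Lemma conjc_real a : (a%:C%C)^* = a%:C%C.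
Proof. by apply: complex_ext; rewrite /= ?oppr0. Qed.

End complex_numbers.

Section complex_integral.
Context {d} {T : measurableType d} {R : realType} (m : {measure set T -> \bar R}).
Implicit Types (f g : T -> R[i]) (u v : T -> R).

Definition rint u := m.-integrable [set: T] (EFin \o u).
Definition cmeas f := measurable_fun [set: T] (Re \o f) /\ measurable_fun [set: T] (Im \o f).
Definition cint_able f := rint (Re \o f) /\ rint (Im \o f).
Definition cint f : R[i] := Complex (\int[m]_x Re (f x)) (\int[m]_x Im (f x)).

Lemma rint_meas u : rint u -> measurable_fun [set: T] u.
Proof. by move=> /measurable_int/measurable_EFinP. Qed.

Lemma rint_le u v : measurable_fun [set: T] u -> rint v ->
  (forall x, `|u x| <= v x) -> rint u.
Proof.
move=> mu iv uv; apply: (le_integrable _ _ _ iv) => //; first exact/measurable_EFinP.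
by move=> x _ /=; rewrite lee_fin (le_trans (uv x))// ler_norm.
Qed.

Lemma rintD u v : rint u -> rint v -> rint (fun x => u x + v x).
Proof. by move=> iu iv; apply: eq_integrable (integrableD _ iu iv). Qed.

Lemma rintZ a u : rint u -> rint (fun x => a * u x).
Proof. by move=> iu; apply: eq_integrable (integrableZl _ a iu). Qed.

Lemma rintN u : rint u -> rint (fun x => - u x).
Proof. by move=> /(rintZ (-1)); under eq_fun do rewrite mulN1r. Qed.

Lemma rint_norm u : rint u -> rint (fun x => `|u x|).
Proof. by move=> iu; exact: integrable_norm. Qed.

Lemma ge0_rintP u : measurable_fun [set: T] u -> (forall x, 0 <= u x) ->
  rint u <-> (\int[m]_x (u x)%:E < +oo)%E.
Proof.
move=> mu u0; split => [/integrableP[_]|h].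
  by apply: le_lt_trans; apply: ge0_le_integral => //=;
    do 1?[exact/measurable_EFinP]; [move=> x _; rewrite lee_fin|
    apply/measurable_EFinP/measurableT_comp => //|
    move=> x _; rewrite lee_fin ler_norm].
apply/integrableP; split; first exact/measurable_EFinP.
apply: le_lt_trans h; rewrite le_eqVlt; apply/orP; left; apply/eqP.
by apply: eq_integral => x _ /=; rewrite ger0_norm.
Qed.

Lemma cint_able_meas f : cint_able f -> cmeas f.
Proof. by move=> [/rint_meas ? /rint_meas]. Qed.

Lemma cmeasD f g : cmeas f -> cmeas g -> cmeas (fun x => f x + g x).
Proof.
move=> [f1 f2] [g1 g2]; split.
  by rewrite (_ : _ \o _ = (Re \o f) \+ (Re \o g)); [exact: measurable_funD|apply/funext=>x/=; rewrite cE].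
by rewrite (_ : _ \o _ = (Im \o f) \+ (Im \o g)); [exact: measurable_funD|apply/funext=>x/=; rewrite cE].
Qed.

Lemma cmeasM f g : cmeas f -> cmeas g -> cmeas (fun x => f x * g x).
Proof.
move=> [f1 f2] [g1 g2]; split.
  rewrite (_ : _ \o _ = (Re \o f) \* (Re \o g) \- (Im \o f) \* (Im \o g)).
    by apply: measurable_funB; exact: measurable_funM.
  by apply/funext=>x/=; rewrite cE.
rewrite (_ : _ \o _ = (Re \o f) \* (Im \o g) \+ (Im \o f) \* (Re \o g)).
  by apply: measurable_funD; exact: measurable_funM.
by apply/funext=>x/=; rewrite cE.
Qed.

Lemma cmeasN f : cmeas f -> cmeas (fun x => - f x).
Proof.
move=> [f1 f2]; split.
  by rewrite (_ : _ \o _ = \- (Re \o f)); [exact: measurable_funN|apply/funext=>x/=; rewrite cE].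
by rewrite (_ : _ \o _ = \- (Im \o f)); [exact: measurable_funN|apply/funext=>x/=; rewrite cE].
Qed.

Lemma cmeasJ f : cmeas f -> cmeas (fun x => (f x)^*).
Proof.
move=> [f1 f2]; split.
  by rewrite (_ : _ \o _ = Re \o f)//; apply/funext=>x/=; rewrite cE.
by rewrite (_ : _ \o _ = \- (Im \o f)); [exact: measurable_funN|apply/funext=>x/=; rewrite cE].
Qed.

Lemma cmeas_cst (c : R[i]) : cmeas (fun=> c).
Proof. by split; exact: measurable_cst. Qed.

Lemma cmeas_real u : measurable_fun [set: T] u -> cmeas (fun x => (u x)%:C%C).
Proof. by move=> mu; split => //; exact: measurable_cst. Qed.

Lemma cmeas_expNi u : measurable_fun [set: T] u -> cmeas (fun x => expNi (u x)).
Proof.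
move=> mu; split.
  by apply: (measurableT_comp (f := cos)) => //; apply: continuous_measurable_fun; exact: continuous_cos.
rewrite (_ : _ \o _ = \- (sin \o u))//; apply: measurable_funN.
by apply: (measurableT_comp (f := sin)) => //; apply: continuous_measurable_fun; exact: continuous_sin.
Qed.

Lemma meas_sqr_cnorm f : cmeas f -> measurable_fun [set: T] (fun x => cnorm (f x) ^+ 2).
Proof.
move=> [f1 f2]; under eq_fun do rewrite sqr_cnorm.
by apply: measurable_funD; exact: measurable_funX.
Qed.

Lemma meas_cnorm f : cmeas f -> measurable_fun [set: T] (fun x => cnorm (f x)).
Proof.
move=> mf; rewrite (_ : (fun _ => _) = Num.sqrt \o (fun x => cnorm (f x) ^+ 2)).
  apply: measurableT_comp; last exact: meas_sqr_cnorm.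
  by apply: continuous_measurable_fun; exact: sqrt_continuous.
by apply/funext => x /=; rewrite sqrtr_sqr ger0_norm// cnorm_ge0.
Qed.

Lemma cint_ableP f : cint_able f <-> cmeas f /\ rint (fun x => cnorm (f x)).
Proof.
split => [if_|[[f1 f2] ic]]; last first.
  split; apply: (rint_le _ ic) => //= x; first exact: Re_le_cnorm.
  exact: Im_le_cnorm.
have mf := cint_able_meas if_; split => //.
have := rintD (rint_norm if_.1) (rint_norm if_.2).
move/rint_le; apply; first exact: meas_cnorm.
by move=> x /=; rewrite ger0_norm ?cnorm_ge0// cnorm_le_ReIm.
Qed.

Lemma cint_able_real u : rint u -> cint_able (fun x => (u x)%:C%C).
Proof. by move=> iu; split => //; have := rintZ 0 iu; under eq_fun do rewrite mul0r. Qed.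

Lemma cint_able_le f u : cmeas f -> rint u -> (forall x, cnorm (f x) <= u x) -> cint_able f.
Proof.
move=> mf iu fu; apply/cint_ableP; split => //; apply: (rint_le _ iu).
  exact: meas_cnorm.
by move=> x; rewrite ger0_norm ?cnorm_ge0.
Qed.

Lemma cint_ableM f g (K : R) : cint_able f -> cmeas g ->
  (forall x, cnorm (g x) <= K) -> cint_able (fun x => f x * g x).
Proof.
move=> /cint_ableP[mf if_] mg gK.
apply: (@cint_able_le _ (fun x => K * cnorm (f x))); first exact: cmeasM.
  exact: rintZ.
by move=> x; rewrite cnormM mulrC ler_wpM2r// cnorm_ge0.
Qed.

Lemma cint_ableD f g : cint_able f -> cint_able g -> cint_able (fun x => f x + g x).
Proof.
move=> [f1 f2] [g1 g2]; split.
  by rewrite (_ : _ \o _ = fun x => Re (f x) + Re (g x)); [exact: rintD|apply/funext=>x/=; rewrite cE].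
by rewrite (_ : _ \o _ = fun x => Im (f x) + Im (g x)); [exact: rintD|apply/funext=>x/=; rewrite cE].
Qed.

Lemma cint_ableJ f : cint_able f -> cint_able (fun x => (f x)^*).
Proof.
move=> [f1 f2]; split.
  by rewrite (_ : _ \o _ = fun x => Re (f x))//; apply/funext=>x/=; rewrite cE.
by rewrite (_ : _ \o _ = fun x => - Im (f x)); [exact: rintN|apply/funext=>x/=; rewrite cE].
Qed.

Lemma cint_ableZ c f : cint_able f -> cint_able (fun x => c * f x).
Proof.
move=> if_; have := cint_ableM if_ (cmeas_cst c) (fun=> lexx (cnorm c)).
by under eq_fun do rewrite mulrC.
Qed.

Lemma eq_cint f g : (forall x, f x = g x) -> cint f = cint g.
Proof. by move=> /funext ->. Qed.

Lemma cintD f g : cint_able f -> cint_able g ->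
  cint (fun x => f x + g x) = cint f + cint g.
Proof.
move=> [f1 f2] [g1 g2]; rewrite /cint; apply: complex_ext; rewrite !cE /=.
  by rewrite -RintegralD//; apply: eq_Rintegral => x _; rewrite cE.
by rewrite -RintegralD//; apply: eq_Rintegral => x _; rewrite cE.
Qed.

Lemma cintZ c f : cint_able f -> cint (fun x => c * f x) = c * cint f.
Proof.
move=> [f1 f2]; rewrite /cint; apply: complex_ext; rewrite !cE /=.
  rewrite -!RintegralZl// -RintegralB//; try exact: rintZ.
  by apply: eq_Rintegral => x _; rewrite cE.
rewrite -!RintegralZl// -RintegralD//; try exact: rintZ.
by apply: eq_Rintegral => x _; rewrite cE.
Qed.

Lemma cintJ f : cint_able f -> cint (fun x => (f x)^*) = (cint f)^*.
Proof.
move=> [f1 f2]; rewrite /cint; apply: complex_ext; rewrite !cE /=.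
  by apply: eq_Rintegral => x _; rewrite cE.
rewrite -[RHS]mulN1r -RintegralZl//.
by apply: eq_Rintegral => x _; rewrite cE mulN1r.
Qed.

(** Rotate the value of the integral onto the positive axis. *)
Lemma cnorm_cint f : cint_able f -> cnorm (cint f) <= \int[m]_x cnorm (f x).
Proof.
move=> if_; have [_ ic] := (cint_ableP f).1 if_.
have [z0|z0] := eqVneq (cnorm (cint f)) 0.
  by rewrite z0; apply: Rintegral_ge0 => x _; exact: cnorm_ge0.
have z_gt0 : 0 < cnorm (cint f) by rewrite lt_neqAle eq_sym z0 cnorm_ge0.
rewrite -(ler_pM2l z_gt0) -expr2.
have -> : cnorm (cint f) ^+ 2 = Re ((cint f)^* * cint f).
  by rewrite sqr_cnorm !cE; ring.
set z := cint f in z0 z_gt0 *.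
rewrite -cintZ// -RintegralZl//; apply: le_Rintegral => //.
- by have [] := cint_ableZ z^* if_.
- exact: rintZ.
- move=> x _; apply: le_trans (ler_norm _) _; apply: le_trans (Re_le_cnorm _) _.
  by rewrite cnormM cnormJ.
Qed.

End complex_integral.

Section complex_fubini.
Context d1 d2 (T1 : measurableType d1) (T2 : measurableType d2) (R : realType).
Variables (m1 : {sigma_finite_measure set T1 -> \bar R}).
Variables (m2 : {sigma_finite_measure set T2 -> \bar R}).

Lemma rfubini12 (u : T1 * T2 -> R) : rint (m1 \x m2)%E u ->
  \int[m1]_x \int[m2]_y u (x, y) = \int[(m1 \x m2)%E]_z u z /\
  rint m1 (fun x => \int[m2]_y u (x, y)).
Proof.
move=> iu; have a1 := ae_integrable1 iu; have iF := integrable_fubini_F iu.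
have ae : {ae m1, forall x, setT x -> fubini_F m2 (EFin \o u) x =
    (\int[m2]_y u (x, y))%:E}.
  apply: filterS a1 => x ix _; rewrite /fubini_F /Rintegral fineK//.
  exact: integrable_fin_num.
have mF : measurable_fun setT (EFin \o (fun x => \int[m2]_y u (x, y))).
  have mF := measurable_fubini_F iu.
  apply/measurable_EFinP.
  rewrite (_ : (fun _ => _) = fine \o fubini_F m2 (EFin \o u))//.
  by apply: measurableT_comp.
split; last first.
  apply/integrableP; split => //; have /integrableP[mF' hF] := iF.
  apply: le_lt_trans hF; rewrite le_eqVlt; apply/orP; left; apply/eqP.
  apply: ge0_ae_eq_integral => //; try exact: measurableT_comp.
  by apply: filterS ae => x h _; rewrite h.
rewrite /Rintegral -(integral12_prod_meas1 iu); congr fine.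
apply: ae_eq_integral => //; first exact: measurable_fubini_F iu.
by apply: filterS ae => x h _; rewrite h.
Qed.

Lemma rfubini21 (u : T1 * T2 -> R) : rint (m1 \x m2)%E u ->
  \int[m2]_y \int[m1]_x u (x, y) = \int[(m1 \x m2)%E]_z u z /\
  rint m2 (fun y => \int[m1]_x u (x, y)).
Proof.
move=> iu; have a1 := ae_integrable2 iu.
have iF : m2.-integrable setT (fubini_G m1 (EFin \o u)).
  have mu := measurable_int _ iu.
  apply/integrableP; split; first exact: measurable_fubini_G iu.
  apply: le_lt_trans ((integrable21ltyP m1 m2 mu).1 iu).
  apply: ge0_le_integral => //.
  - by apply: measurableT_comp => //; exact: measurable_fubini_G iu.
  - apply: (measurable_fun_fubini_tonelli_G (abse \o (EFin \o u))) => //=.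
    exact: measurableT_comp.
  - move=> y _; apply: le_abse_integral => //.
    exact: measurableT_comp mu (measurable_pair2 _).
have ae : {ae m2, forall y, setT y -> fubini_G m1 (EFin \o u) y =
    (\int[m1]_x u (x, y))%:E}.
  apply: filterS a1 => x ix _; rewrite /fubini_G /Rintegral fineK//.
  exact: integrable_fin_num.
have mF : measurable_fun setT (EFin \o (fun y => \int[m1]_x u (x, y))).
  have mF := measurable_fubini_G iu.
  apply/measurable_EFinP.
  rewrite (_ : (fun _ => _) = fine \o fubini_G m1 (EFin \o u))//.
  by apply: measurableT_comp.
split; last first.
  apply/integrableP; split => //; have /integrableP[mF' hF] := iF.
  apply: le_lt_trans hF; rewrite le_eqVlt; apply/orP; left; apply/eqP.
  apply: ge0_ae_eq_integral => //; try exact: measurableT_comp.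
  by apply: filterS ae => x h _; rewrite h.
rewrite /Rintegral -(integral21_prod_meas1 iu); congr fine.
apply: ae_eq_integral => //; first exact: measurable_fubini_G iu.
by apply: filterS ae => x h _; rewrite h.
Qed.

Lemma cint_able_fubini (G : T1 * T2 -> R[i]) : cint_able (m1 \x m2)%E G ->
  cint_able m1 (fun x => cint m2 (fun y => G (x, y))) /\
  cint_able m2 (fun y => cint m1 (fun x => G (x, y))).
Proof.
move=> [i1 i2]; split; split.
- exact: (rfubini12 i1).2.
- exact: (rfubini12 i2).2.
- exact: (rfubini21 i1).2.
- exact: (rfubini21 i2).2.
Qed.

Lemma cfubini (G : T1 * T2 -> R[i]) : cint_able (m1 \x m2)%E G ->
  cint m1 (fun x => cint m2 (fun y => G (x, y))) =
  cint m2 (fun y => cint m1 (fun x => G (x, y))).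
Proof.
move=> [i1 i2]; apply: complex_ext => /=.
  by rewrite (rfubini12 i1).1 (rfubini21 i1).1.
by rewrite (rfubini12 i2).1 (rfubini21 i2).1.
Qed.

Lemma rint_tensor (u : T1 -> R) (v : T2 -> R) : rint m1 u -> rint m2 v ->
  rint (m1 \x m2)%E (fun z => u z.1 * v z.2).
Proof.
move=> iu iv; have mu := rint_meas iu; have mv := rint_meas iv.
have m : measurable_fun setT (EFin \o fun z : T1 * T2 => u z.1 * v z.2).
  apply/measurable_EFinP/measurable_funM.
    exact: measurableT_comp mu measurable_fst.
  exact: measurableT_comp mv measurable_snd.
apply/(integrable12ltyP m1 m2 m).
have vlt : (\int[m2]_y `|(v y)%:E| < +oo)%E by have /integrableP[] := iv.
rewrite (_ : (fun _ => _) = fun x => (`|(u x)%:E| * \int[m2]_y `|(v y)%:E|)%E); last first.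
  apply/funext => x; rewrite -ge0_integralZl//; last first.
    by apply: measurableT_comp => //; exact/measurable_EFinP.
  by apply: eq_integral => y _; rewrite /= normrM EFinM.
rewrite ge0_integralZr//; last 2 first.
- by apply: measurableT_comp => //; exact/measurable_EFinP.
- exact: integral_ge0.
by apply: lte_mul_pinfty => //; [exact: integral_ge0|
  rewrite ge0_fin_numE ?integral_ge0//; have /integrableP[] := iu].
Qed.

End complex_fubini.

Section complex_tensor.
Context d1 d2 (T1 : measurableType d1) (T2 : measurableType d2) (R : realType).
Variables (m1 : {sigma_finite_measure set T1 -> \bar R}).
Variables (m2 : {sigma_finite_measure set T2 -> \bar R}).

Lemma cmeas_fst (f : T1 -> R[i]) : cmeas f -> cmeas (fun z : T1 * T2 => f z.1).
Proof.
by move=> [h1 h2]; split;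
  [exact: measurableT_comp h1 measurable_fst|exact: measurableT_comp h2 measurable_fst].
Qed.

Lemma cmeas_snd (f : T2 -> R[i]) : cmeas f -> cmeas (fun z : T1 * T2 => f z.2).
Proof.
by move=> [h1 h2]; split;
  [exact: measurableT_comp h1 measurable_snd|exact: measurableT_comp h2 measurable_snd].
Qed.

Lemma cint_able_tensor (f : T1 -> R[i]) (g : T2 -> R[i]) (h : T1 * T2 -> R[i]) (K : R) :
  cint_able m1 f -> cint_able m2 g -> cmeas h -> (forall z, cnorm (h z) <= K) ->
  cint_able (m1 \x m2)%E (fun z => f z.1 * g z.2 * h z).
Proof.
move=> /cint_ableP[mf if_] /cint_ableP[mg ig] mh hK; apply: (@cint_ableM _ _ _ _ _ _ K) => //.
apply: (@cint_able_le _ _ _ _ _ (fun z => cnorm (f z.1) * cnorm (g z.2))).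
- by apply: cmeasM; [exact: cmeas_fst|exact: cmeas_snd].
- exact: rint_tensor if_ ig.
- by move=> z; rewrite cnormM.
Qed.

Lemma cint_tensor (f : T1 -> R[i]) (g : T2 -> R[i]) :
  cint_able m1 f -> cint_able m2 g ->
  cint_able (m1 \x m2)%E (fun z => f z.1 * g z.2) /\
  cint (m1 \x m2)%E (fun z => f z.1 * g z.2) = cint m1 f * cint m2 g.
Proof.
move=> if_ ig; have := cint_able_tensor if_ ig (cmeas_cst 1) (fun=> lexx _).
under eq_fun do rewrite mulr1; move=> ifg; split => //.
have [i1 i2] := ifg.
transitivity (cint m1 (fun x => cint m2 (fun y => f x * g y))).
  by apply: complex_ext => /=; [rewrite (rfubini12 i1).1|rewrite (rfubini12 i2).1].
rewrite mulrC -cintZ//; apply: eq_cint => x.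
by rewrite cintZ// mulrC.
Qed.

End complex_tensor.

(** * Lebesgue measure on row vectors *)

Section rV_measure.
Context {R : realType}.
Local Notation leb := (@lebesgue_measure R).

Lemma consv0 d (p : measurableTypeR R * 'rV[R]_d) : consv p ord0 ord0 = p.1.
Proof. by rewrite mxE; case: splitP => // j _; rewrite mxE !ord1 eqxx mulr1n. Qed.

Lemma consvS d (p : measurableTypeR R * 'rV[R]_d) (i : 'I_d) :
  consv p ord0 (lift ord0 i) = p.2 ord0 i.
Proof.
rewrite mxE; case: splitP => j ij; first by move: (ltn_ord j); rewrite -ij.
by congr (p.2 ord0 _); apply/val_inj; case: ij.
Qed.

Lemma rint_rVS d (F : 'rV[R]_d.+1 -> R) : measurable_fun setT F ->
  rint (leb \x lebesgue_rV d)%E (F \o @consv R d) ->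
  rint (lebesgue_rV d.+1) F /\
  \int[lebesgue_rV d.+1]_x F x =
    \int[(leb \x lebesgue_rV d)%E]_z F (consv z).
Proof.
move=> mF iF; have mF' : measurable_fun setT (EFin \o F) by exact/measurable_EFinP.
split.
  apply: (integrable_pushforward (@measurable_consv R d) mF') => //.
rewrite /Rintegral; congr fine.
exact: (integral_pushforward (@measurable_consv R d) mF' _ measurableT).
Qed.

Lemma ge0_integral_rVS d (F : 'rV[R]_d.+1 -> \bar R) : measurable_fun setT F ->
  (forall x, 0 <= F x)%E ->
  (\int[lebesgue_rV d.+1]_x F x =
    \int[leb]_a \int[lebesgue_rV d]_v F (consv (a : measurableTypeR R, v)))%E.
Proof.
move=> mF F0.
rewrite (ge0_integral_pushforward (@measurable_consv R d) _ measurableT mF)//.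
have mFc := measurableT_comp mF (@measurable_consv R d).
by rewrite preimage_setT (fubini_tonelli1 _ mFc (fun=> F0 _)).
Qed.

Lemma integral_rV0 (F : 'rV[R]_0 -> \bar R) (mF : measurable_fun setT F) :
  (\int[lebesgue_rV 0]_x F x = F 0%R)%E.
Proof. by rewrite integral_dirac// diracT mul1e. Qed.

Lemma meas_sum {d0} {T : measurableType d0} (I : Type) (r : seq I) (P : pred I)
    (h : I -> T -> R) :
  (forall i, measurable_fun setT (h i)) ->
  measurable_fun setT (fun x => \sum_(i <- r | P i) h i x).
Proof.
move=> mh; elim: r => [|i r IH].
  by under eq_fun do rewrite big_nil; exact: measurable_cst.
under eq_fun do rewrite big_cons.
by case: (P i) => //; exact: measurable_funD.
Qed.

Lemma meas_prod {d0} {T : measurableType d0} (I : Type) (r : seq I) (P : pred I)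
    (h : I -> T -> R) :
  (forall i, measurable_fun setT (h i)) ->
  measurable_fun setT (fun x => \prod_(i <- r | P i) h i x).
Proof.
move=> mh; elim: r => [|i r IH].
  by under eq_fun do rewrite big_nil; exact: measurable_cst.
under eq_fun do rewrite big_cons.
by case: (P i) => //; exact: measurable_funM.
Qed.

Lemma meas_coor d (i : 'I_d) : measurable_fun setT (fun x : 'rV[R]_d => x ord0 i).
Proof. exact: measurable_coord. Qed.

Lemma meas_prod_coor d (h : 'I_d -> R -> R) :
  (forall i, measurable_fun setT (h i)) ->
  measurable_fun setT (fun x : 'rV[R]_d => \prod_(i < d) h i (x ord0 i)).
Proof.
by move=> mh; apply: meas_prod => i; exact: measurableT_comp (mh i) (meas_coor i).
Qed.

Lemma ge0_integral_prod d (h : 'I_d -> R -> R) :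
  (forall i, measurable_fun setT (h i)) -> (forall i t, 0 <= h i t) ->
  (\int[lebesgue_rV d]_x (\prod_(i < d) h i (x ord0 i))%:E =
   \prod_(i < d) \int[leb]_t (h i t)%:E)%E.
Proof.
elim: d h => [|d IH] h mh h0.
  rewrite integral_rV0; first by rewrite !big_ord0.
  by apply/measurable_EFinP; exact: meas_prod_coor.
rewrite ge0_integral_rVS; last 2 first.
  by apply/measurable_EFinP; exact: meas_prod_coor.
  by move=> x; rewrite lee_fin prodr_ge0.
rewrite big_ord_recl /=.
have mhS i : measurable_fun setT (h (lift ord0 i)) by exact: mh.
rewrite -IH// -ge0_integralZr//; last 3 first.
- by apply/measurable_EFinP; exact: mh.
- by move=> t _; rewrite lee_fin.
- by apply: integral_ge0 => x _; rewrite lee_fin prodr_ge0.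
apply: eq_integral => a _.
rewrite -ge0_integralZl//; last 3 first.
- by apply/measurable_EFinP; exact: (meas_prod_coor mhS).
- by move=> x _; rewrite lee_fin prodr_ge0.
- by rewrite lee_fin.
apply: eq_integral => v _; rewrite -EFinM big_ord_recl consv0.
by congr (_ * _)%:E; apply: eq_bigr => i _; rewrite consvS.
Qed.

Lemma meas_dotv d (t : 'rV[R]_d) : measurable_fun setT (dotv t).
Proof.
apply: meas_sum => i; apply: measurable_funM; first exact: measurable_cst.
exact: meas_coor.
Qed.

(** Fubini, one coordinate at a time: the character of a sum is the product of the
characters of the coordinates. *)
Lemma cint_expNi_prod d (e : R -> R) (c : R -> R) (t : 'rV[R]_d) :
  rint leb e ->
  (forall a, cint leb (fun b => (e b)%:C%C * expNi (a * b)) = (c a)%:C%C) ->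
  rint (lebesgue_rV d) (fun xi => \prod_(i < d) e (xi ord0 i)) /\
  cint (lebesgue_rV d) (fun xi => (\prod_(i < d) e (xi ord0 i))%:C%C * expNi (dotv t xi))
  = (\prod_(i < d) c (t ord0 i))%:C%C.
Proof.
move=> ie cP; have me := rint_meas ie.
have me0 (a : R) : cint_able leb (fun b => (e b)%:C%C * expNi (a * b)).
  apply: (@cint_ableM _ _ _ leb (fun b => (e b)%:C%C) (fun b => expNi (a * b)) 1).
  - exact: cint_able_real.
  - by apply: cmeas_expNi; exact: measurable_funM.
  - by move=> b; rewrite cnorm_expNi.
elim: d t => [|d IH] t.
  have m1 : measurable_fun [set: 'rV[R]_0] (EFin \o (fun xi : 'rV[R]_0 => \prod_(i < 0) e (xi ord0 i))).
    by apply/measurable_EFinP; exact: (meas_prod_coor (fun=> me)).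
  split.
    apply/integrableP; split => //.
    rewrite (integral_rV0 (measurableT_comp (@abse_measurable R setT) m1)) /=.
    exact: ltry.
  have E : (fun xi : 'rV[R]_0 => (\prod_(i < 0) e (xi ord0 i))%:C%C * expNi (dotv t xi)) = fun=> 1.
    by apply/funext => xi; rewrite /dotv !big_ord0 mul1r expNi0.
  rewrite big_ord0 E; apply: complex_ext => /=.
    by rewrite /Rintegral integral_rV0.
  by rewrite /Rintegral integral_rV0.
have [iP EP] := IH (rsubmx (t : 'rV_(1 + d))).
have tS (i : 'I_d) : rsubmx (t : 'rV_(1 + d)) ord0 i = t ord0 (lift ord0 i).
  by rewrite mxE; congr (t _ _); exact/val_inj.
have prodS (z : measurableTypeR R * 'rV[R]_d) :
    \prod_(i < d.+1) e (consv z ord0 i) = e z.1 * \prod_(i < d) e (z.2 ord0 i).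
  by rewrite big_ord_recl consv0; congr (_ * _); apply: eq_bigr => i _; rewrite consvS.
split.
  apply: (rint_rVS _ _).1; first exact: (meas_prod_coor (fun=> me)).
  have := rint_tensor ie iP; congr (rint _ _).
  by apply/funext => z /=; rewrite prodS.
have iPe : cint_able (lebesgue_rV d) (fun xi => (\prod_(i < d) e (xi ord0 i))%:C%C *
    expNi (dotv (rsubmx (t : 'rV_(1 + d))) xi)).
  apply: (@cint_ableM _ _ _ (lebesgue_rV d) (fun xi => (\prod_(i < d) e (xi ord0 i))%:C%C)
    (fun xi => expNi (dotv (rsubmx (t : 'rV_(1 + d))) xi)) 1).
  - exact: cint_able_real.
  - by apply: cmeas_expNi; exact: meas_dotv.
  - by move=> b; rewrite cnorm_expNi.
have [[j1 j2] j3] := cint_tensor (me0 (t ord0 ord0)) iPe.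
have E z : (\prod_(i < d.+1) e (consv z ord0 i))%:C%C * expNi (dotv t (consv z)) =
   (e z.1)%:C%C * expNi (t ord0 ord0 * z.1) * ((\prod_(i < d) e (z.2 ord0 i))%:C%C *
    expNi (dotv (rsubmx (t : 'rV_(1 + d))) z.2)).
  have -> : dotv t (consv z) = t ord0 ord0 * z.1 + dotv (rsubmx (t : 'rV_(1 + d))) z.2.
    rewrite /dotv big_ord_recl consv0; congr (_ + _).
    by apply: eq_bigr => i _; rewrite consvS tS.
  rewrite prodS rmorphM /= expNiD.
  by ring.
have mF : cmeas (fun xi : 'rV[R]_d.+1 =>
    (\prod_(i < d.+1) e (xi ord0 i))%:C%C * expNi (dotv t xi)).
  apply: cmeasM; first by apply: cmeas_real; exact: (meas_prod_coor (fun=> me)).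
  by apply: cmeas_expNi; exact: meas_dotv.
transitivity (cint (leb \x lebesgue_rV d)%E (fun z =>
    (\prod_(i < d.+1) e (consv z ord0 i))%:C%C * expNi (dotv t (consv z)))).
  apply: complex_ext => /=.
    apply: (rint_rVS mF.1 _).2; move: j1; congr (rint _ _).
    by apply/funext => z; exact: (congr1 (@complex.Re R) (esym (E z))).
  apply: (rint_rVS mF.2 _).2; move: j2; congr (rint _ _).
  by apply/funext => z; exact: (congr1 (@complex.Im R) (esym (E z))).
rewrite (eq_cint _ E) j3 cP EP -rmorphM /= big_ord_recl; congr (_ * _)%:C%C.
by apply: eq_bigr => i _; rewrite tS.
Qed.

End rV_measure.

(** * Half-open boxes, translations *)

Section boxes.
Context {R : realType} {d : nat}.
Local Notation E := 'rV[R]_d.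
Local Notation leb := (@lebesgue_measure R).
Local Notation mu := (@lebesgue_rV R d).

Definition ocbox (a b : 'I_d -> R) : set E :=
  [set x | forall i, `]a i, b i]%classic (x ord0 i)].

Definition ocboxes : set (set E) := [set B | exists a b, B = ocbox a b].

Lemma measurable_rectangle (A : 'I_d -> set R) : (forall i, measurable (A i)) ->
  measurable [set x : E | forall i, A i (x ord0 i)].
Proof.
move=> mA; rewrite (_ : [set _ | _] = \big[setI/setT]_(i < d)
    ((fun x : 'rV[R]_d => x ord0 i) @^-1` A i)).
  apply: bigsetI_measurable => i _; rewrite -[X in measurable X]setTI.
  exact: measurable_coord.
rewrite -bigcap_seq; apply/seteqP; split => x /= Ax; first by move=> i _; exact: Ax.
by move=> i; apply: Ax; rewrite /= mem_index_enum.
Qed.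

Lemma measurable_ocbox a b : measurable (ocbox a b).
Proof.
apply: (measurable_rectangle (A := fun i => `]a i, b i]%classic)) => i.
exact: measurable_itv.
Qed.

Lemma ocboxI : setI_closed ocboxes.
Proof.
move=> _ _ [a [b ->]] [a' [b' ->]].
exists (fun i => Num.max (a i) (a' i)), (fun i => Num.min (b i) (b' i)).
apply/seteqP; split => [x [xB xB'] i|x xB].
  have := xB i; have := xB' i; rewrite /= !in_itv /= gt_max le_min.
  by move=> /andP[-> ->] /andP[-> ->].
split=> i; have := xB i; rewrite /= !in_itv /= gt_max le_min.
  by move=> /andP[/andP[-> _] /andP[-> _]].
by move=> /andP[/andP[_ ->] /andP[_ ->]].
Qed.

Definition cube (n : nat) : set E := ocbox (fun=> - n%:R) (fun=> n%:R).

Lemma mem_cube (x : E) : \forall n \near \oo, cube n x.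
Proof.
have [M MP] : exists M : R, forall i, `|x ord0 i| < M.
  exists (\sum_(i < d) `|x ord0 i| + 1) => i.
  by rewrite (bigD1 i)//= -addrA ltr_pwDr// ltr_wpDl// sumr_ge0.
have /cvgryPgt/(_ M) := @cvgr_idn R.
apply: filterS => n Mn i /=; have := lt_trans (MP i) Mn.
by rewrite in_itv /= ltr_norml => /andP[-> /ltW].
Qed.

Lemma bigcup_cube : \bigcup_n cube n = setT.
Proof.
rewrite -subTset => x _; have [n _ /(_ n (leqnn n)) xn] := mem_cube x.
by exists n.
Qed.

Lemma measurable_generated_ocboxes : @measurable _ E = <<s ocboxes >>.
Proof.
apply/seteqP; split; last first.
  apply: smallest_sub; first exact: sigma_algebra_measurable.
  by move=> _ [a [b ->]]; exact: measurable_ocbox.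
apply: smallest_sub; first exact: smallest_sigma_algebra.
rewrite -bigcup_seq; apply: bigcup_sub => i _ _ [Y mY <-]; rewrite setTI.
suff : @measurable _ (measurableTypeR R) `<=`
    [set Y | <<s ocboxes >> ((fun x : E => x ord0 i) @^-1` Y)] by apply.
apply: smallest_sub.
  split => /=.
  - by rewrite preimage_set0; exact: sigma_algebra0.
  - by move=> A; rewrite setTD preimage_setC; exact: sigma_algebraC.
  - by move=> A mA; rewrite preimage_bigcup; exact: sigma_algebra_bigcup.
move=> _ [[a b] _ <-] /=.
rewrite (_ : _ @^-1` _ = \bigcup_n ocbox (fun j => if j == i then a else - n%:R)
    (fun j => if j == i then b else n%:R)).
  by apply: sigma_algebra_bigcup => n; apply: sub_sigma_algebra; eexists; eexists.
apply/seteqP; split => [x /= xi|x [n _ /(_ i)]]; last by rewrite eqxx.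
have [n _ /(_ n (leqnn n)) xn] := mem_cube x; exists n => // j /=.
by case: ifPn => [/eqP->//|_]; exact: xn.
Qed.

Lemma lebesgue_rV_ocbox a b :
  mu (ocbox a b) = (\prod_(i < d) Num.max (b i - a i) 0)%:E.
Proof.
rewrite /ocbox (lebesgue_rV_box (A := fun i => `]a i, b i]%classic)); last first.
  by move=> i; exact: measurable_itv.
rewrite (big_morph EFin (id1 := 1%E) (op1 := *%E) EFinM)//.
apply: eq_bigr => i _; rewrite lebesgue_measure_itv /= lte_fin.
case: ltP => ab; first by rewrite max_l// subr_ge0 ltW.
by rewrite max_r// subr_le0.
Qed.

Lemma ocbox_lty a b : (mu (ocbox a b) < +oo)%E.
Proof. by rewrite lebesgue_rV_ocbox ltry. Qed.

Lemma meas_addl (x : E) : measurable_fun setT (fun y : E => y + x).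
Proof.
apply: measurable_fun_coordP => i; under eq_fun do rewrite mxE.
by apply: measurable_funD; [exact: meas_coor|exact: measurable_cst].
Qed.

Lemma lebesgue_rV_shift (x : E) (A : set E) : measurable A ->
  mu ((fun y => y + x) @^-1` A) = mu A.
Proof.
move=> mA; pose m' : {measure set E -> \bar R} :=
  measure_function_pushforward__canonical__measure_function_Measure mu (meas_addl x).
rewrite -[LHS]/(m' A).
apply: (measure_unique ocboxes cube measurable_generated_ocboxes ocboxI _ bigcup_cube) => //.
- by move=> n; eexists; eexists.
- move=> _ [a [b ->]]; rewrite [LHS]/(pushforward _ _ _).
  rewrite (_ : _ @^-1` _ = ocbox (fun i => a i - x ord0 i) (fun i => b i - x ord0 i)).
    refine (etrans (lebesgue_rV_ocbox _ _) _).
    refine (etrans _ (esym (lebesgue_rV_ocbox _ _))).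
    by congr EFin; apply: eq_bigr => i _; congr Num.max; ring.
  by apply/seteqP; split => y /= yA i; have := yA i; rewrite /= !in_itv /= mxE ltrBlDr lerBrDr.
- move=> n; rewrite [X in (X < _)%E]/(pushforward _ _ _).
  rewrite (_ : _ @^-1` _ = ocbox (fun i => - n%:R - x ord0 i) (fun i => n%:R - x ord0 i)).
    exact: ocbox_lty.
  by apply/seteqP; split => y /= yA i; have := yA i; rewrite /= !in_itv /= mxE ltrBlDr lerBrDr.
Qed.

Lemma ge0_integral_shift (x : E) (f : E -> \bar R) : measurable_fun setT f ->
  (forall y, 0 <= f y)%E -> (\int[mu]_y f (y + x)%R = \int[mu]_y f y)%E.
Proof.
move=> mf f0.
have := ge0_integral_pushforward (meas_addl x) mu measurableT mf.
rewrite preimage_setT => <-//.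
apply: eq_measure_integral; first exact: meas_addl.
by move=> mx A mA _; exact: lebesgue_rV_shift.
Qed.

(** On a cube, the measurable sets over which [h] has integral zero form a Dynkin
system; it contains the boxes, which are stable under intersection and generate. *)
Lemma ae0_of_ocbox (h : E -> R) : measurable_fun setT h ->
  (forall a b, mu.-integrable (ocbox a b) (EFin \o h) /\
     (\int[mu]_(x in ocbox a b) (h x)%:E = 0)%E) ->
  {ae mu, forall x, h x = 0}.
Proof.
move=> mh hP.
have Q n : {ae mu, forall x, cube n x -> h x = 0}.
  have [ih h0] := hP (fun=> - n%:R) (fun=> n%:R).
  have mQ : measurable (cube n) by exact: measurable_ocbox.
  suff key A : measurable A -> (\int[mu]_(x in cube n `&` A) (h x)%:E = 0)%E.
    have := @integral_ae_eq _ _ _ mu (cube n) mQ (cst 0%E) (EFin \o h) ih _ _.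
    move=> /(_ (measurable_cst _)) /=.
    have : forall A, A `<=` cube n -> measurable A ->
        (\int[mu]_(x in A) (h x)%:E = \int[mu]_(x in A) 0)%E.
      by move=> A AQ mA; rewrite integral0 -(setIidr AQ) key.
    move=> k /(_ k); apply: filterS => x + xQ => /(_ xQ) /=.
    by move=> [].
  rewrite measurable_generated_ocboxes => mA.
  pose L := [set A : set E | measurable A /\ (\int[mu]_(x in cube n `&` A) (h x)%:E = 0)%E].
  suff : <<s ocboxes >> `<=` L by move=> /(_ _ mA)[].
  apply: lambda_system_subset => //; first exact: ocboxI.
  - apply/dynkin_lambda_system; split.
    + by split; [exact: measurableT|rewrite setIT].
    + move=> B [mB B0]; split; first exact: measurableC.
      have : (\int[mu]_(x in (cube n `&` B) `|` (cube n `&` ~` B)) (h x)%:E = 0)%E.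
        by rewrite -setDE setUIDK.
      rewrite integral_setU.
      - by rewrite B0 add0e.
      - exact: measurableI.
      - by apply: measurableI => //; exact: measurableC.
      - by apply/measurable_EFinP; exact: measurable_funTS.
      - by apply/disj_set2P; rewrite setIACA setICr setI0.
    + move=> F tF LF; have mF k := (LF k).1; split; first exact: bigcupT_measurable.
      rewrite setI_bigcupr integral_bigcup.
      - by apply: eseries0 => k _ _; exact: (LF k).2.
      - exact: trivIset_setIl.
      - by move=> k; exact: measurableI.
      - by apply: (integrableS _ _ _ ih) => //; [apply: bigcupT_measurable => k; exact: measurableI|move=> x [k _ []]].
  - move=> _ [a [b ->]]; split; first exact: measurable_ocbox.
    have [a' [b' ->]] : ocboxes (cube n `&` ocbox a b).
      by apply: ocboxI; eexists; eexists.
    by have [] := hP a' b'.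
have : {ae mu, forall x n, cube n x -> h x = 0}.
  by apply/ae_foralln.
apply: filterS => x hx; have [n _ /(_ n (leqnn n)) xn] := mem_cube x.
exact: hx xn.
Qed.

End boxes.

(** * One-dimensional integrals: the Abel and Poisson kernels *)

Lemma fatou_le {d} {T : measurableType d} {R : realType} (m : {measure set T -> \bar R})
    (f_ : nat -> T -> R) (f : T -> R) (K : \bar R) :
  (forall n, measurable_fun setT (f_ n)) -> measurable_fun setT f ->
  (forall n x, 0 <= f_ n x) ->
  {ae m, forall x, f_ n x @[n --> \oo] --> f x} ->
  (forall n, (\int[m]_x (f_ n x)%:E <= K)%E) -> (\int[m]_x (f x)%:E <= K)%E.
Proof.
move=> mf_ mf f0 cf fK.
have f00 : {ae m, forall x, 0 <= f x}.
  by apply: filterS cf => x cx; apply: (cvgr_to_ge cx); exact: nearW.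
have mE n : measurable_fun setT (fun x => (f_ n x)%:E) by exact/measurable_EFinP.
have := @fatou _ _ _ m setT measurableT (fun n x => (f_ n x)%:E) mE
  (fun n x _ => f0 n x).
have -> : (\int[m]_x (f x)%:E = \int[m]_x limn_einf (fun n => (f_ n x)%:E))%E.
  apply: ae_eq_integral => //.
  - exact/measurable_EFinP.
  - apply: (@emeasurable_fun_cvg _ _ _ _ (fun n x => einfs (fun k => (f_ k x)%:E) n)).
      by move=> n; exact: measurable_fun_einfs.
    by move=> x _; rewrite limn_einf_lim; exact: is_cvg_einfs.
  apply: filterS cf => x cx _.
  have [|-> _] := @cvg_limn_einf_sup R (fun n => (f_ n x)%:E) (f x)%:E.
    exact: cvg_EFin (nearW _ _) cx.
  by [].
move=> h; apply: le_trans h _; rewrite limn_einf_lim; apply: lime_le.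
  exact: is_cvg_einfs.
by apply: nearW => n; apply: le_trans (fK n); apply: ereal_inf_lbound; exists n => /=.
Qed.

Section exhaustion.
Context {d} {T : measurableType d} {R : realType} (m : {measure set T -> \bar R}).
Variable Q : nat -> set T.
Hypothesis mQ : forall n, measurable (Q n).
Hypothesis Q_near : forall x, \forall n \near \oo, Q n x.

Lemma exhaust_cvg (f : T -> R) : rint m f ->
  \int[m]_(x in Q n) f x @[n --> \oo] --> \int[m]_x f x.
Proof.
move=> if_; have mf := rint_meas if_.
have [|||||_ _] := @dominated_convergence _ _ _ m setT measurableT
  (fun n x => (f x * \1_(Q n) x)%:E) (EFin \o f) (fun x => `|f x|%:E).
- by move=> n; apply/measurable_EFinP; apply: measurable_funM => //; exact: measurable_indic.
- exact/measurable_EFinP.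
- apply: aeW => x _; apply: cvg_near_cst; apply: filterS (Q_near x) => n Qx.
  by rewrite indicE mem_set// mulr1.
- exact: rint_norm.
- apply: aeW => x n _; rewrite lee_fin normrM indicE.
  by case: (_ \in _); rewrite ?normr1 ?mulr1// normr0 mulr0.
move=> h; have fin := integrable_fin_num measurableT if_.
have h' : (\int[m]_x (f x * \1_(Q n) x)%:E @[n --> \oo] --> (\int[m]_x f x)%:E)%E.
  by rewrite /Rintegral fineK.
apply: (cvg_ext (fine_cvg h')) => n /=.
rewrite Rintegral_mkcond; congr fine; apply: eq_integral => x _.
by rewrite patchE indicE; case: ifP => _; rewrite ?mulr1 ?mulr0.
Qed.

Lemma exhaust_le (f : T -> R) (K : R) : measurable_fun setT f -> (forall x, 0 <= f x) ->
  (forall n, (\int[m]_(x in Q n) (f x)%:E <= K%:E)%E) -> (\int[m]_x (f x)%:E <= K%:E)%E.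
Proof.
move=> mf f0 fK.
apply: (@fatou_le _ _ _ m (fun n x => f x * \1_(Q n) x)) => //.
- by move=> n; apply: measurable_funM => //; exact: measurable_indic.
- by move=> n x; rewrite mulr_ge0// indicE.
- apply: aeW => x; apply: cvg_near_cst; apply: filterS (Q_near x) => n Qx.
  by rewrite indicE mem_set// mulr1.
move=> n; apply: le_trans (fK n); rewrite [leRHS]integral_mkcond le_eqVlt.
apply/orP; left; apply/eqP; apply: eq_integral => x _.
by rewrite patchE indicE; case: ifP => _; rewrite ?mulr1 ?mulr0.
Qed.

End exhaustion.

Section kernels.
Context {R : realType}.
Local Notation leb := (@lebesgue_measure R).

Lemma integral_derive (F f : R -> R) (a b : R) : (forall x : R, is_derive x (1 : R) F (f x)) ->
  continuous f -> a <= b ->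
  (\int[leb]_(x in `[a, b]) (f x)%:E = (F b - F a)%:E)%E.
Proof.
move=> dF cf; rewrite le_eqVlt => /predU1P[->|ab].
  by rewrite set_itv1 integral_set1 subrr.
have cF x : {for x, continuous F}.
  by apply/differentiable_continuous/derivable1_diffP; have [] := dF x.
rewrite (@continuous_FTC2 _ f F)//.
- by apply: continuous_subspaceT.
- split => [x _||]; first by have [] := dF x.
  + exact: cvg_at_right_filter (cF a).
  + exact: cvg_at_left_filter (cF b).
- by move=> x _; rewrite derive1E; have [_ ->] := dF x.
Qed.

Lemma is_derive_lin (c x : R) : is_derive x (1 : R) (fun b => c * b) c.
Proof.
have D := is_deriveZ c (is_derive_id x (1 : R)).
by apply: is_derive_eq D _; rewrite /GRing.scale /= mulr1.
Qed.

Lemma is_derive_exp_lin (c x : R) : is_derive x (1 : R) (fun b => expR (c * b)) (c * expR (c * x)).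
Proof.
have := is_derive1_comp (is_derive_expR (c * x)) (is_derive_lin c x).
by rewrite mulrC.
Qed.
Lemma is_derive_sin_lin (a x : R) : is_derive x (1 : R) (fun b => sin (a * b)) (a * cos (a * x)).
Proof.
have := is_derive1_comp (is_derive_sin (a * x)) (is_derive_lin a x).
by rewrite mulrC.
Qed.
Lemma is_derive_cos_lin (a x : R) : is_derive x (1 : R) (fun b => cos (a * b)) (- a * sin (a * x)).
Proof.
have := is_derive1_comp (is_derive_cos (a * x)) (is_derive_lin a x).
by rewrite mulrC mulrN mulNr.
Qed.

Lemma is_derive_exp_cos (a c x : R) : 0 < a ^+ 2 + c ^+ 2 -> is_derive x (1 : R)
  (fun b => (a ^+ 2 + c ^+ 2)^-1 * (expR (c * b) * (a * sin (a * b) + c * cos (a * b))))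
  (expR (c * x) * cos (a * x)).
Proof.
move=> ac; have D1 := is_derive_exp_lin c x.
have D2 := is_derive_sin_lin a x; have D3 := is_derive_cos_lin a x.
have D4 : is_derive x (1 : R) (a \*: (fun b => sin (a * b)) + c \*: (fun b => cos (a * b)))
   (a *: (a * cos (a * x)) + c *: (- a * sin (a * x))).
  by apply: is_deriveD; apply: is_deriveZ.
have D5 := is_deriveZ ((a ^+ 2 + c ^+ 2)^-1) (is_deriveM D1 D4).
apply: is_derive_eq D5 _; rewrite /GRing.scale /= /GRing.scale /=.
rewrite -[in RHS](mul1r (expR _ * _)) -(mulVf (lt0r_neq0 ac)) !fctE /= /GRing.scale /=.
ring.
Qed.

Lemma is_derive_exp_sin (a c x : R) : 0 < a ^+ 2 + c ^+ 2 -> is_derive x (1 : R)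
  (fun b => (a ^+ 2 + c ^+ 2)^-1 * (expR (c * b) * (c * sin (a * b) - a * cos (a * b))))
  (expR (c * x) * sin (a * x)).
Proof.
move=> ac; have D1 := is_derive_exp_lin c x.
have D2 := is_derive_sin_lin a x; have D3 := is_derive_cos_lin a x.
have D4 : is_derive x (1 : R) (c \*: (fun b => sin (a * b)) - a \*: (fun b => cos (a * b)))
   (c *: (a * cos (a * x)) - a *: (- a * sin (a * x))).
  by apply: is_deriveB; apply: is_deriveZ.
have D5 := is_deriveZ ((a ^+ 2 + c ^+ 2)^-1) (is_deriveM D1 D4).
apply: is_derive_eq D5 _; rewrite /GRing.scale /= /GRing.scale /=.
rewrite -[in RHS](mul1r (expR _ * _)) -(mulVf (lt0r_neq0 ac)) !fctE /= /GRing.scale /=.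
ring.
Qed.

Definition abel (eps b : R) : R := expR (- eps * `|b|).
Definition poisson (eps t : R) : R := 2 * eps / (eps ^+ 2 + t ^+ 2).

Definition oitv (n : nat) : set R := `]- n%:R, n%:R]%classic.

Lemma oitv_near (x : R) : \forall n \near \oo, oitv n x.
Proof.
have /cvgryPgt/(_ `|x|) := @cvgr_idn R.
by apply: filterS => n; rewrite /oitv /= in_itv /= ltr_norml => /andP[-> /ltW].
Qed.

Lemma continuous_abel (eps : R) : continuous (abel eps).
Proof.
move=> x.
apply: (cvg_comp (fun b : R => - eps * `|b|) expR); last exact: continuous_expR.
by apply: cvgMr; exact: norm_continuous.
Qed.

Lemma continuous_abel_mul (eps : R) (f : R -> R) : continuous f ->
  continuous (fun b => abel eps b * f b).
Proof.
by move=> cf x; apply: cvgM; [exact: continuous_abel|exact: cf].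
Qed.

(** On each half-line [abel eps] is a pure exponential. *)
Lemma Rintegral_oitv_abel (eps : R) (f Fl Fr : R -> R) (n : nat) :
  continuous f ->
  (forall x : R, is_derive x (1 : R) Fl (expR (eps * x) * f x)) ->
  (forall x : R, is_derive x (1 : R) Fr (expR (- eps * x) * f x)) ->
  \int[leb]_(x in oitv n) (abel eps x * f x) = (Fl 0 - Fl (- n%:R)) + (Fr n%:R - Fr 0).
Proof.
move=> cf dl dr; have cg := @continuous_abel_mul eps _ cf.
have n0 : - n%:R <= 0 :> R by rewrite oppr_le0.
have ig (A : set R) : A `<=` `[- n%:R, n%:R]%classic -> measurable A ->
    leb.-integrable A (EFin \o (fun x => abel eps x * f x)).
  move=> AI mA; apply: (@integrableS _ _ _ leb `[- n%:R, n%:R]%classic) => //.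
  apply: continuous_compact_integrable; first exact: segment_compact.
  exact: continuous_subspaceT.
have E : oitv n = `]- n%:R, 0]%classic `|` `]0, n%:R]%classic.
  apply/seteqP; split => x; rewrite /oitv /= !in_itv /=.
    by move=> /andP[-> ->]; case: ltP; [right|left].
  by move=> [/andP[-> /le_trans]|/andP[x0 ->]]; [apply|rewrite (le_lt_trans _ x0)].
have sl : (`]- n%:R, 0]%classic : set R) `<=` `[- n%:R, n%:R]%classic.
  by move=> x; rewrite /= !in_itv /= => /andP[/ltW -> /le_trans->].
have sr : (`]0, n%:R]%classic : set R) `<=` `[- n%:R, n%:R]%classic.
  by move=> x; rewrite /= !in_itv /= => /andP[/ltW/(le_trans n0) -> ->].
rewrite E Rintegral_setU//; last 2 first.
- rewrite -E; apply: ig; last exact: measurable_itv.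
  by move=> x; rewrite /oitv /= !in_itv /= => /andP[/ltW -> ->].
- by apply/disj_setPS => x [] /=; rewrite !in_itv /= => /andP[_ x0] /andP[/(le_lt_trans x0)]; rewrite ltxx.
rewrite !Rintegral_itv_obnd_cbnd; [|by apply: ig => //; exact: measurable_itv..].
have Cexp (c : R) : continuous (fun x => expR (c * x) * f x).
  move=> x; apply: cvgM; last exact: cf.
  apply: (cvg_comp (fun b : R => c * b) expR); last exact: continuous_expR.
  by apply: cvgMr; exact: cvg_id.
congr (_ + _).
  transitivity (\int[leb]_(x in `[- n%:R, 0]) (expR (eps * x) * f x)).
    apply: eq_Rintegral => x; rewrite inE /= in_itv /= => /andP[_ x0].
    by rewrite /abel ler0_norm// mulrNN.
  by rewrite /Rintegral (integral_derive dl).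
transitivity (\int[leb]_(x in `[0, n%:R]) (expR (- eps * x) * f x)).
  apply: eq_Rintegral => x; rewrite inE /= in_itv /= => /andP[x0 _].
  by rewrite /abel ger0_norm.
by rewrite /Rintegral (integral_derive dr).
Qed.

Lemma cvg_exp_bounded (eps K : R) (g : nat -> R) : 0 < eps ->
  (forall n, `|g n| <= K * expR (- eps * n%:R)) -> g n @[n --> \oo] --> (0 : R).
Proof.
move=> eps0 gK; have lim : K * expR (- eps * n%:R) @[n --> \oo] --> K * 0.
  apply: cvgMr.
  have h : (fun n : nat => eps * n%:R) @ \oo --> +oo.
    apply/cvgryPgt => A; have /cvgryPgt/(_ (A / eps)) := @cvgr_idn R.
    by apply: filterS => n; rewrite ltr_pdivrMr// mulrC.
  have := cvg_comp _ _ h (@cvgr_expR R).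
  by move=> c; apply: (cvg_ext c) => n /=; rewrite mulNr.
rewrite mulr0 in lim.
apply/norm_cvg0P; apply: (squeeze_cvgr _ (cvg_cst 0) lim).
by apply: nearW => n; rewrite normr_ge0 gK.
Qed.

Lemma meas_abel (eps : R) : measurable_fun [set: R] (abel eps).
Proof.
by apply: continuous_measurable_fun; exact: continuous_abel.
Qed.

Lemma rint_abel (eps : R) : 0 < eps -> rint leb (abel eps).
Proof.
move=> eps0; apply/ge0_rintP; first exact: meas_abel.
  by move=> b; exact: expR_ge0.
apply: (@le_lt_trans _ _ (2 / eps)%:E); last exact: ltry.
apply: (@exhaust_le _ _ R leb oitv _ _ (abel eps)).
- by move=> n; exact: measurable_itv.
- exact: oitv_near.
- exact: meas_abel.
- by move=> b; exact: expR_ge0.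
move=> n.
have dl (x : R) : is_derive x (1:R) (fun b => eps^-1 * expR (eps * b)) (expR (eps * x) * 1).
  have := is_deriveZ eps^-1 (is_derive_exp_lin eps x).
  by rewrite /GRing.scale /= mulKf ?gt_eqF// mulr1.
have dr (x : R) : is_derive x (1:R) (fun b => - eps^-1 * expR (- eps * b)) (expR (- eps * x) * 1).
  have := is_deriveZ (- eps^-1) (is_derive_exp_lin (- eps) x).
  by rewrite /GRing.scale /= mulrA mulrNN mulVf ?gt_eqF// mul1r mulr1.
have := Rintegral_oitv_abel n (fun=> cvg_cst (1 : R)) dl dr.
under eq_Rintegral do rewrite mulr1.
rewrite mulr0 expR0 mulr1 mulr0 expR0 mulr1 !mulNr mulrN opprK => h.
have ii : leb.-integrable (oitv n) (EFin \o abel eps).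
  apply: (@integrableS _ _ _ leb `[- n%:R, n%:R]%classic) => //.
  - exact: measurable_itv.
  - by move=> x; rewrite /oitv /= !in_itv /= => /andP[/ltW -> ->].
  apply: continuous_compact_integrable; first exact: segment_compact.
  by apply: continuous_subspaceT; exact: continuous_abel.
rewrite -(fineK (integrable_fin_num _ ii)); last exact: measurable_itv.
rewrite -/(Rintegral leb (oitv n) (abel eps)) lee_fin h.
have := expR_ge0 (- (eps * n%:R)); set t := expR _ => t0.
have : 0 < eps^-1 by rewrite invr_gt0.
move: eps^-1 => e e0; nra.
Qed.

Lemma cint_abel (eps a : R) : 0 < eps ->
  cint leb (fun b => (abel eps b)%:C%C * expNi (a * b)) = (poisson eps a)%:C%C.
Proof.
move=> eps0; have ac : 0 < a ^+ 2 + eps ^+ 2 by rewrite ltr_wpDl ?sqr_ge0 ?exprn_gt0.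
have ac' : 0 < a ^+ 2 + (- eps) ^+ 2 by rewrite sqrrN.
have ia : cint_able leb (fun b => (abel eps b)%:C%C * expNi (a * b)).
  apply: (@cint_ableM _ _ _ leb (fun b => (abel eps b)%:C%C) (fun b => expNi (a * b)) 1).
  - by apply: cint_able_real; exact: rint_abel.
  - by apply: cmeas_expNi; exact: measurable_funM.
  - by move=> b; rewrite cnorm_expNi.
have [i1 i2] := ia.
have mo n : measurable (oitv n : set (measurableTypeR R)) by exact: measurable_itv.
have c1 := @exhaust_cvg _ _ R leb oitv mo oitv_near _ i1.
have c2 := @exhaust_cvg _ _ R leb oitv mo oitv_near _ i2.
have csin : continuous (fun b : R => - sin (a * b)).
  move=> x; apply: cvgN; apply: (cvg_comp (fun b : R => a * b) sin); last exact: continuous_sin.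
  by apply: cvgMr; exact: cvg_id.
have ccos : continuous (fun b : R => cos (a * b)).
  move=> x; apply: (cvg_comp (fun b : R => a * b) cos); last exact: continuous_cos.
  by apply: cvgMr; exact: cvg_id.
have bnd (c e' : R) : `|c| <= 1 -> `|e'| <= 1 -> `|a * c + eps * e'| <= `|a| + `|eps|.
  move=> c1' e1; apply: le_trans (ler_normD _ _) _; rewrite !normrM.
  by rewrite lerD// ler_piMr.
apply: complex_ext => /=.
  apply: cvg_unique c1 _ => //.
  have -> : poisson eps a = poisson eps a + 0 by rewrite addr0.
  have E n : \int[leb]_(x in oitv n) ((@complex.Re R) \o
     (fun b => (abel eps b)%:C%C * expNi (a * b))) x = poisson eps a +
     2 * ((a ^+ 2 + eps ^+ 2)^-1 *
        (expR (- eps * n%:R) * (a * sin (a * n%:R) - eps * cos (a * n%:R)))).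
    transitivity (\int[leb]_(x in oitv n) (abel eps x * cos (a * x))).
      by apply: eq_Rintegral => x _ /=; ring.
    rewrite (Rintegral_oitv_abel n ccos (fun x => is_derive_exp_cos x ac)
       (fun x => is_derive_exp_cos x ac')).
    rewrite !mulr0 sin0 cos0 expR0 !mulrN sinN cosN sqrrN /poisson.
    rewrite (_ : expR (- (eps * n%:R)) = expR (- eps * n%:R)); last by congr expR; ring.
    by rewrite [eps ^+ 2 + _]addrC; ring.
  suff h : (fun n : nat => poisson eps a +
      2 * ((a ^+ 2 + eps ^+ 2)^-1 * (expR (- eps * n%:R) *
       (a * sin (a * n%:R) - eps * cos (a * n%:R))))) @ \oo --> poisson eps a + 0.
    by apply: (cvg_ext h) => n; exact: (esym (E n)).
  apply: cvgD; first exact: cvg_cst.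
  apply: (@cvg_exp_bounded eps (2 * (a ^+ 2 + eps ^+ 2)^-1 * (`|a| + `|eps|))) => // n.
  rewrite !normrM [`|2|]ger0_norm// [`|_^-1|]gtr0_norm ?invr_gt0//.
  rewrite [`|expR _|]gtr0_norm ?expR_gt0// -!mulrA ler_pM2l// ler_pM2l ?invr_gt0//.
  rewrite mulrC ler_pM2r ?expR_gt0// -mulrN; apply: bnd.
  + by rewrite ler_norml sin_geN1 sin_le1.
  + by rewrite normrN ler_norml cos_geN1 cos_le1.
apply: cvg_unique c2 _ => //.
have E n : \int[leb]_(x in oitv n) ((@complex.Im R) \o
   (fun b => (abel eps b)%:C%C * expNi (a * b))) x = 0.
  transitivity (\int[leb]_(x in oitv n) (abel eps x * - sin (a * x))).
    by apply: eq_Rintegral => x _ /=; ring.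
  have dS' (c : R) x (h : 0 < a ^+ 2 + c ^+ 2) : is_derive x (1:R)
    (fun b => - ((a ^+ 2 + c ^+ 2)^-1 * (expR (c * b) * (c * sin (a * b) - a * cos (a * b)))))
     (expR (c * x) * - sin (a * x)).
    pose proof (is_deriveN (is_derive_exp_sin x h)) as D.
    by apply: is_derive_eq D _; rewrite mulrN.
  rewrite (Rintegral_oitv_abel n csin (fun x => dS' _ x ac) (fun x => dS' _ x ac')).
  rewrite !mulr0 sin0 cos0 expR0 !mulrN sinN cosN sqrrN.
  rewrite (_ : expR (- (eps * n%:R)) = expR (- eps * n%:R)); last by congr expR; ring.
  ring.
by apply: (cvg_ext (cvg_cst (0 : R))) => n; exact: (esym (E n)).
Qed.

(** Integrating the Poisson kernel in its argument gives an arctangent. *)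
Lemma is_derive_poisson (eps x t : R) : 0 < eps -> is_derive t (1 : R)
  (fun s => 2 * atan ((s - x) / eps)) (poisson eps (x - t)).
Proof.
move=> eps0.
have D1 : is_derive t (1:R) (fun s => (s - x) / eps) eps^-1.
  have D0 : is_derive t (1:R) (fun s : R => s - x) (1 - 0).
    by apply: is_deriveB.
  have -> : (fun s => (s - x) / eps) = eps^-1 \*: (fun s : R => s - x).
    by apply/funext => s; rewrite mulrC.
  by apply: is_derive_eq (is_deriveZ eps^-1 D0) _; rewrite /GRing.scale /= subr0 mulr1.
pose proof (is_deriveZ (2 : R) (@is_derive1_comp R atan (fun s => (s - x) / eps) t _ _
  (is_derive1_atan ((t - x) / eps)) D1)) as D2.
apply: is_derive_eq D2 _; rewrite /GRing.scale /= /poisson.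
have h : 0 < eps ^+ 2 + (x - t) ^+ 2 by rewrite ltr_pwDl ?exprn_gt0 ?sqr_ge0.
by field; rewrite !gt_eqF.
Qed.

Lemma continuous_poisson (eps x : R) : 0 < eps -> continuous (fun t => poisson eps (x - t)).
Proof.
move=> eps0 t; rewrite /poisson.
have h (s : R) : 0 < eps ^+ 2 + (x - s) ^+ 2 by rewrite ltr_pwDl ?exprn_gt0 ?sqr_ge0.
apply: cvgMr; apply: cvgV; first by rewrite gt_eqF.
apply: cvgD; first exact: cvg_cst.
by apply: cvgM; apply: cvgB; [exact: cvg_cst|exact: cvg_id|exact: cvg_cst|exact: cvg_id].
Qed.

Lemma integral_poisson_itv (eps x a b : R) : 0 < eps -> a <= b ->
  (\int[leb]_(t in `]a, b]) (poisson eps (x - t))%:E =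
   (2 * atan ((b - x) / eps) - 2 * atan ((a - x) / eps))%:E)%E.
Proof.
move=> eps0 ab; rewrite integral_itv_obnd_cbnd; last first.
  apply/measurable_EFinP/measurable_funTS; apply: continuous_measurable_fun.
  exact: continuous_poisson.
by rewrite (integral_derive (fun t => is_derive_poisson x t eps0)
  (@continuous_poisson eps x eps0) ab).
Qed.

Lemma poisson_ge0 (eps t : R) : 0 < eps -> 0 <= poisson eps t.
Proof. by move=> e0; rewrite divr_ge0 ?mulr_ge0 ?addr_ge0 ?sqr_ge0// ltW. Qed.

Lemma poissonN (eps t : R) : poisson eps (- t) = poisson eps t.
Proof. by rewrite /poisson sqrrN. Qed.

Lemma integral_poisson_le (eps x : R) : 0 < eps ->
  (\int[leb]_t (poisson eps (x - t))%:E <= (2 * pi)%:E)%E.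
Proof.
move=> eps0; apply: (@exhaust_le _ _ R leb oitv _ _ (fun t => poisson eps (x - t))).
- by move=> n; exact: measurable_itv.
- exact: oitv_near.
- by apply: continuous_measurable_fun; exact: continuous_poisson.
- by move=> t; exact: poisson_ge0.
move=> n; rewrite integral_poisson_itv//; last by rewrite ge0_cp ?ler0n.
rewrite lee_fin; have := atan_ltpi2 ((n%:R - x) / eps).
have := atan_gtNpi2 ((- n%:R - x) / eps); lra.
Qed.

Lemma cvg_atan_pos (t : R) : 0 < t -> atan (t / n.+1%:R^-1) @[n --> \oo] --> pi / 2.
Proof.
move=> t0; have h : (fun n : nat => t / n.+1%:R^-1) @ \oo --> +oo.
  under eq_fun do rewrite invrK.
  apply/cvgryPgt => A; have /cvgryPgt/(_ (A / t)) := @cvgr_idn R.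
  apply: filterS => n; rewrite ltr_pdivrMr// mulrC => /lt_le_trans; apply.
  by rewrite ler_pM2l// ler_nat.
exact: cvg_comp h (@cvgy_atan R).
Qed.

Lemma cvg_atan_neg (t : R) : t < 0 -> atan (t / n.+1%:R^-1) @[n --> \oo] --> - (pi / 2).
Proof.
move=> t0; have nt0 : 0 < - t by rewrite oppr_gt0.
pose proof (cvgN (cvg_atan_pos nt0)) as h.
by apply: (cvg_ext h) => n; rewrite !fctE mulNr atanN opprK.
Qed.

(** Each arctangent tends to plus or minus [pi / 2] according to the sign of its
argument; the limits cancel unless [x] lies between [a] and [b]. *)
Lemma cvg_poisson_itv (a b x : R) : a <= b -> x != a -> x != b ->
  (2 * atan ((b - x) / n.+1%:R^-1) - 2 * atan ((a - x) / n.+1%:R^-1)) @[n --> \oo]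
  --> 2 * pi * \1_(`]a, b]%classic) x.
Proof.
move=> ab xa xb.
have [xltb|bltx] := ltP x b; last first.
  have bx : b < x by rewrite lt_neqAle eq_sym xb.
  rewrite indicE memNset ?mulr0; last by rewrite /= in_itv /= (lt_geF bx) andbF.
  rewrite -(subrr (2 * - (pi / 2))).
  by apply: cvgB; apply: cvgMr; apply: cvg_atan_neg; rewrite subr_lt0// (le_lt_trans ab).
have [xlta|altx] := ltP x a.
  rewrite indicE memNset ?mulr0; last by rewrite /= in_itv /= (lt_gtF xlta).
  rewrite -(subrr (2 * (pi / 2))).
  by apply: cvgB; apply: cvgMr; apply: cvg_atan_pos; rewrite subr_gt0.
have ax : a < x by rewrite lt_neqAle eq_sym xa.
rewrite indicE mem_set ?mulr1; last by rewrite /= in_itv /= ax (ltW xltb).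
have -> : 2 * pi = 2 * (pi / 2) - 2 * - (pi / 2) :> R by field.
apply: cvgB; apply: cvgMr; first by apply: cvg_atan_pos; rewrite subr_gt0.
by apply: cvg_atan_neg; rewrite subr_lt0.
Qed.

End kernels.

(** * The Hilbert space of square-integrable functions *)

Section L2.
Context {d} {T : measurableType d} {R : realType} (m : {measure set T -> \bar R}).
Implicit Types (f g h : T -> R[i]).

Definition L2 f := cmeas f /\ rint m (fun x => cnorm (f x) ^+ 2).

Definition ip2 f g : R := \int[m]_x (Re (f x) * Re (g x) + Im (f x) * Im (g x)).

Lemma L2_le f (u : T -> R) : cmeas f -> rint m u -> (forall x, cnorm (f x) ^+ 2 <= u x) -> L2 f.
Proof.
move=> mf iu fu; split => //; apply: (rint_le _ iu); first exact: meas_sqr_cnorm.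
by move=> x; rewrite ger0_norm ?sqr_ge0.
Qed.

Lemma sqr_cnormD (z w : R[i]) : cnorm (z + w) ^+ 2 <= 2 * cnorm z ^+ 2 + 2 * cnorm w ^+ 2.
Proof.
rewrite !sqr_cnorm !cE.
have := sqr_ge0 (Re z - Re w); have := sqr_ge0 (Im z - Im w); rewrite !expr2; lra.
Qed.

Lemma L2D f g : L2 f -> L2 g -> L2 (fun x => f x + g x).
Proof.
move=> [mf if_] [mg ig]; apply: (L2_le (cmeasD mf mg) (rintD (rintZ 2 if_) (rintZ 2 ig))).
by move=> x; exact: sqr_cnormD.
Qed.

Lemma L2M f g (K : R) : L2 f -> cmeas g -> (forall x, cnorm (g x) <= K) ->
  L2 (fun x => g x * f x).
Proof.
move=> [mf if_] mg gK; apply: (L2_le (cmeasM mg mf) (rintZ (K ^+ 2) if_)) => x.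
rewrite cnormM exprMn ler_wpM2r ?sqr_ge0// ler_pXn2r ?nnegrE ?cnorm_ge0//.
exact: le_trans (cnorm_ge0 _) (gK x).
Qed.

Lemma L2Z c f : L2 f -> L2 (fun x => c * f x).
Proof. by move=> Lf; apply: (L2M Lf (cmeas_cst c) (fun=> lexx _)). Qed.

Lemma L2N f : L2 f -> L2 (fun x => - f x).
Proof. by move=> /(L2Z (-1)); under eq_fun do rewrite mulN1r. Qed.

Lemma L2B f g : L2 f -> L2 g -> L2 (fun x => f x - g x).
Proof. by move=> Lf Lg; exact: L2D Lf (L2N Lg). Qed.

Lemma L2J f : L2 f -> L2 (fun x => (f x)^*).
Proof.
move=> [mf if_]; split; first exact: cmeasJ.
by under eq_fun do rewrite cnormJ.
Qed.

Lemma L20 : L2 (fun=> 0).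
Proof.
split; first exact: cmeas_cst.
by under eq_fun do rewrite cnorm0 expr0n; exact: integrable0.
Qed.

Lemma L2_cint_able f g : L2 f -> L2 g -> cint_able m (fun x => f x * g x).
Proof.
move=> [mf if_] [mg ig]; apply: (cint_able_le (cmeasM mf mg) (rintD if_ ig)) => x.
rewrite cnormM; have := cnorm_ge0 (f x); have := cnorm_ge0 (g x).
have := sqr_ge0 (cnorm (f x) - cnorm (g x)); rewrite !expr2; nra.
Qed.

Lemma rint_ip2 f g : L2 f -> L2 g ->
  rint m (fun x => Re (f x) * Re (g x) + Im (f x) * Im (g x)).
Proof.
move=> Lf Lg; have [+ _] := L2_cint_able Lf (L2J Lg).
congr (rint m _); apply/funext => x /=; rewrite !cE; ring.
Qed.

Lemma ip2_self f : ip2 f f = \int[m]_x cnorm (f x) ^+ 2.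
Proof. by apply: eq_Rintegral => x _; rewrite sqr_cnorm !expr2. Qed.

Lemma integral_sqr f : L2 f -> (\int[m]_x (cnorm (f x) ^+ 2)%:E = (ip2 f f)%:E)%E.
Proof.
move=> [mf if_]; rewrite ip2_self /Rintegral fineK//.
exact: (integrable_fin_num measurableT if_).
Qed.

Lemma ip2_ae0 f : L2 f -> ip2 f f = 0 -> {ae m, forall x, f x = 0}.
Proof.
move=> Lf f0; have := integral_sqr Lf; rewrite f0 => h.
have mf : measurable_fun setT (fun x => (cnorm (f x) ^+ 2)%:E).
  by apply/measurable_EFinP; apply: meas_sqr_cnorm; exact: Lf.1.
have /(ae_eq_integral_abs m measurableT mf) : (\int[m]_x `|(cnorm (f x) ^+ 2)%:E| = 0)%E.
  by apply: etrans h; apply: eq_integral => x _; rewrite gee0_abs// lee_fin sqr_ge0.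
apply: filterS => x /(_ I) [] /eqP; rewrite sqrf_eq0 => /eqP.
exact: cnorm_eq0.
Qed.

Lemma ae_ip2_eq f g : L2 f -> L2 g -> {ae m, forall x, f x = g x} ->
  ip2 (fun x => f x - g x) (fun x => f x - g x) = 0.
Proof.
move=> Lf Lg fg; have Lfg := L2B Lf Lg.
apply: EFin_inj; rewrite -integral_sqr//.
apply: etrans (@integral0 _ _ _ m setT); apply: ae_eq_integral => //.
  by apply/measurable_EFinP; apply: meas_sqr_cnorm; exact: Lfg.1.
by apply: filterS fg => x -> _ /=; rewrite subrr cnorm0 expr0n.
Qed.

Let sc (a : R) f : T -> R[i] := fun x => a%:C%C * f x.

Section riesz_fischer.
Variable u : nat -> T -> R[i].
Hypothesis Lu : forall n, L2 (u n).

(** When the increments decrease geometrically in [L^2], they do so pointwise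
almost everywhere: [\sum_k 4^k |u_(k+1) - u_k|^2] has a finite integral. *)
Lemma fast_cauchy_ae : (forall k, ip2 (u k.+1 - u k) (u k.+1 - u k) <= 16^-1 ^+ k) ->
  exists2 l : T -> R[i], cmeas l &
  {ae m, forall x, Re (u k x) @[k --> \oo] --> Re (l x) /\
                   Im (u k x) @[k --> \oo] --> Im (l x)}.
Proof.
move=> uk.
pose D k x := 4 ^+ k * cnorm (u k.+1 x - u k x) ^+ 2.
have LD k : L2 (fun x => u k.+1 x - u k x) by apply: L2B.
have D0 k x : 0 <= D k x by rewrite mulr_ge0 ?sqr_ge0 ?exprn_ge0.
have mD k : measurable_fun setT (fun x => (D k x)%:E).
  apply/measurable_EFinP; apply: measurable_funM => //.
  by apply: meas_sqr_cnorm; exact: (LD k).1.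
pose S x := (\sum_(k <oo) (D k x)%:E)%E.
have mS : measurable_fun setT S.
  apply: ge0_emeasurable_sum => //.
  by move=> k x _ _; rewrite lee_fin.
have IS : (\int[m]_x S x < +oo)%E.
  rewrite /S integral_nneseries//; last by move=> k x _; rewrite lee_fin.
  apply: (@le_lt_trans _ _ (\sum_(k <oo) (4^-1 ^+ k)%:E)%E).
    apply: lee_nneseries => [k *|k *].
      by apply: integral_ge0 => x _; rewrite lee_fin.
    rewrite /D; under eq_integral do rewrite EFinM.
    rewrite ge0_integralZl//; last 2 first.
    - by apply/measurable_EFinP; apply: meas_sqr_cnorm; exact: (LD k).1.
    - by move=> x _; rewrite lee_fin sqr_ge0.
    rewrite (integral_sqr (LD k)) -EFinM lee_fin.
    apply: le_trans (_ : 4 ^+ k * 16^-1 ^+ k <= _).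
      by rewrite ler_pM2l ?exprn_gt0//; exact: uk.
    by rewrite -exprMn; have -> : 4 * 16^-1 = 4^-1 :> R by field.
  have cg : series (geometric (1 : R) 4^-1) n @[n --> \oo] --> (1 / (1 - 4^-1) : R).
    by apply: cvg_geometric_series; rewrite ger0_norm// invf_lt1// ltr1n.
  have -> : (\sum_(k <oo) (4^-1 ^+ k)%:E = (1 / (1 - 4^-1) : R)%:E)%E.
    apply/cvg_lim => //.
    apply: cvg_EFin; first by apply: nearW => n; rewrite sumEFin.
    apply: (cvg_ext cg) => n /=; rewrite sumEFin /series /=.
    by apply: eq_bigr => k _; rewrite /geometric /= mul1r.
  exact: ltry.
pose A := [set x | (S x < +oo)%E].
have mA : measurable A.
  rewrite -[A]setTI; have := emeasurable_fun_infty_o measurableT mS +oo%E.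
  by [].
have Aae : {ae m, forall x, A x}.
  have iS : m.-integrable setT S.
    apply/integrableP; split => //; apply: le_lt_trans IS.
    rewrite le_eqVlt; apply/orP; left; apply/eqP; apply: eq_integral => x _.
    by rewrite gee0_abs// nneseries_ge0// => k _ _; rewrite lee_fin.
  have := integrable_ae measurableT iS; apply: filterS => x /(_ I).
  by rewrite /A /= => /fin_numPlt /andP[].
have conv x : A x -> cvgn (fun k => Re (u k x)) /\ cvgn (fun k => Im (u k x)).
  move=> Ax.
  have [K KP] : exists K : R, forall k, D k x <= K.
    exists (fine (S x)) => k; rewrite -lee_fin fineK; last first.
      by rewrite ge0_fin_numE// nneseries_ge0// => ? _ _; rewrite lee_fin.
    have h : (\sum_(0 <= i < k.+1) (D i x)%:E <= S x)%E.
      by apply: nneseries_lim_ge => *; rewrite lee_fin.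
    apply: le_trans h; rewrite big_mkord big_ord_recr /= leeDr// sume_ge0// => ? _.
    by rewrite lee_fin.
  have K0 : 0 <= K by exact: le_trans (D0 0 x) (KP 0).
  have step k : cnorm (u k.+1 x - u k x) <= Num.sqrt K * 2^-1 ^+ k.
    rewrite -(@ler_pXn2r _ 2) ?nnegrE ?cnorm_ge0 ?mulr_ge0 ?sqrtr_ge0 ?exprn_ge0//.
    rewrite exprMn sqr_sqrtr// -exprM mulnC exprM.
    rewrite (_ : 2^-1 ^+ 2 = 4^-1 :> R); last by rewrite expr2; field.
    rewrite exprVn ler_pdivlMr ?exprn_gt0// mulrC; exact: KP.
  have geo (v : nat -> R) : (forall k, `|v k.+1 - v k| <= Num.sqrt K * 2^-1 ^+ k) -> cvgn v.
    move=> vk.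
    have cs : cvgn (series (fun k => v k.+1 - v k)).
      apply: normed_cvg.
      apply: (series_le_cvg _ _ vk).
      - by move=> k; exact: normr_ge0.
      - by move=> k; rewrite mulr_ge0 ?sqrtr_ge0 ?exprn_ge0.
      - by apply: is_cvg_geometric_series; rewrite ger0_norm// invf_lt1// ltr1n.
    have E : v = (fun k => v 0 + series (fun k => v k.+1 - v k) k).
      apply/funext => k; rewrite /series /= telescope_sumr//.
      by rewrite addrC subrK.
    have : cvgn (fun k => v 0 + series (fun k => v k.+1 - v k) k).
      by apply: is_cvgD; [exact: is_cvg_cst|exact: cs].
    by rewrite -E.
  split; apply: geo => k; apply: le_trans (step k).
    by apply: le_trans (Re_le_cnorm _); rewrite !cE.
  by apply: le_trans (Im_le_cnorm _); rewrite !cE.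
pose lr (p : R[i] -> R) x : R := limn (fun k => p (u k x) * \1_A x).
have lrP (p : R[i] -> R) : (forall k, measurable_fun setT (p \o u k)) ->
    (forall x, A x -> cvgn (fun k => p (u k x))) ->
    measurable_fun setT (lr p) /\ (forall x, A x -> p (u k x) @[k --> \oo] --> lr p x).
  move=> mp cp.
  have cpA x : cvgn (fun k => p (u k x) * \1_A x).
    have [Ax|nAx] := pselect (A x).
      by rewrite indicE (mem_set Ax); under eq_fun do rewrite mulr1; exact: cp.
    by rewrite indicE (memNset nAx); under eq_fun do rewrite mulr0; exact: is_cvg_cst.
  split.
    apply: (@measurable_fun_cvg _ _ _ _ (fun k x => p (u k x) * \1_A x)).
      by move=> k; apply: measurable_funM; [exact: mp|exact: measurable_indic].
    by move=> x _; exact: cpA.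
  move=> x Ax; have := cpA x; rewrite /lr indicE (mem_set Ax).
  by under eq_fun do rewrite mulr1; move=> h; exact: h.
have [mr cr] := lrP (@complex.Re R) (fun k => (Lu k).1.1) (fun x Ax => (conv x Ax).1).
have [mi ci] := lrP (@complex.Im R) (fun k => (Lu k).1.2) (fun x Ax => (conv x Ax).2).
exists (fun x => Complex (lr (@complex.Re R) x) (lr (@complex.Im R) x)); first by split.
by apply: filterS Aae => x Ax /=; split; [exact: cr|exact: ci].
Qed.

End riesz_fischer.

Lemma riesz_fischer (u : nat -> T -> R[i]) : (forall n, L2 (u n)) ->
  (forall e : R, 0 < e -> exists N, forall i j, (N <= i)%N -> (N <= j)%N ->
     ip2 (u i - u j) (u i - u j) <= e) ->
  exists2 l, L2 l & forall e : R, 0 < e -> exists N, forall n, (N <= n)%N ->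
     ip2 (u n - l) (u n - l) <= e.
Proof.
move=> Lu cu.
have /choice[N NP] : forall k, exists N, forall i j, (N <= i)%N -> (N <= j)%N ->
    ip2 (u i - u j) (u i - u j) <= 16^-1 ^+ k.
  by move=> k; apply: cu; rewrite exprn_gt0.
pose p k := (\max_(i < k.+1) (N i + i))%N.
have kp k : (N k + k <= p k)%N.
  exact: (leq_bigmax (F := fun i : 'I_k.+1 => (N i + i)%N) ord_max).
have Np k : (N k <= p k)%N by apply: leq_trans (kp k); exact: leq_addr.
have pS k : (p k <= p k.+1)%N.
  by rewrite /p [leqRHS]big_ord_recr /= leq_max leqnn.
have pmono : {homo p : i j / (i <= j)%N} by exact: homo_leq leq_trans pS.
have [|l ml lP] := @fast_cauchy_ae (fun k => u (p k)) (fun k => Lu _).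
  by move=> k; apply: NP => //; exact: leq_trans (Np k) (pS k).
have clos e n N0 : (forall i, (N0 <= i)%N -> ip2 (u n - u i) (u n - u i) <= e) ->
    (\int[m]_x (cnorm (u n x - l x) ^+ 2)%:E <= e%:E)%E.
  move=> ne; apply: (@fatou_le _ _ _ m
    (fun k x => cnorm (u n x - u (p (k + N0)%N) x) ^+ 2)).
  - by move=> k; apply: meas_sqr_cnorm; exact: (L2B (Lu _) (Lu _)).1.
  - by apply: meas_sqr_cnorm; apply: cmeasD; [exact: (Lu n).1|exact: cmeasN].
  - by move=> k x; exact: sqr_ge0.
  - apply: filterS lP => x [cr ci].
    under eq_fun do rewrite sqr_cnorm !cE.
    rewrite sqr_cnorm !cE.
    have crs : Re (u (p (k + N0)%N) x) @[k --> \oo] --> Re (l x).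
      by rewrite (cvg_shiftn N0 (fun k => Re (u (p k) x))).
    have cis : Im (u (p (k + N0)%N) x) @[k --> \oo] --> Im (l x).
      by rewrite (cvg_shiftn N0 (fun k => Im (u (p k) x))).
    by rewrite !expr2; apply: cvgD; apply: cvgM; apply: cvgB => //; exact: cvg_cst.
  - move=> k; rewrite (integral_sqr (L2B (Lu n) (Lu _))) lee_fin.
    apply: ne; apply: leq_trans (kp _); rewrite addnA leq_addl//.
have Ll : L2 l.
  have [N1 N1P] := cu 1 ltr01.
  have mul : cmeas (fun x => u N1 x - l x) by apply: cmeasD; [exact: (Lu N1).1|exact: cmeasN].
  have L1 : L2 (fun x => u N1 x - l x).
    split => //; apply/ge0_rintP; [exact: meas_sqr_cnorm|by move=> x; exact: sqr_ge0|].
    apply: le_lt_trans (clos 1 N1 N1 _) (ltry _) => i Ni; exact: N1P.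
  have := L2B (Lu N1) L1; congr (L2 _); apply/funext => x.
  by rewrite opprB addrC subrK.
exists l => // e e0; have [N0 N0P] := cu e e0; exists N0 => n Nn.
rewrite -lee_fin -(integral_sqr (L2B (Lu n) Ll)).
by apply: (clos e n N0) => i Ni; exact: N0P.
Qed.

Definition L2H : semiHilbert R (T -> R[i]).
Proof.
refine (@SemiHilbert R (T -> R[i]) sc L2 ip2 L20 L2D L2N (fun a f => @L2Z a%:C%C f)
  _ _ _ _ riesz_fischer).
- by move=> f g; apply: eq_Rintegral => x _; ring.
- move=> f g h Lf Lg Lh; rewrite /ip2 -RintegralD//; try exact: rint_ip2.
  by apply: eq_Rintegral => x _; rewrite fctE !cE; ring.
- move=> a f g Lf Lg; rewrite /ip2 -RintegralZl//; last exact: rint_ip2.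
  by apply: eq_Rintegral => x _; rewrite /sc !cE /=; ring.
- by move=> f; apply: Rintegral_ge0 => x _; rewrite addr_ge0// -expr2 sqr_ge0.
Defined.

End L2.

(** * The Fourier integral *)

Section fourier_integral.
Context {R : realType} {d : nat}.
Local Notation E := 'rV[R]_d.
Local Notation leb := (@lebesgue_measure R).
Local Notation mu := (@lebesgue_rV R d).
Local Notation F := (@fourier_integral R d).
Implicit Types (f g h : E -> R[i]) (x y xi : E).

Lemma cLnormE (p : R) f :
  cLnorm p%:E f = ((\int[mu]_x (cnorm (f x) `^ p)%:E) `^ p^-1)%E.
Proof.
rewrite /cLnorm unlock /=; apply: (congr1 (fun t : \bar R => t `^ p^-1)%E).
apply: eq_integral => x _ /=.
by rewrite ger0_norm ?cnorm_ge0// poweR_EFin.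
Qed.

Lemma powR2 (a : R) : 0 <= a -> a `^ 2 = a ^+ 2.
Proof. by move=> a0; rewrite -powR_mulrn. Qed.

Lemma cLnorm2E f : L2 mu f -> cLnorm 2%:E f = (Num.sqrt (ip2 mu f f))%:E.
Proof.
move=> Lf; rewrite cLnormE.
under eq_integral do rewrite powR2 ?cnorm_ge0//.
rewrite (integral_sqr Lf) poweR_EFin powR12_sqrt//.
exact: (ip_ge0 (L2H mu)).
Qed.

Lemma Lp2P f : Lp 2%:E f <-> L2 mu f.
Proof.
split => [[mf Nf]|Lf]; last first.
  by split; [exact: Lf.1|rewrite cLnorm2E// ltry].
split => //; apply/ge0_rintP; [exact: meas_sqr_cnorm|by move=> x; exact: sqr_ge0|].
have E2 : cLnorm 2%:E f = ((\int[mu]_x (cnorm (f x) ^+ 2)%:E) `^ 2^-1)%E.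
  rewrite cLnormE; congr (_ `^ _)%E; apply: eq_integral => x _.
  by rewrite powR2 ?cnorm_ge0.
by move: Nf; rewrite E2; apply: lty_poweRy; rewrite invr_neq0.
Qed.

Lemma Lp1P f : Lp 1%:E f <-> cint_able mu f.
Proof.
have E1 : cLnorm 1%:E f = (\int[mu]_x (cnorm (f x))%:E)%E.
  rewrite cLnormE invr1 poweRe1.
    by apply: eq_integral => x _; rewrite powRr1 ?cnorm_ge0.
  by apply: integral_ge0 => x _; rewrite lee_fin powR_ge0.
split => [[mf]|/cint_ableP[mf if_]].
  rewrite E1 => h; apply/cint_ableP; split => //; apply/ge0_rintP => //.
    exact: meas_cnorm.
  by move=> x; exact: cnorm_ge0.
split => //; rewrite E1; apply/ge0_rintP => //; first exact: meas_cnorm.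
by move=> x; exact: cnorm_ge0.
Qed.

Definition cd : R := (2 * pi) `^ (- (d%:R / 2)).

Lemma cd_gt0 : 0 < cd.
Proof. by rewrite powR_gt0// mulr_gt0// pi_gt0. Qed.

Lemma FE f xi : F f xi = (cd%:C)%C * cint mu (fun x => f x * expNi (dotv x xi)).
Proof. by []. Qed.

Lemma dotvC x y : dotv x y = dotv y x.
Proof. by apply: eq_bigr => i _; rewrite mulrC. Qed.

Lemma dotvDl x y xi : dotv (x + y) xi = dotv x xi + dotv y xi.
Proof. by rewrite -big_split; apply: eq_bigr => i _; rewrite mxE mulrDl. Qed.

Lemma dotvNl x xi : dotv (- x) xi = - dotv x xi.
Proof.
rewrite -[RHS]mulN1r big_distrr; apply: eq_bigr => i _.
by rewrite mxE /= mulN1r mulNr.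
Qed.

Lemma dotvNr x xi : dotv x (- xi) = - dotv x xi.
Proof. by rewrite dotvC dotvNl dotvC. Qed.

Lemma dotvDr x xi eta : dotv x (xi + eta) = dotv x xi + dotv x eta.
Proof. by rewrite dotvC dotvDl !(dotvC x). Qed.

Lemma meas_dotv2 : measurable_fun setT (fun z : E * E => dotv z.1 z.2).
Proof.
apply: (@meas_sum R _ _ _ _ _ (fun i (z : E * E) => z.1 ord0 i * z.2 ord0 i)) => i.
by apply: measurable_funM;
  [exact: measurableT_comp (meas_coor i) measurable_fst|
   exact: measurableT_comp (meas_coor i) measurable_snd].
Qed.

Lemma meas_dotvr xi : measurable_fun setT (fun x : E => dotv x xi).
Proof. by under eq_fun do rewrite dotvC; exact: meas_dotv. Qed.

Lemma cmeas_char xi : cmeas (fun x : E => expNi (dotv x xi)).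
Proof. by apply: cmeas_expNi; exact: meas_dotvr. Qed.

Lemma cint_able_char f xi : cint_able mu f -> cint_able mu (fun x => f x * expNi (dotv x xi)).
Proof.
move=> if_; apply: (@cint_ableM _ _ _ mu f (fun x => expNi (dotv x xi)) 1) => //.
  exact: cmeas_char.
by move=> x; rewrite cnorm_expNi.
Qed.

Lemma F_bound f xi : cint_able mu f -> cnorm (F f xi) <= cd * \int[mu]_x cnorm (f x).
Proof.
move=> if_; rewrite FE cnormM cnorm_real gtr0_norm ?cd_gt0// ler_pM2l ?cd_gt0//.
apply: le_trans (cnorm_cint (cint_able_char xi if_)) _.
rewrite le_eqVlt; apply/orP; left; apply/eqP; apply: eq_Rintegral => x _.
by rewrite cnormM cnorm_expNi mulr1.
Qed.

Lemma FD f g xi : cint_able mu f -> cint_able mu g ->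
  F (fun x => f x + g x) xi = F f xi + F g xi.
Proof.
move=> if_ ig; rewrite !FE -mulrDr -cintD; [|exact: cint_able_char..].
by congr (_ * _); apply: eq_cint => x; rewrite mulrDl.
Qed.

Lemma FZ (c : R[i]) f xi : cint_able mu f -> F (fun x => c * f x) xi = c * F f xi.
Proof.
move=> if_; rewrite !FE mulrCA -[c * cint _ _]cintZ; last exact: cint_able_char.
by congr (_ * _); apply: eq_cint => x; rewrite mulrA.
Qed.

Lemma cint_able_kernel f h : cint_able mu f -> cint_able mu h ->
  cint_able (mu \x mu)%E (fun z => f z.1 * h z.2 * expNi (dotv z.1 z.2)).
Proof.
move=> if_ ih.
apply: (@cint_able_tensor _ _ _ _ _ mu mu f h (fun z => expNi (dotv z.1 z.2)) 1) => //.
  by apply: cmeas_expNi; exact: meas_dotv2.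
by move=> z; rewrite cnorm_expNi.
Qed.

Definition abeld (eps : R) xi : R := \prod_(i < d) abel eps (xi ord0 i).
Definition poissond (eps : R) x : R := \prod_(i < d) poisson eps (x ord0 i).

Lemma abeld_gt0 eps xi : 0 < abeld eps xi.
Proof. by apply: prodr_gt0 => i _; exact: expR_gt0. Qed.

Lemma abeld_le1 (eps : R) xi : 0 < eps -> abeld eps xi <= 1.
Proof.
move=> e0; apply: prodr_ile1 => i _; rewrite expR_ge0 /=.
by rewrite -expR0 ler_expR mulNr oppr_le0 mulr_ge0// ltW.
Qed.

Lemma meas_abeld eps : measurable_fun setT (abeld eps : E -> R).
Proof. exact: (meas_prod_coor (fun=> meas_abel eps)). Qed.

Lemma abeld_cint eps x : 0 < eps ->
  rint mu (abeld eps) /\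
  cint mu (fun xi => (abeld eps xi)%:C%C * expNi (dotv x xi)) = (poissond eps x)%:C%C.
Proof.
move=> e0; apply: (cint_expNi_prod x (rint_abel e0)) => a.
exact: cint_abel.
Qed.

(** Weighting by an integrable positive function makes the kernel integrable in
both variables, hence the transform measurable. *)
Lemma cmeas_F f : cint_able mu f -> cmeas (F f).
Proof.
move=> if_; have [ia _] := abeld_cint (0 : E) ltr01.
have [_ i2] := cint_able_fubini (cint_able_kernel if_ (cint_able_real ia)).
have -> : F f = fun xi => ((cd / abeld 1 xi)%:C)%C *
    cint mu (fun x => f x * (abeld 1 xi)%:C%C * expNi (dotv x xi)).
  apply/funext => xi; rewrite FE.
  have -> : cint mu (fun x => f x * (abeld 1 xi)%:C%C * expNi (dotv x xi)) =
      cint mu (fun x => (abeld 1 xi)%:C%C * (f x * expNi (dotv x xi))).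
    by apply: eq_cint => x; ring.
  rewrite cintZ; last exact: cint_able_char.
  by rewrite mulrA -rmorphM /= divfK// gt_eqF// abeld_gt0.
apply: cmeasM; last exact: cint_able_meas i2.
apply: cmeas_real; apply: measurable_funM; first exact: measurable_cst.
have -> : (fun xi : E => (abeld 1 xi)^-1) = fun xi => \prod_(i < d) (expR `|xi ord0 i|).
  apply/funext => xi; rewrite -prodfV; apply: eq_bigr => i _.
  by rewrite /abel -expRN mulN1r opprK.
have me : measurable_fun [set: R] (fun a : R => expR `|a|).
  by apply: measurableT_comp => //; exact: measurable_normr.
exact: (meas_prod_coor (fun=> me)).
Qed.

End fourier_integral.

Lemma EFin_Rintegral {d} {T : measurableType d} {R : realType}
    (m : {measure set T -> \bar R}) (u : T -> R) : rint m u ->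
  ((\int[m]_x u x)%R%:E = \int[m]_x (u x)%:E)%E.
Proof. by move=> iu; rewrite fineK//; exact: (integrable_fin_num measurableT iu). Qed.

Section plancherel.
Context {R : realType} {d : nat}.
Local Notation E := 'rV[R]_d.
Local Notation leb := (@lebesgue_measure R).
Local Notation mu := (@lebesgue_rV R d).
Local Notation F := (@fourier_integral R d).
Local Notation cd := (@cd R d).
Implicit Types (f g h : E -> R[i]) (x y xi : E).

(** Fubini, for a kernel that is symmetric in [x] and [xi]. *)
Lemma multiplication_formula f h : cint_able mu f -> cint_able mu h ->
  cint mu (fun xi => F f xi * h xi) = cint mu (fun x => f x * F h x).
Proof.
move=> if_ ih; have fub := cfubini (cint_able_kernel if_ ih).
have [i1 i2] := cint_able_fubini (cint_able_kernel if_ ih).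
transitivity (cd%:C%C * cint mu (fun xi =>
    cint mu (fun x => f x * h xi * expNi (dotv x xi)))).
  rewrite -(cintZ cd%:C%C i2); apply: eq_cint => xi; rewrite FE -mulrA; congr (_ * _).
  rewrite mulrC -(cintZ (h xi) (cint_able_char xi if_)).
  by apply: eq_cint => x; ring.
rewrite -[X in _ * X = _]fub -(cintZ cd%:C%C i1); apply: eq_cint => x.
rewrite FE [RHS]mulrCA; congr (_ * _).
rewrite -(cintZ (f x) (cint_able_char x ih)).
by apply: eq_cint => xi; rewrite /= dotvC; ring.
Qed.

Lemma cint_able_F f h : cint_able mu f -> cint_able mu h ->
  cint_able mu (fun xi => h xi * F f xi).
Proof.
move=> if_ ih.
apply: (@cint_ableM _ _ _ mu h (F f) (cd * \int[mu]_x cnorm (f x))) => //.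
  exact: cmeas_F.
by move=> xi; exact: F_bound.
Qed.

(** The product Poisson kernel, normalised to total mass one. *)
Definition pk (eps : R) x : R := cd ^+ 2 * poissond eps x.

Lemma pk_ge0 (eps : R) x : 0 < eps -> 0 <= pk eps x.
Proof.
by move=> e0; rewrite mulr_ge0// ?sqr_ge0// prodr_ge0// => i _; exact: poisson_ge0.
Qed.

Let cc_pk_ge0 (eps : R) (a b : R[i]) x : 0 < eps -> 0 <= cnorm a * cnorm b * pk eps x.
Proof. by move=> e0; rewrite mulr_ge0 ?pk_ge0// mulr_ge0// cnorm_ge0. Qed.

Lemma pk_sym (eps : R) x y : pk eps (x - y) = pk eps (y - x).
Proof.
rewrite /pk /poissond; congr (_ * _); apply: eq_bigr => i _.
by rewrite -poissonN !mxE opprB.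
Qed.

Lemma poisson_le (eps t : R) : 0 < eps -> poisson eps t <= 2 / eps.
Proof.
move=> e0; rewrite /poisson ler_pdivrMr; last first.
  by rewrite ltr_wpDr ?sqr_ge0// exprn_gt0.
rewrite mulrAC ler_pdivlMr// expr2.
by have := sqr_ge0 t; nra.
Qed.

Lemma meas_poisson (eps : R) : 0 < eps -> measurable_fun [set: R] (poisson eps).
Proof.
move=> e0; apply: continuous_measurable_fun.
have -> : poisson eps = fun t => poisson eps (0 - t).
  by apply/funext => t; rewrite sub0r poissonN.
exact: continuous_poisson.
Qed.

Lemma meas_pk2 (eps : R) : 0 < eps ->
  measurable_fun setT (fun z : E * E => pk eps (z.2 - z.1)).
Proof.
move=> e0; apply: measurable_funM; first exact: measurable_cst.
apply: (@meas_prod R _ _ _ _ _ (fun i (z : E * E) => poisson eps ((z.2 - z.1) ord0 i))) => i.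
apply: measurableT_comp; first exact: meas_poisson.
have -> : (fun z : E * E => (z.2 - z.1) ord0 i) = fun z => z.2 ord0 i - z.1 ord0 i.
  by apply/funext => z; rewrite !mxE.
by apply: measurable_funB;
  [exact: measurableT_comp (meas_coor i) measurable_snd|
   exact: measurableT_comp (meas_coor i) measurable_fst].
Qed.

Lemma meas_pk (eps : R) x : 0 < eps -> measurable_fun setT (fun y => pk eps (y - x)).
Proof.
move=> e0; exact: (measurableT_comp (meas_pk2 e0) (measurable_pair1 x)).
Qed.

Lemma pk_bound (eps : R) : 0 < eps -> exists K, forall x, `|pk eps x| <= K.
Proof.
move=> e0; exists (cd ^+ 2 * \prod_(i < d) (2 / eps)) => x.
rewrite ger0_norm ?pk_ge0// ler_wpM2l ?sqr_ge0//.
by apply: ler_prod => i _; rewrite poisson_ge0// poisson_le.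
Qed.

Lemma cd_sqr : cd ^+ 2 * (2 * pi) ^+ d = 1.
Proof.
have p0 : 0 < 2 * pi :> R by rewrite mulr_gt0// pi_gt0.
rewrite -powR_mulrn ?ltW ?cd_gt0// -powRrM -[(2 * pi) ^+ d]powR_mulrn ?ltW//.
rewrite -powRD; last by rewrite (gt_eqF p0) implybT.
by rewrite mulNr divfK ?pnatr_eq0// addNr powRr0.
Qed.

Lemma integral_pk_le (eps : R) x : 0 < eps -> (\int[mu]_y (pk eps (y - x))%:E <= 1)%E.
Proof.
move=> e0; rewrite /pk /poissond.
under eq_integral do rewrite EFinM.
have mp (i : 'I_d) : measurable_fun setT (fun t : R => poisson eps (x ord0 i - t)).
  by apply: continuous_measurable_fun; exact: continuous_poisson.
have pE y : \prod_(i < d) poisson eps ((y - x) ord0 i) =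
    \prod_(i < d) poisson eps (x ord0 i - y ord0 i).
  by apply: eq_bigr => i _; rewrite -poissonN !mxE opprB.
under eq_integral do rewrite pE.
rewrite ge0_integralZl//; last 3 first.
- by apply/measurable_EFinP; exact: (meas_prod_coor mp).
- by move=> y _; rewrite lee_fin prodr_ge0// => i _; exact: poisson_ge0.
- by rewrite lee_fin sqr_ge0.
rewrite (ge0_integral_prod (h := fun i t => poisson eps (x ord0 i - t)))//; last first.
  by move=> i t; exact: poisson_ge0.
have E1 : (1%E = (cd ^+ 2)%:E * (\prod_(i < d) (2 * pi) : R)%:E)%E.
  by rewrite -EFinM prodr_const card_ord cd_sqr.
rewrite [leRHS]E1 lee_wpmul2l ?lee_fin ?sqr_ge0//.
suff /andP[] : (0 <= \prod_(i < d) \int[leb]_t (poisson eps (x ord0 i - t))%:E <=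
    (\prod_(i < d) (2 * pi))%:E)%E by [].
elim/big_ind2 : _ => [|a b a' b' /andP[a0 ab] /andP[b0 bb]|i _].
- by rewrite lee01 lexx.
- by rewrite mule_ge0// EFinM lee_pmul.
- rewrite integral_poisson_le// andbT.
  by apply: integral_ge0 => t _; rewrite lee_fin poisson_ge0.
Qed.

Definition smooth (eps : R) g x : R[i] :=
  cint mu (fun y => g y * (pk eps (y - x))%:C%C).

Lemma cint_able_pk (eps : R) g x : 0 < eps -> cint_able mu g ->
  cint_able mu (fun y => g y * (pk eps (y - x))%:C%C).
Proof.
move=> e0 ig; have [K pK] := pk_bound e0.
apply: (@cint_ableM _ _ _ mu g (fun y => (pk eps (y - x))%:C%C) K) => //.
  by apply: cmeas_real; exact: meas_pk.
by move=> y; rewrite cnorm_real.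
Qed.

Lemma cint_able_abeld (eps : R) : 0 < eps -> cint_able mu (fun xi => (abeld eps xi)%:C%C).
Proof. by move=> e0; apply: cint_able_real; exact: (abeld_cint 0 e0).1. Qed.

Lemma cint_able_abeld_F (eps : R) g : 0 < eps -> cint_able mu g ->
  cint_able mu (fun xi => (abeld eps xi)%:C%C * (F g xi)^*).
Proof.
move=> e0 ig.
apply: (@cint_ableM _ _ _ mu (fun xi => (abeld eps xi)%:C%C) (fun xi => (F g xi)^*)
  (cd * \int[mu]_x cnorm (g x))).
- exact: cint_able_abeld.
- by apply: cmeasJ; exact: cmeas_F.
- by move=> xi; rewrite cnormJ; exact: F_bound.
Qed.

(** Applying the multiplication formula twice turns the Abel regularisation
into a convolution with the Poisson kernel. *)
Lemma F_abel (eps : R) g x : 0 < eps -> cint_able mu g ->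
  F (fun xi => (abeld eps xi)%:C%C * (F g xi)^*) x = (smooth eps g x)^*.
Proof.
move=> e0 ig.
have ia := cint_able_abeld e0.
have ik : cint_able mu (fun xi => (abeld eps xi)%:C%C * expNi (dotv xi (- x))).
  exact: cint_able_char.
transitivity ((cd%:C%C * cint mu (fun xi => F g xi *
    ((abeld eps xi)%:C%C * expNi (dotv xi (- x)))))^*).
  rewrite FE cJM conjc_real; congr (_ * _); rewrite -cintJ; last first.
    have := cint_able_F ig ik; congr (cint_able _ _).
    by apply/funext => xi; rewrite mulrC.
  apply: eq_cint => xi; rewrite (cJM (F g xi)) [(_ * expNi _)^*]cJM conjc_real.
  by rewrite -expNiN dotvNr opprK mulrCA mulrA.
rewrite multiplication_formula// -cintZ; last first.
  have := cint_able_F ik ig; apply.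
congr (_^*); apply: eq_cint => y; rewrite mulrCA; congr (_ * _).
rewrite FE /pk expr2 -mulrA !rmorphM /=; congr (_ * (_ * _)).
rewrite -(abeld_cint (y - x) e0).2; apply: eq_cint => xi.
rewrite -mulrA -expNiD; congr (_ * expNi _).
by rewrite -dotvDr addrC dotvC.
Qed.

Lemma abel_identity (eps : R) f g : 0 < eps -> cint_able mu f -> cint_able mu g ->
  cint mu (fun xi => F f xi * (F g xi)^* * (abeld eps xi)%:C%C) =
  cint mu (fun x => f x * (smooth eps g x)^*).
Proof.
move=> e0 if_ ig.
have ih := cint_able_abeld_F e0 ig.
transitivity (cint mu (fun xi => F f xi * ((abeld eps xi)%:C%C * (F g xi)^*))).
  by apply: eq_cint => xi; ring.
by rewrite multiplication_formula//; apply: eq_cint => x; rewrite F_abel.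
Qed.

Lemma smooth_le (eps : R) g x : 0 < eps -> cint_able mu g ->
  ((cnorm (smooth eps g x))%:E <= \int[mu]_y (cnorm (g y) * pk eps (y - x))%:E)%E.
Proof.
move=> e0 ig; have ip := cint_able_pk x e0 ig.
apply: (@le_trans _ _ (\int[mu]_y cnorm (g y * (pk eps (y - x))%:C%C))%R%:E).
  by rewrite lee_fin; exact: cnorm_cint.
rewrite EFin_Rintegral; last by have /cint_ableP[] := ip.
rewrite le_eqVlt; apply/orP; left; apply/eqP; apply: eq_integral => y _.
by rewrite cnormM cnorm_real ger0_norm// pk_ge0.
Qed.

(** Schur test: both marginals of the Poisson kernel have mass at most one. *)
Lemma schur_pk (eps : R) f : 0 < eps -> L2 mu f ->
  (\int[mu]_x \int[mu]_y (cnorm (f x) * cnorm (f y) * pk eps (y - x))%:E <=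
   (ip2 mu f f)%:E)%E.
Proof.
move=> e0 Lf; pose a x := cnorm (f x) ^+ 2 / 2.
have a0 x : 0 <= a x by rewrite divr_ge0// sqr_ge0.
have ma : measurable_fun setT a.
  by apply: measurable_funM; [exact: meas_sqr_cnorm Lf.1|exact: measurable_cst].
have mk := meas_pk2 e0.
have k0 z : 0 <= pk eps z by exact: pk_ge0.
pose A (z : E * E) := (a z.1 * pk eps (z.2 - z.1))%:E.
pose B (z : E * E) := (a z.2 * pk eps (z.2 - z.1))%:E.
have mA : measurable_fun setT A.
  apply/measurable_EFinP; apply: measurable_funM => //.
  exact: measurableT_comp ma measurable_fst.
have mB : measurable_fun setT B.
  apply/measurable_EFinP; apply: measurable_funM => //.
  exact: measurableT_comp ma measurable_snd.
have A0 z : (0 <= A z)%E by rewrite lee_fin mulr_ge0.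
have B0 z : (0 <= B z)%E by rewrite lee_fin mulr_ge0.
have ia : (\int[mu]_x (a x)%:E = (ip2 mu f f)%:E * (2^-1)%:E)%E.
  rewrite -(integral_sqr Lf) muleC -ge0_integralZl//; first last.
  - by move=> x _; rewrite lee_fin sqr_ge0.
  - by apply/measurable_EFinP; exact: meas_sqr_cnorm Lf.1.
  by apply: eq_integral => x _; rewrite -EFinM mulrC.
have half (k : E -> E -> R) : (forall x, measurable_fun setT (k x)) ->
    (forall x y, 0 <= k x y) ->
    measurable_fun setT (fun x => \int[mu]_y (a x * k x y)%:E)%E ->
    (forall x, \int[mu]_y (k x y)%:E <= 1)%E ->
    (\int[mu]_x \int[mu]_y (a x * k x y)%:E <= (ip2 mu f f)%:E * (2^-1)%:E)%E.
  move=> mk' k0' mak k1; rewrite -ia; apply: ge0_le_integral => //.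
  - by move=> x _; apply: integral_ge0 => y _; rewrite lee_fin mulr_ge0.
  - by apply/measurable_EFinP.
  - move=> x _; under eq_integral do rewrite EFinM.
    rewrite ge0_integralZl//; first last.
    + by rewrite lee_fin.
    + by move=> y _; rewrite lee_fin.
    + by apply/measurable_EFinP.
    by rewrite -[leRHS]mule1 lee_wpmul2l// lee_fin.
apply: (@le_trans _ _ (\int[mu]_x \int[mu]_y (A (x, y) + B (x, y)))%E).
  apply: ge0_le_integral => //.
  - move=> x _; apply: integral_ge0 => y _.
    by rewrite lee_fin cc_pk_ge0.
  - apply: (@measurable_fun_fubini_tonelli_F _ _ _ _ _ mu (fun z : E * E =>
      (cnorm (f z.1) * cnorm (f z.2) * pk eps (z.2 - z.1))%:E)); last first.
      by move=> z; rewrite lee_fin cc_pk_ge0.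
    apply/measurable_EFinP; apply: measurable_funM => //.
    have mc := meas_cnorm Lf.1.
    by apply: measurable_funM;
      [exact: measurableT_comp mc measurable_fst|exact: measurableT_comp mc measurable_snd].
  - apply: (@measurable_fun_fubini_tonelli_F _ _ _ _ _ mu (fun z => A z + B z)%E); last first.
      by move=> z; rewrite adde_ge0.
    exact: emeasurable_funD.
  - move=> x _; apply: ge0_le_integral => //.
    + by move=> y _; rewrite lee_fin cc_pk_ge0.
    + apply/measurable_EFinP; apply: measurable_funM; last exact: meas_pk.
      by apply: measurable_funM; [exact: measurable_cst|exact: meas_cnorm Lf.1].
    + by apply: emeasurable_funD;
       [exact: measurableT_comp mA (measurable_pair1 x)
       |exact: measurableT_comp mB (measurable_pair1 x)].
    + move=> y _; rewrite -EFinD lee_fin -mulrDl ler_wpM2r// /a.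
      by have := sqr_ge0 (cnorm (f x) - cnorm (f y)); nra.
have -> : (\int[mu]_x \int[mu]_y (A (x, y) + B (x, y)) =
    \int[mu]_x \int[mu]_y A (x, y) + \int[mu]_x \int[mu]_y B (x, y))%E.
  rewrite -ge0_integralD//; first last.
  - exact: (measurable_fun_fubini_tonelli_F B mB B0).
  - by move=> x _; apply: integral_ge0.
  - exact: (measurable_fun_fubini_tonelli_F A mA A0).
  - by move=> x _; apply: integral_ge0.
  apply: eq_integral => x _; rewrite ge0_integralD//.
  - exact: measurableT_comp mA (measurable_pair1 x).
  - exact: measurableT_comp mB (measurable_pair1 x).
rewrite (fubini_tonelli _ mB)//.
have -> : (ip2 mu f f)%:E = ((ip2 mu f f)%:E * (2^-1)%:E + (ip2 mu f f)%:E * (2^-1)%:E)%E.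
  by rewrite -!EFinM -EFinD; congr EFin; lra.
apply: leeD.
- apply: half => //.
  + by move=> x; exact: meas_pk.
  + exact: (measurable_fun_fubini_tonelli_F A mA A0).
  + by move=> x; exact: integral_pk_le.
- have sw (x y : E) : pk eps (y - x) = pk eps (x - y) by exact: pk_sym.
  apply: (half (fun y x => pk eps (y - x))) => //.
  + by move=> y; under eq_fun do rewrite sw; exact: meas_pk.
  + exact: (measurable_fun_fubini_tonelli_G B mB B0).
  + by move=> y; under eq_integral do rewrite sw; exact: integral_pk_le.
Qed.

Lemma abeldE (eps : R) xi : abeld eps xi = expR (- (eps * \sum_(i < d) `|xi ord0 i|)).
Proof.
rewrite /abeld /abel mulr_sumr -sumrN expR_sum.
by apply: eq_bigr => i _; rewrite mulNr.
Qed.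

Lemma cvg_abeld xi : abeld n.+1%:R^-1 xi @[n --> \oo] --> (1 : R).
Proof.
apply: (cvg_ext (f := fun n => expR (- (n.+1%:R^-1 * \sum_(i < d) `|xi ord0 i|)))); last first.
  by move=> n; rewrite abeldE.
have : - (n.+1%:R^-1 * \sum_(i < d) `|xi ord0 i|) @[n --> \oo] --> - (0 * \sum_(i < d) `|xi ord0 i|).
  by apply: cvgN; apply: cvgMl; exact: cvg_harmonic.
rewrite mul0r oppr0 => h.
have := cvg_comp _ _ h (@continuous_expR R 0); rewrite expR0; apply.
Qed.



(** The regularised square norm of [F f] is a double integral of [f] against the
Poisson kernel, which the Schur test bounds; Fatou removes the regularisation. *)
Lemma F_contraction f : cint_able mu f -> L2 mu f ->
  L2 mu (F f) /\ ip2 mu (F f) (F f) <= ip2 mu f f.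
Proof.
move=> if_ Lf; have mF := cmeas_F if_.
have key (eps : R) : 0 < eps ->
    (\int[mu]_xi (cnorm (F f xi) ^+ 2 * abeld eps xi)%:E <= (ip2 mu f f)%:E)%E.
  move=> e0.
  have iA : rint mu (fun xi => cnorm (F f xi) ^+ 2 * abeld eps xi).
    have := (abeld_cint (0 : E) e0).1.
    move=> /(rintZ ((cd * \int[mu]_x cnorm (f x)) ^+ 2)) h; apply: (rint_le _ h).
      by apply: measurable_funM; [exact: meas_sqr_cnorm|exact: meas_abeld].
    move=> xi; rewrite ger0_norm; last by rewrite mulr_ge0 ?sqr_ge0// ltW// abeld_gt0.
    rewrite ler_wpM2r ?(ltW (abeld_gt0 _ _))// ler_sqr ?nnegrE ?cnorm_ge0//.
      exact: F_bound.
    exact: le_trans (cnorm_ge0 _) (F_bound xi if_).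
  rewrite -EFin_Rintegral//.
  have -> : \int[mu]_xi (cnorm (F f xi) ^+ 2 * abeld eps xi) =
      Re (cint mu (fun xi => F f xi * (F f xi)^* * (abeld eps xi)%:C%C)).
    apply: eq_Rintegral => xi _; rewrite sqr_cnorm !cE /=; ring.
  rewrite abel_identity//.
  apply: le_trans; last exact: (schur_pk e0 Lf).
  have isf : cint_able mu (fun x => f x * (smooth eps f x)^*).
    have ih := cint_able_abeld_F e0 if_.
    have := cint_able_F ih if_; congr (cint_able _ _).
    by apply/funext => x; rewrite F_abel.
  apply: (@le_trans _ _ (\int[mu]_x cnorm (f x * (smooth eps f x)^*))%R%:E).
    rewrite lee_fin; apply: le_trans (ler_norm _) _.
    by apply: le_trans (Re_le_cnorm _) _; exact: cnorm_cint.
  have /cint_ableP[mi ii] := isf.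
  rewrite EFin_Rintegral//; apply: ge0_le_integral => //.
  - by move=> x _; rewrite lee_fin cnorm_ge0.
  - by apply/measurable_EFinP; exact: meas_cnorm.
  - apply: (@measurable_fun_fubini_tonelli_F _ _ _ _ _ mu (fun z : E * E =>
      (cnorm (f z.1) * cnorm (f z.2) * pk eps (z.2 - z.1))%:E)); last first.
      by move=> z; rewrite lee_fin cc_pk_ge0.
    apply/measurable_EFinP; apply: measurable_funM; last exact: meas_pk2.
    have mc := meas_cnorm Lf.1.
    by apply: measurable_funM;
      [exact: measurableT_comp mc measurable_fst|exact: measurableT_comp mc measurable_snd].
  - move=> x _; rewrite cnormM cnormJ EFinM.
    apply: le_trans (lee_wpmul2l _ (smooth_le x e0 if_)) _.
      by rewrite lee_fin cnorm_ge0.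
    rewrite -ge0_integralZl//; first last.
    + by rewrite lee_fin cnorm_ge0.
    + by move=> y _; rewrite lee_fin mulr_ge0 ?cnorm_ge0// pk_ge0.
    + apply/measurable_EFinP; apply: measurable_funM; last exact: meas_pk.
      exact: meas_cnorm Lf.1.
    rewrite le_eqVlt; apply/orP; left; apply/eqP; apply: eq_integral => y _.
    by rewrite -EFinM mulrA.
have B : (\int[mu]_xi (cnorm (F f xi) ^+ 2)%:E <= (ip2 mu f f)%:E)%E.
  apply: (@fatou_le _ _ _ mu (fun n xi => cnorm (F f xi) ^+ 2 * abeld n.+1%:R^-1 xi)).
  - by move=> n; apply: measurable_funM; [exact: meas_sqr_cnorm|exact: meas_abeld].
  - exact: meas_sqr_cnorm.
  - by move=> n xi; rewrite mulr_ge0 ?sqr_ge0// ltW// abeld_gt0.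
  - apply: aeW => xi; rewrite -[X in _ --> X]mulr1.
    by apply: cvgMr; exact: cvg_abeld.
  - by move=> n; apply: key; rewrite invr_gt0.
have LF : L2 mu (F f).
  split => //; apply/ge0_rintP; first exact: meas_sqr_cnorm.
    by move=> xi; exact: sqr_ge0.
  by apply: le_lt_trans B _; rewrite ltry.
by split => //; rewrite -lee_fin -(integral_sqr LF).
Qed.

End plancherel.

(** * Convergence in norm *)

Lemma cvg_squeeze0 {R : realType} (a c : nat -> R) (l : R) :
  (forall n, `|a n - l| <= c n) -> c n @[n --> \oo] --> (0 : R) -> a n @[n --> \oo] --> l.
Proof.
move=> ac c0; apply/cvgrPdist_le => e e0.
have /cvgrPdist_le/(_ e e0) := c0; apply: filterS => n; rewrite sub0r normrN => ce.
by rewrite distrC; apply: le_trans (ac n) _; exact: le_trans (ler_norm _) ce.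
Qed.

Lemma lim_uniq {R : realType} (a : nat -> R) (l l' : R) :
  a n @[n --> \oo] --> l -> a n @[n --> \oo] --> l' -> l = l'.
Proof. by move=> h h'; rewrite -(cvg_lim _ h)// -(cvg_lim _ h'). Qed.

Lemma cvg_prodr {R : realType} (I : Type) (r : seq I) (h : I -> nat -> R) (l : I -> R) :
  (forall i, h i n @[n --> \oo] --> l i) ->
  \prod_(i <- r) h i n @[n --> \oo] --> \prod_(i <- r) l i.
Proof.
move=> hl; elim: r => [|i r IH].
  by rewrite big_nil; under eq_fun do rewrite big_nil; exact: cvg_cst.
by rewrite big_cons; under eq_fun do rewrite big_cons; exact: cvgM.
Qed.

Section norm_convergence.
Context {R : realType} {V : zmodType} (H : semiHilbert R V).
Local Notation D := (dom H).
Local Notation ip := (ip H).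
Implicit Types (x y z : V) (u v : nat -> V).

Definition hcvg u x := ip (u n - x) (u n - x) @[n --> \oo] --> (0 : R).

Lemma norm_ip x y : D x -> D y -> `|ip x y| <= Num.sqrt (ip x x) * Num.sqrt (ip y y).
Proof.
move=> Dx Dy; rewrite -sqrtrM ?ip_ge0// -sqrtr_sqr ler_wsqrtr//.
exact: cauchy_schwarz.
Qed.

Lemma hcvg_cst x : hcvg (fun=> x) x.
Proof.
rewrite /hcvg; apply: (cvg_ext (f := fun=> 0)); first exact: cvg_cst.
by move=> n; rewrite subrr (ip0l (dom0 H)).
Qed.

Lemma eq_hcvg u v x y : hcvg u x ->
  (forall n, ip (u n - x) (u n - x) = ip (v n - y) (v n - y)) -> hcvg v y.
Proof. by rewrite /hcvg => h e; apply: (cvg_ext h). Qed.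

Lemma hcvg_sqrt u x : hcvg u x -> Num.sqrt (ip (u n - x) (u n - x)) @[n --> \oo] --> (0 : R).
Proof.
move=> h; have := cvg_comp _ _ h (@sqrt_continuous R 0); rewrite sqrtr0; apply.
Qed.

Lemma hcvg_ip u v x y : (forall n, D (u n)) -> (forall n, D (v n)) -> D x -> D y ->
  hcvg u x -> hcvg v y -> ip (u n) (v n) @[n --> \oo] --> ip x y.
Proof.
move=> Du Dv Dx Dy ux vy.
pose a n := Num.sqrt (ip (u n - x) (u n - x)).
pose b n := Num.sqrt (ip (v n - y) (v n - y)).
apply: (@cvg_squeeze0 _ _ (fun n => a n * b n + a n * Num.sqrt (ip y y) +
    Num.sqrt (ip x x) * b n)).
  move=> n; have Dux := domB (Du n) Dx; have Dvy := domB (Dv n) Dy.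
  have -> : ip (u n) (v n) - ip x y =
      ip (u n - x) (v n - y) + ip (u n - x) y + ip x (v n - y).
    transitivity (ip ((u n - x) + x) ((v n - y) + y) - ip x y); first by rewrite !subrK.
    rewrite (ipDl Dux Dx); last by rewrite subrK.
    by rewrite (ipDr Dvy Dy Dux) (ipDr Dvy Dy Dx); ring.
  apply: le_trans (ler_normD _ _) _; apply: lerD; last exact: norm_ip.
  by apply: le_trans (ler_normD _ _) _; apply: lerD; exact: norm_ip.
have a0 := hcvg_sqrt ux; have b0 := hcvg_sqrt vy.
have : a n * b n + a n * Num.sqrt (ip y y) + Num.sqrt (ip x x) * b n @[n --> \oo]
    --> 0 * 0 + 0 * Num.sqrt (ip y y) + Num.sqrt (ip x x) * 0.
  by apply: cvgD; [apply: cvgD; [exact: cvgM|exact: cvgMl]|exact: cvgMr].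
by rewrite mul0r mulr0 mul0r !addr0.
Qed.

Lemma ip_distC x y : D x -> D y -> ip (x - y) (x - y) = ip (y - x) (y - x).
Proof.
move=> Dx Dy; have Dyx := domB Dy Dx.
by rewrite -(opprB y x) ipNl ?ipNr ?opprK//; exact: domN.
Qed.

Lemma ip_triangle x y z : D x -> D y -> D z ->
  ip (x - z) (x - z) <= 2 * ip (x - y) (x - y) + 2 * ip (y - z) (y - z).
Proof.
move=> Dx Dy Dz; rewrite -(subrKA y x (- z)).
by apply: ip_sqrD_le; exact: domB.
Qed.

Lemma hcvgD u v x y : (forall n, D (u n)) -> (forall n, D (v n)) -> D x -> D y ->
  hcvg u x -> hcvg v y -> hcvg (fun n => u n + v n) (x + y).
Proof.
move=> Du Dv Dx Dy ux vy.
apply: (@cvg_squeeze0 _ _ (fun n => 2 * ip (u n - x) (u n - x) + 2 * ip (v n - y) (v n - y))).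
  move=> n; rewrite subr0 ger0_norm ?ip_ge0// opprD addrACA.
  by apply: ip_sqrD_le; exact: domB.
rewrite -[X in _ --> X](addr0 0) -[X in X + _ ](mulr0 2) -[X in _ + X](mulr0 2).
by apply: cvgD; apply: cvgMr.
Qed.

Lemma hcvg_shift u v x : (forall n, D (u n)) -> (forall n, D (v n)) -> D x ->
  (forall n, ip (v n - u n) (v n - u n) <= n.+1%:R^-1) -> hcvg u x -> hcvg v x.
Proof.
move=> Du Dv Dx uv ux.
apply: (@cvg_squeeze0 _ _ (fun n => 2 * n.+1%:R^-1 + 2 * ip (u n - x) (u n - x))).
  move=> n; rewrite subr0 ger0_norm ?ip_ge0//.
  apply: le_trans (ip_triangle (Dv n) (Du n) Dx) _.
  by rewrite lerD2r ler_pM2l.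
rewrite -[X in _ --> X](addr0 0) -[X in X + _ ](mulr0 2) -[X in _ + X](mulr0 2).
by apply: cvgD; apply: cvgMr => //; exact: cvg_harmonic.
Qed.

Lemma hcvg_le u x (e : R) : hcvg u x -> 0 < e ->
  exists N, forall n, (N <= n)%N -> ip (u n - x) (u n - x) <= e.
Proof.
move=> /cvgrPdist_le/[swap] e0 /(_ e e0) [N _ h]; exists N => n Nn.
by have := h n Nn; rewrite /= sub0r normrN; apply: le_trans; exact: ler_norm.
Qed.

Lemma le_hcvg u x : (forall e : R, 0 < e ->
    exists N, forall n, (N <= n)%N -> ip (u n - x) (u n - x) <= e) -> hcvg u x.
Proof.
move=> h; apply/cvgrPdist_le => e e0; have [N hN] := h e e0.
exists N => // n /= Nn; rewrite sub0r normrN ger0_norm ?ip_ge0//; exact: hN.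
Qed.

Lemma hcvg_addn N u x : hcvg u x -> hcvg (fun m => u (N + m)%N) x.
Proof.
move=> h; apply: le_hcvg => e e0; have [K hK] := hcvg_le h e0; exists K => m Km.
by apply: hK; rewrite (leq_trans Km)// leq_addl.
Qed.

End norm_convergence.

Section dominated.
Context {d} {T : measurableType d} {R : realType} (m : {measure set T -> \bar R}).

Lemma Rintegral_cvg (u_ : nat -> T -> R) (u v : T -> R) :
  (forall n, measurable_fun setT (u_ n)) -> measurable_fun setT u -> rint m v ->
  (forall n x, `|u_ n x| <= v x) ->
  {ae m, forall x, u_ n x @[n --> \oo] --> u x} ->
  \int[m]_x u_ n x @[n --> \oo] --> \int[m]_x u x.
Proof.
move=> mu_ mu iv uv cu.
have [||||| iu _ h] := @dominated_convergence _ _ _ m setT measurableT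
  (fun n x => (u_ n x)%:E) (EFin \o u) (EFin \o v).
- by move=> n; apply/measurable_EFinP.
- by apply/measurable_EFinP.
- apply: filterS cu => x cx _.
  exact: cvg_EFin (nearW _ _) cx.
- exact: iv.
- by apply: aeW => x n _; rewrite lee_fin.
have h' : (\int[m]_x (u_ n x)%:E @[n --> \oo] --> (\int[m]_x u x)%:E)%E.
  by rewrite /Rintegral fineK//; exact: (integrable_fin_num measurableT iu).
exact: fine_cvg h'.
Qed.

Lemma cint_cvg (f : T -> R[i]) (t_ : nat -> T -> R) (t : T -> R) (K : R) :
  cint_able m f -> (forall n, measurable_fun setT (t_ n)) -> measurable_fun setT t ->
  (forall n x, `|t_ n x| <= K) ->
  {ae m, forall x, t_ n x @[n --> \oo] --> t x} ->
  Re (cint m (fun x => f x * (t_ n x)%:C%C)) @[n --> \oo] --> Re (cint m (fun x => f x * (t x)%:C%C)) /\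
  Im (cint m (fun x => f x * (t_ n x)%:C%C)) @[n --> \oo] --> Im (cint m (fun x => f x * (t x)%:C%C)).
Proof.
move=> [if1 if2] mt_ mt tK ct.
have key (a : T -> R) : rint m a ->
    \int[m]_x (a x * t_ n x) @[n --> \oo] --> \int[m]_x (a x * t x).
  move=> ia; have ma := rint_meas ia.
  apply: (@Rintegral_cvg _ _ (fun x => K * `|a x|)).
  - by move=> n; exact: measurable_funM.
  - exact: measurable_funM.
  - by apply: rintZ; exact: rint_norm.
  - by move=> n x; rewrite normrM mulrC ler_wpM2r.
  - by apply: filterS ct => x cx; exact: cvgMr.
split.
- have /= -> : Re (cint m (fun x => f x * (t x)%:C%C)) = \int[m]_x (Re (f x) * t x).
    by apply: eq_Rintegral => x _; rewrite !cE /=; ring.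
  apply: (cvg_ext (key _ if1)) => n.
  by apply: eq_Rintegral => x _; rewrite !cE /=; ring.
- have /= -> : Im (cint m (fun x => f x * (t x)%:C%C)) = \int[m]_x (Im (f x) * t x).
    by apply: eq_Rintegral => x _; rewrite !cE /=; ring.
  apply: (cvg_ext (key _ if2)) => n.
  by apply: eq_Rintegral => x _; rewrite !cE /=; ring.
Qed.

Lemma hcvg_trunc (Q : nat -> set T) (f : T -> R[i]) :
  (forall n, measurable (Q n)) -> (forall x, \forall n \near \oo, Q n x) -> L2 m f ->
  (forall n, L2 m (fun x => (\1_(Q n) x)%:C%C * f x)) /\
  hcvg (L2H m) (fun n x => (\1_(Q n) x)%:C%C * f x) f.
Proof.
move=> mQ Qn Lf.
have LQ n : L2 m (fun x => (\1_(Q n) x)%:C%C * f x).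
  apply: (@L2M _ _ _ m f _ 1) => //; first by apply: cmeas_real; exact: measurable_indic.
  by move=> x; rewrite cnorm_real indicE; case: (_ \in _); rewrite ?normr1// normr0.
split => //; rewrite /hcvg.
apply: (cvg_ext (f := fun n => \int[m]_x cnorm ((\1_(Q n) x)%:C%C * f x - f x) ^+ 2)); last first.
  by move=> n; rewrite -ip2_self.
have -> : (0 : R) = \int[m]_x (cst 0 x) by rewrite Rintegral_cst// mul0r.
apply: (@Rintegral_cvg _ _ (fun x => cnorm (f x) ^+ 2)) => //.
- by move=> n; apply: meas_sqr_cnorm; exact: (L2B (LQ n) Lf).1.
- exact: Lf.2.
- move=> n x; rewrite ger0_norm ?sqr_ge0// indicE.
  case: (_ \in _); first by rewrite mul1r subrr cnorm0 expr0n sqr_ge0.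
  by rewrite mul0r sub0r cnormN.
- apply: aeW => x; apply: cvg_near_cst; apply: filterS (Qn x) => n Qx.
  by rewrite indicE mem_set// mul1r subrr cnorm0 expr0n.
Qed.

End dominated.

(** * Fourier inversion on boxes *)

Section boxes_inversion.
Context {R : realType} {d : nat}.
Local Notation E := 'rV[R]_d.
Local Notation leb := (@lebesgue_measure R).
Local Notation mu := (@lebesgue_rV R d).
Local Notation F := (@fourier_integral R d).
Local Notation cd := (@cd R d).
Implicit Types (f g h : E -> R[i]) (x y xi : E) (a b : 'I_d -> R).

Definition boxf a b x : R[i] := (\1_(ocbox a b) x)%:C%C.

Lemma rint_indic (A : set E) : measurable A -> (mu A < +oo)%E -> rint mu \1_A.
Proof.
move=> mA Af; apply/ge0_rintP; first exact: measurable_indic.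
  by move=> x; rewrite indicE.
by rewrite integral_indic// setIT.
Qed.

Lemma boxf_L1 a b : cint_able mu (boxf a b).
Proof. by apply: cint_able_real; apply: rint_indic; [exact: measurable_ocbox|exact: ocbox_lty]. Qed.

Lemma boxf_L2 a b : L2 mu (boxf a b).
Proof.
have i1 : rint mu \1_(ocbox a b) by apply: rint_indic; [exact: measurable_ocbox|exact: ocbox_lty].
apply: (L2_le _ i1); first exact: cint_able_meas (boxf_L1 a b).
move=> x; rewrite cnorm_real indicE; case: (_ \in _); rewrite ?normr1 ?expr1n//.
by rewrite normr0 expr0n.
Qed.

Lemma indic_ocbox a b y : \1_(ocbox a b) y = \prod_(i < d) \1_(`]a i, b i]%classic) (y ord0 i) :> R.
Proof.
rewrite indicE; case: (boolP (y \in ocbox a b)) => [/set_mem yB|yB].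
  by rewrite big1// => i _; rewrite indicE mem_set//; exact: yB.
have [i yi] : exists i, ~ `]a i, b i]%classic (y ord0 i).
  by apply/existsNP => yB'; move/negP: yB; apply; exact/mem_set.
by rewrite (bigD1 i)//= indicE memNset// mul0r.
Qed.

Lemma smooth_boxf (eps : R) a b x : 0 < eps -> (forall i, a i <= b i) ->
  smooth eps (boxf a b) x = (cd ^+ 2 * \prod_(i < d)
    (2 * atan ((b i - x ord0 i) / eps) - 2 * atan ((a i - x ord0 i) / eps)))%:C%C.
Proof.
move=> e0 ab; apply: complex_ext => /=; last first.
  rewrite -[RHS](@mul0r _ (fine (mu setT))) -Rintegral_cst//.
  by apply: eq_Rintegral => y _; rewrite /= mulr0 mul0r addr0.
pose k i (t : R) := \1_(`]a i, b i]%classic) t * poisson eps (x ord0 i - t).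
have mk i : measurable_fun setT (k i).
  apply: measurable_funM; first exact: measurable_indic.
  by apply: continuous_measurable_fun; exact: continuous_poisson.
have k0 i t : 0 <= k i t by rewrite mulr_ge0 ?poisson_ge0// indicE.
transitivity (fine (\int[mu]_y ((cd ^+ 2)%:E * (\prod_(i < d) k i (y ord0 i))%:E))%E).
  congr fine; apply: eq_integral => y _; rewrite -EFinM /= mul0r subr0; congr EFin.
  rewrite indic_ocbox /pk mulrCA; congr (_ * _); rewrite -big_split; apply: eq_bigr => i _.
  by rewrite /k /= -[X in _ = _ * X]poissonN !mxE opprB.
rewrite ge0_integralZl//; last 3 first.
- by apply/measurable_EFinP; exact: meas_prod_coor.
- by move=> y _; rewrite lee_fin prodr_ge0.
- by rewrite lee_fin sqr_ge0.
rewrite ge0_integral_prod//.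
rewrite (eq_bigr (fun i => (2 * atan ((b i - x ord0 i) / eps) -
    2 * atan ((a i - x ord0 i) / eps))%:E)) => [|i _]; last first.
  rewrite -integral_poisson_itv// [RHS]integral_mkcond; apply: eq_integral => t _.
  by rewrite patchE /k indicE; case: ifP => _; rewrite ?mul1r ?mul0r.
by rewrite -(big_morph EFin EFinM (erefl _)).
Qed.

Lemma ae_coor (i : 'I_d) (c : R) : {ae mu, forall x, x ord0 i != c}.
Proof.
pose A j : set R := if j == i then [set c] else setT.
have mA j : measurable (A j) by rewrite /A; case: ifP.
exists [set x : E | forall j, A j (x ord0 j)]; split.
- exact: measurable_rectangle.
- rewrite lebesgue_rV_box// (bigD1 i)//= /A eqxx.
  by rewrite lebesgue_measure_set1 mul0e.
- move=> x /= /negP; rewrite negbK => /eqP xc j; rewrite /A.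
  by case: eqP => [->|].
Qed.

Lemma smooth_boxf_cvg a b : (forall i, a i <= b i) ->
  {ae mu, forall x, Re (smooth n.+1%:R^-1 (boxf a b) x) @[n --> \oo] --> (\1_(ocbox a b) x : R)}.
Proof.
move=> ab.
have : {ae mu, forall x, forall i, x ord0 i != a i /\ x ord0 i != b i}.
  apply: filter_forall => i.
  by apply: filterS2 (ae_coor i (a i)) (ae_coor i (b i)).
apply: filterS => x xab.
apply: (cvg_ext (f := fun n => cd ^+ 2 * \prod_(i < d)
    (2 * atan ((b i - x ord0 i) / n.+1%:R^-1) - 2 * atan ((a i - x ord0 i) / n.+1%:R^-1)))); last first.
  by move=> n; rewrite smooth_boxf ?invr_gt0.
have -> : \1_(ocbox a b) x = cd ^+ 2 * \prod_(i < d) (2 * pi * \1_(`]a i, b i]%classic) (x ord0 i)) :> R.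
  by rewrite big_split /= prodr_const card_ord mulrA cd_sqr mul1r indic_ocbox.
apply: cvgMr; apply: (cvg_prodr (h := fun i n => _)) => i.
by have [xa xb] := xab i; exact: cvg_poisson_itv.
Qed.

(** Parseval against a box: the Poisson means of a box are bounded by one and
converge to the box almost everywhere. *)
Lemma parseval_boxf f a b : (forall i, a i <= b i) -> cint_able mu f -> L2 mu f ->
  cint mu (fun xi => F f xi * (F (boxf a b) xi)^*) = cint mu (fun x => f x * boxf a b x).
Proof.
move=> ab if_ Lf; have ib := boxf_L1 a b; have Lb := boxf_L2 a b.
have [LFf _] := F_contraction if_ Lf; have [LFb _] := F_contraction ib Lb.
have iFF := L2_cint_able LFf (L2J LFb).
pose e n : R := n.+1%:R^-1; have e0 n : 0 < e n by rewrite invr_gt0.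
pose t n x := Re (smooth (e n) (boxf a b) x).
have tE n x : (smooth (e n) (boxf a b) x)^* = (t n x)%:C%C.
  by rewrite /t smooth_boxf//; apply: complex_ext; rewrite /= ?oppr0.
have [||| |r1 i1] := @cint_cvg _ _ _ mu _ (fun n => abeld (e n)) (cst 1) 1 iFF.
- by move=> n; exact: meas_abeld.
- exact: measurable_cst.
- by move=> n xi; rewrite ger0_norm ?abeld_le1// ltW// abeld_gt0.
- by apply: aeW => xi; exact: cvg_abeld.
have [||| |r2 i2] := @cint_cvg _ _ _ mu _ t (\1_(ocbox a b)) 1 if_.
- move=> n; have ih := cint_able_abeld_F (e0 n) ib.
  have [+ _] := cmeas_F ih; congr (measurable_fun _ _).
  by apply/funext => x; exact: (congr1 Re (etrans (F_abel x (e0 n) ib) (tE n x))).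
- by apply: measurable_indic; exact: measurable_ocbox.
- move=> n x; apply: le_trans (Re_le_cnorm _) _; rewrite -lee_fin.
  apply: le_trans (smooth_le x (e0 n) ib) _.
  apply: le_trans (integral_pk_le x (e0 n)); apply: ge0_le_integral => //.
  + by move=> y _; rewrite lee_fin mulr_ge0 ?cnorm_ge0// pk_ge0.
  + apply/measurable_EFinP; apply: measurable_funM; last exact: meas_pk.
    exact: meas_cnorm Lb.1.
  + by apply/measurable_EFinP; exact: meas_pk.
  + move=> y _; rewrite lee_fin ler_piMl ?pk_ge0// cnorm_real indicE.
    by case: (_ \in _); rewrite ?normr1// normr0.
- exact: smooth_boxf_cvg.
have E n : cint mu (fun xi => F f xi * (F (boxf a b) xi)^* * (abeld (e n) xi)%:C%C) =
    cint mu (fun x => f x * (t n x)%:C%C).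
  by rewrite abel_identity//; apply: eq_cint => x; rewrite tE.
transitivity (cint mu (fun xi => F f xi * (F (boxf a b) xi)^* * (cst 1 xi : R)%:C%C)).
  by apply: eq_cint => xi; rewrite /= mulr1.
apply: complex_ext.
- by apply: (lim_uniq r1); apply: (cvg_ext r2) => n; rewrite E.
- by apply: (lim_uniq i1); apply: (cvg_ext i2) => n; rewrite E.
Qed.

End boxes_inversion.

(** * The unitary Fourier transform *)

Section fourier_L2.
Context {R : realType} {d : nat}.
Local Notation E := 'rV[R]_d.
Local Notation mu := (@lebesgue_rV R d).
Local Notation F := (@fourier_integral R d).
Local Notation H := (L2H mu).
Local Notation L2 := (L2 mu).
Local Notation ip2 := (ip2 mu).
Local Notation hcvg := (hcvg (L2H mu)).
Implicit Types (f g h k : E -> R[i]) (x y xi : E).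

Lemma normr_le_1sqr (t : R) : `|t| <= 1 + t ^+ 2.
Proof. by rewrite -(real_normK (num_real t)); have := sqr_ge0 (`|t| - 1); have := normr_ge0 t; nra. Qed.

Definition L12 f := cint_able mu f /\ L2 f.
Definition cj f : E -> R[i] := fun x => (f x)^*.

Lemma FB f g : cint_able mu f -> cint_able mu g -> F (f - g) = F f - F g.
Proof.
move=> if_ ig; apply/funext => xi.
have -> : f - g = fun x => f x + (-1) * g x by apply/funext => x; rewrite mulN1r.
by rewrite (FD xi if_ (cint_ableZ (-1) ig)) FZ// mulN1r.
Qed.

Lemma cint_ableB f g : cint_able mu f -> cint_able mu g -> cint_able mu (f - g).
Proof.
move=> if_ ig; have := cint_ableD if_ (cint_ableZ (-1) ig); congr (cint_able _ _).
by apply/funext => x; rewrite mulN1r.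
Qed.

Lemma FL2 f : L12 f -> L2 (F f).
Proof. by move=> [if_ Lf]; exact: (F_contraction if_ Lf).1. Qed.

Lemma cvg_cLnorm2 (u : nat -> E -> R[i]) f : (forall n, L2 (u n)) -> L2 f ->
  (cLnorm 2%:E (fun x => u n x - f x)%R @[n --> \oo] --> 0)%E <-> hcvg u f.
Proof.
move=> Lu Lf.
have E2 n : cLnorm 2%:E (fun x => u n x - f x) = (Num.sqrt (ip2 (u n - f) (u n - f)))%:E.
  by rewrite cLnorm2E//; exact: L2B.
split => [h|h]; last first.
  apply: (cvg_ext (f := fun n => (Num.sqrt (ip2 (u n - f) (u n - f)))%:E)) => //.
  have h2 : (Num.sqrt (ip2 (u n - f) (u n - f)))%:E @[n --> \oo] --> (0%R : R)%:E.
    exact: cvg_EFin (nearW _ _) (hcvg_sqrt h).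
  exact: h2.
have h' : (Num.sqrt (ip2 (u n - f) (u n - f)))%:E @[n --> \oo] --> (0%R : R)%:E.
  by apply: (cvg_ext h) => n; rewrite E2.
have h2 := fine_cvg h'.
have : Num.sqrt (ip2 (u n - f) (u n - f)) * Num.sqrt (ip2 (u n - f) (u n - f)) @[n --> \oo]
   --> (0 * 0 : R) by apply: cvgM; exact: h2.
rewrite mul0r => h3; apply: (cvg_ext h3) => n.
by rewrite -expr2 sqr_sqrtr//; exact: (ip_ge0 H).
Qed.

Lemma is_fourierP f g : is_fourier f g <-> [/\ L2 f, L2 g &
  exists w, [/\ forall n, L12 (w n), hcvg w f & hcvg (fun n => F (w n)) g]].
Proof.
split=> [[/Lp2P Lf /Lp2P Lg [w [Lw wf wg]]]|[Lf Lg [w [Lw wf wg]]]].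
  have Lw' n : L12 (w n) by have [/Lp1P ? /Lp2P ?] := Lw n.
  split => //; exists w; split => //.
    by apply/cvg_cLnorm2 => // n; exact: (Lw' n).2.
  by apply/cvg_cLnorm2 => // n; exact: FL2.
split; [exact/Lp2P|exact/Lp2P|exists w; split].
- by move=> n; have [? ?] := Lw n; split; [exact/Lp1P|exact/Lp2P].
- by apply/cvg_cLnorm2 => // n; exact: (Lw n).2.
- by apply/cvg_cLnorm2 => // n; exact: FL2.
Qed.

Lemma is_fourier_dom f g : is_fourier f g -> L2 f /\ L2 g.
Proof. by move=> /is_fourierP[]. Qed.

Lemma ip2J f g : ip2 (cj f) (cj g) = ip2 f g.
Proof. by apply: eq_Rintegral => x _; rewrite !cE; ring. Qed.

Lemma cjK f : cj (cj f) = f.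
Proof. by apply/funext => x; rewrite /cj conjcK. Qed.

Lemma cjB f g : cj (f - g) = cj f - cj g.
Proof. by apply/funext => x; rewrite /cj !fctE; apply: complex_ext; rewrite !cE//; ring. Qed.

Lemma hcvgJ (u : nat -> E -> R[i]) f : hcvg u f -> hcvg (fun n => cj (u n)) (cj f).
Proof. by move=> /eq_hcvg; apply => n; rewrite -cjB; exact: (esym (ip2J _ _)). Qed.

Lemma L2cj f : L2 f -> L2 (cj f).
Proof. exact: L2J. Qed.

Lemma ip2Z (c : R[i]) f : L2 f ->
  ip2 (fun x => c * f x) (fun x => c * f x) = cnorm c ^+ 2 * ip2 f f.
Proof.
move=> Lf; rewrite /ip2 -RintegralZl//; last exact: rint_ip2.
by apply: eq_Rintegral => x _; rewrite sqr_cnorm !cE; ring.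
Qed.

Lemma hcvgZ (c : R[i]) (u : nat -> E -> R[i]) f : (forall n, L2 (u n)) -> L2 f ->
  hcvg u f -> hcvg (fun n x => c * u n x) (fun x => c * f x).
Proof.
move=> Lu Lf h; rewrite /hcvg -[X in _ --> X](mulr0 (cnorm c ^+ 2)).
have h' : cnorm c ^+ 2 * ip2 (u n - f) (u n - f) @[n --> \oo] --> cnorm c ^+ 2 * 0.
  exact: cvgMr.
apply: (cvg_ext h') => n; rewrite -ip2Z; last exact: L2B.
by apply: eq_Rintegral => x _; rewrite !fctE -!mulrBr.
Qed.

Lemma is_fourierZ (c : R[i]) f g : is_fourier f g ->
  is_fourier (fun x => c * f x) (fun xi => c * g xi).
Proof.
move=> /is_fourierP[Lf Lg [w [Lw wf wg]]]; apply/is_fourierP; split; try exact: L2Z.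
exists (fun n x => c * w n x); split.
- by move=> n; have [? ?] := Lw n; split; [exact: cint_ableZ|exact: L2Z].
- by apply: hcvgZ => // n; exact: (Lw n).2.
- rewrite (_ : (fun n => _) = fun n xi => c * F (w n) xi).
    by apply: hcvgZ => // n; exact: FL2.
  by apply/funext => n; apply/funext => xi; rewrite FZ//; exact: (Lw n).1.
Qed.

Lemma is_fourierD f g f' g' : is_fourier f g -> is_fourier f' g' ->
  is_fourier (f + f') (g + g').
Proof.
move=> /is_fourierP[Lf Lg [w [Lw wf wg]]] /is_fourierP[Lf' Lg' [w' [Lw' wf' wg']]].
apply/is_fourierP; split; try exact: L2D.
exists (fun n => w n + w' n); split.
- by move=> n; have [? ?] := Lw n; have [? ?] := Lw' n; split; [exact: cint_ableD|exact: L2D].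
- by apply: hcvgD => // n; [exact: (Lw n).2|exact: (Lw' n).2].
- rewrite (_ : (fun n => _) = fun n => F (w n) + F (w' n)).
    by apply: hcvgD => // n; exact: FL2.
  by apply/funext => n; apply/funext => xi; rewrite FD//; [exact: (Lw n).1|exact: (Lw' n).1].
Qed.

Lemma is_fourierB f g f' g' : is_fourier f g -> is_fourier f' g' ->
  is_fourier (f - f') (g - g').
Proof.
move=> h /(is_fourierZ (-1)) h'; have := is_fourierD h h'; congr is_fourier.
  by apply/funext => x; rewrite !fctE mulN1r.
by apply/funext => x; rewrite !fctE mulN1r.
Qed.

Lemma is_fourier_F f : L12 f -> is_fourier f (F f).
Proof.
move=> Lf; apply/is_fourierP; split; [exact: Lf.2|exact: FL2|].
exists (fun=> f); split => //; exact: hcvg_cst.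
Qed.

Lemma is_fourier_le f g : is_fourier f g -> ip2 g g <= ip2 f f.
Proof.
move=> /is_fourierP[Lf Lg [w [Lw wf wg]]].
have LFw n : L2 (F (w n)) by exact: FL2.
have Lw2 n : L2 (w n) by exact: (Lw n).2.
have cf := hcvg_ip (H := H) Lw2 Lw2 Lf Lf wf wf.
have cg := hcvg_ip (H := H) LFw LFw Lg Lg wg wg.
apply: (ler_cvg_to cg cf); apply: nearW => n.
by have [i1 i2] := Lw n; exact: (F_contraction i1 i2).2.
Qed.

(** Diagonal argument: each [u n] is approximated, together with its transform, by an
integrable function. *)
Lemma is_fourier_closed (u v : nat -> E -> R[i]) f g :
  (forall n, is_fourier (u n) (v n)) -> L2 f -> L2 g -> hcvg u f -> hcvg v g ->
  is_fourier f g.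
Proof.
move=> uv Lf Lg uf vg.
have Lu n := (is_fourier_dom (uv n)).1; have Lv n := (is_fourier_dom (uv n)).2.
have : forall n, exists w, [/\ L12 w, ip2 (w - u n) (w - u n) <= n.+1%:R^-1 &
    ip2 (F w - v n) (F w - v n) <= n.+1%:R^-1].
  move=> n; have /is_fourierP[_ _ [w [Lw wu wv]]] := uv n.
  have e0 : 0 < n.+1%:R^-1 :> R by rewrite invr_gt0.
  have [N1 h1] := hcvg_le wu e0; have [N2 h2] := hcvg_le wv e0.
  exists (w (maxn N1 N2)); split => //; [apply: h1|apply: h2].
    exact: leq_maxl.
  exact: leq_maxr.
move=> /choice[w hw]; apply/is_fourierP; split => //; exists w; split.
- by move=> n; have [] := hw n.
- apply: (hcvg_shift (H := H) Lu _ Lf _ uf); first by move=> n; have [[]] := hw n.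
  by move=> n; have [] := hw n.
- apply: (hcvg_shift (H := H) Lv _ Lg _ vg); first by move=> n; have [/FL2] := hw n.
  by move=> n; have [] := hw n.
Qed.

Lemma hcvg_null f g : ip2 (f - g) (f - g) = 0 -> hcvg (fun=> f) g.
Proof.
by move=> h; rewrite /hcvg; apply: (cvg_ext (f := fun=> 0)); [exact: cvg_cst|move=> n; rewrite [RHS]h].
Qed.

Lemma is_fourier_null f g f' g' : is_fourier f g -> L2 f' -> L2 g' ->
  ip2 (f - f') (f - f') = 0 -> ip2 (g - g') (g - g') = 0 -> is_fourier f' g'.
Proof.
move=> h Lf' Lg' ff' gg'.
by apply: (is_fourier_closed (u := fun=> f) (v := fun=> g)) => //; exact: hcvg_null.
Qed.

Lemma L12_trunc f (A : set E) : measurable A -> (mu A < +oo)%E -> L2 f ->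
  L12 (fun x => (\1_A x)%:C%C * f x).
Proof.
move=> mA Af Lf.
have LA : L2 (fun x => (\1_A x)%:C%C * f x).
  apply: (@L2M _ _ _ mu f _ 1) => //; first by apply: cmeas_real; exact: measurable_indic.
  by move=> x; rewrite cnorm_real indicE; case: (_ \in _); rewrite ?normr1// normr0.
split => //; apply: (cint_able_le LA.1 (rintD (rint_indic mA Af) Lf.2)) => x.
rewrite cnormM cnorm_real indicE; case: (_ \in _); last first.
  by rewrite normr0 mul0r add0r sqr_ge0.
by have := normr_le_1sqr (cnorm (f x)); rewrite normr1 mul1r ger0_norm ?cnorm_ge0.
Qed.

Lemma is_fourier_exists f : L2 f -> exists g, is_fourier f g.
Proof.
move=> Lf; pose w n x := (\1_(cube n) x)%:C%C * f x.
have mQ n : measurable (cube n : set E) by exact: measurable_ocbox.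
have [Lw wf] := hcvg_trunc mQ mem_cube Lf.
have Lw12 n : L12 (w n) by apply: L12_trunc => //; exact: ocbox_lty.
have [n|e e0|g Lg hg] := @riesz_fischer _ _ _ mu (fun n => F (w n)); first exact: FL2.
  have [|N hN] := hcvg_le wf (e := e / 4); first by rewrite divr_gt0.
  exists N => i j Ni Nj.
  have [[i1 l1] [i2 l2]] := (Lw12 i, Lw12 j).
  rewrite -FB//; apply: le_trans (F_contraction (cint_ableB i1 i2) (L2B l1 l2)).2 _.
  apply: le_trans (ip_triangle (H := H) l1 Lf l2) _.
  rewrite (ip_distC (H := H) Lf l2).
  apply: le_trans (lerD (ler_wpM2l _ (hN i Ni)) (ler_wpM2l _ (hN j Nj))) _ => //.
  by rewrite -mulrDr; lra.
exists g; apply/is_fourierP; split => //; exists w; split => //.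
exact: (le_hcvg (H := H)).
Qed.

Lemma ip2cjr f h : ip2 f (cj h) = Re (cint mu (fun x => f x * h x)).
Proof. by apply: eq_Rintegral => x _; rewrite !cE; ring. Qed.

(** Both sides of the multiplication formula are continuous for the norm. *)
Lemma is_fourier_dual f g h k : is_fourier f g -> is_fourier h k ->
  ip2 g (cj h) = ip2 f (cj k).
Proof.
move=> /is_fourierP[Lf Lg [w [Lw wf wg]]] /is_fourierP[Lh Lk [v [Lv vh vk]]].
have c1 := hcvg_ip (H := H) (fun n => FL2 (Lw n)) (fun n => L2cj (Lv n).2) Lg
  (L2cj Lh) wg (hcvgJ vh).
have c2 := hcvg_ip (H := H) (fun n => (Lw n).2) (fun n => L2cj (FL2 (Lv n))) Lf
  (L2cj Lk) wf (hcvgJ vk).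
apply: (lim_uniq c1); apply: (cvg_ext c2) => n.
rewrite -[LHS]/(ip2 _ _) -[RHS]/(ip2 _ _) !ip2cjr.
by rewrite multiplication_formula//; [exact: (Lw n).1|exact: (Lv n).1].
Qed.

(** Paired with a box, the transform of the conjugate of [F f] gives the same number
as the conjugate of [f], by duality and by Parseval against boxes; and boxes
determine a function almost everywhere. *)
Lemma is_fourier_inv_F f : L12 f -> is_fourier (cj (F f)) (cj f).
Proof.
move=> Lf; have [if_ L2f] := Lf; have LF := FL2 Lf.
have [k hk] := is_fourier_exists (L2cj LF).
have Lk := (is_fourier_dom hk).2; have Lcf := L2cj L2f.
have Lkf := L2B Lk Lcf.
suff null : ip2 (k - cj f) (k - cj f) = 0.
  apply: (is_fourier_null hk) => //; first exact: L2cj.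
  by rewrite subrr; exact: (ip0l (H := H) (dom0 H)).
have test a b (c : R[i]) : (forall i, a i <= b i) ->
    ip2 k (cj (fun x => c * boxf a b x)) = ip2 (cj f) (cj (fun x => c * boxf a b x)).
  move=> ab; have L12b : L12 (boxf a b : E -> R[i]) by split; [exact: boxf_L1|exact: boxf_L2].
  rewrite (is_fourier_dual hk (is_fourierZ c (is_fourier_F L12b))).
  have LFb := FL2 L12b; rewrite !ip2cjr.
  have -> : cint mu (fun x => cj (F f) x * (c * F (boxf a b) x)) =
      c * (cint mu (fun x => F f x * (F (boxf a b) x)^*))^*.
    rewrite -cintJ; last exact: (L2_cint_able LF (L2J LFb)).
    rewrite -cintZ; last by apply: cint_ableJ; exact: (L2_cint_able LF (L2J LFb)).
    by apply: eq_cint => x; rewrite cJM conjcK /cj mulrCA.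
  rewrite parseval_boxf//.
  have iB := L2_cint_able L2f (boxf_L2 a b).
  rewrite -cintJ// -cintZ; last exact: cint_ableJ.
  congr Re; apply: eq_cint => x; rewrite cJM mulrCA; congr (_ * (_ * _)).
  by apply: complex_ext; rewrite /= ?oppr0.
have key (p : R[i] -> R) (c : R[i]) :
    (forall x a b, Re ((k - cj f) x) * Re (cj (fun x => c * boxf a b x) x) +
      Im ((k - cj f) x) * Im (cj (fun x => c * boxf a b x) x) =
      p ((k - cj f) x) * \1_(ocbox a b) x) ->
    (forall g, L2 g -> rint mu (fun x => p (g x) ^+ 2)) ->
    (forall g, L2 g -> measurable_fun setT (fun x => p (g x))) ->
    {ae mu, forall x, p ((k - cj f) x) = 0}.
  move=> hp ip mp; apply: ae0_of_ocbox; first exact: mp.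
  move=> a b; have mB := measurable_ocbox a b.
  have i0 : rint mu (fun x => p ((k - cj f) x) * \1_(ocbox a b) x).
      apply: (rint_le _ (rintD (rint_indic mB (ocbox_lty a b)) (ip _ Lkf))).
        by apply: measurable_funM; [exact: mp|exact: measurable_indic].
      move=> x; rewrite normrM indicE; case: (_ \in _); last first.
        by rewrite normr0 mulr0 add0r sqr_ge0.
      by rewrite normr1 mulr1; exact: normr_le_1sqr.
  have iB : mu.-integrable (ocbox a b) (EFin \o (fun x => p ((k - cj f) x))).
    have i1 := @integrableS _ _ _ mu setT (ocbox a b) _ measurableT mB (@subsetT _ _) i0.
    apply: eq_integrable i1 => // x xB /=.
    by rewrite indicE xB mulr1.
  split => //.
  have [ab|nab] := pselect (forall i, a i <= b i); last first.
    suff -> : ocbox a b = set0 by rewrite integral_set0.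
    apply/seteqP; split => // x xB; apply: nab => i.
    by have := xB i; rewrite /= in_itv /= => /andP[/ltW]; exact: le_trans.
  have Lb : L2 (cj (fun x => c * boxf a b x)) by apply: L2cj; apply: L2Z; exact: boxf_L2.
  have T : ip2 (k - cj f) (cj (fun x => c * boxf a b x)) = 0.
    have e1 : ip2 (k - cj f) (cj (fun x => c * boxf a b x)) =
        ip2 k (cj (fun x => c * boxf a b x)) + ip2 (- cj f) (cj (fun x => c * boxf a b x)).
      exact: (ipDl (s := H) Lk (domN (s := H) Lcf) Lb).
    have e2 : ip2 (- cj f) (cj (fun x => c * boxf a b x)) =
        - ip2 (cj f) (cj (fun x => c * boxf a b x)) by exact: (ipNl (H := H) Lcf Lb).
    by rewrite e1 e2 test// subrr.
  have e0 : \int[mu]_x (p ((k - cj f) x) * \1_(ocbox a b) x) = 0.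
    by rewrite -T; apply: eq_Rintegral => x _; rewrite -hp.
  have e := EFin_Rintegral i0; rewrite e0 in e; apply: etrans (esym e).
  rewrite [LHS]integral_mkcond; apply: eq_integral => x _.
  by rewrite patchE indicE; case: ifP => _; rewrite ?mulr1 ?mulr0.
have sq g : L2 g -> rint mu (fun x => Re (g x) ^+ 2) /\ rint mu (fun x => Im (g x) ^+ 2).
  move=> Lg; have [[m1 m2] ig] := Lg; split; apply: (rint_le _ ig).
  - exact: measurable_funX.
  - by move=> x; rewrite ger0_norm ?sqr_ge0// sqr_cnorm lerDl sqr_ge0.
  - exact: measurable_funX.
  - by move=> x; rewrite ger0_norm ?sqr_ge0// sqr_cnorm lerDr sqr_ge0.
have aRe : {ae mu, forall x, Re ((k - cj f) x) = 0}.
  apply: (key Re 1) => [x a b|g Lg|g Lg]; last exact: Lg.1.1.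
    by rewrite /cj /boxf !cE /=; ring.
  exact: (sq g Lg).1.
have aIm : {ae mu, forall x, Im ((k - cj f) x) = 0}.
  apply: (key Im (Complex 0 (-1))) => [x a b|g Lg|g Lg]; last exact: Lg.1.2.
    by rewrite /cj /boxf !cE /=; ring.
  exact: (sq g Lg).2.
apply: (ae_ip2_eq Lk Lcf); apply: filterS2 aRe aIm => x r i.
by apply/eqP; rewrite -subr_eq0; apply/eqP; apply: complex_ext.
Qed.

(** Inversion holds on a dense subspace, and the graph is closed. *)
Lemma is_fourier_inv f g : is_fourier f g -> is_fourier (cj g) (cj f).
Proof.
move=> /is_fourierP[Lf Lg [w [Lw wf wg]]].
apply: (is_fourier_closed (u := fun n => cj (F (w n))) (v := fun n => cj (w n))).
- by move=> n; exact: is_fourier_inv_F.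
- exact: L2cj.
- exact: L2cj.
- exact: hcvgJ.
- exact: hcvgJ.
Qed.

(** The contraction property, for the transform and for its inverse. *)
Lemma is_fourier_isometry f g : is_fourier f g -> ip2 g g = ip2 f f.
Proof.
move=> h; apply/le_anti; rewrite (is_fourier_le h) /=.
by have := is_fourier_le (is_fourier_inv h); rewrite !ip2J.
Qed.

Lemma is_fourier_surj g : L2 g -> exists f, is_fourier f g.
Proof.
move=> /L2cj/is_fourier_exists[k /is_fourier_inv h].
by exists (cj k); rewrite -[g]cjK.
Qed.

Lemma is_fourier_dist f g f' g' : is_fourier f g -> is_fourier f' g' ->
  ip2 (g - g') (g - g') = ip2 (f - f') (f - f').
Proof. by move=> h h'; exact: is_fourier_isometry (is_fourierB h h'). Qed.

(** For an integrable [g] the inverse transform is again an integral: the conjugate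
of the Fourier integral of the conjugate. *)
Lemma is_fourier_Finv g : L12 g -> is_fourier (cj (F (cj g))) g.
Proof.
move=> [ig Lg].
have : is_fourier (cj g) (F (cj g)).
  by apply: is_fourier_F; split; [exact: cint_ableJ|exact: L2cj].
by move=> /is_fourier_inv; rewrite cjK.
Qed.

Definition shift x f : E -> R[i] := fun y => f (y + x).
Definition modul x g : E -> R[i] := fun xi => expNi (- dotv x xi) * g xi.

Lemma rint_shift x (u : E -> R) : rint mu u -> rint mu (fun y => u (y + x)).
Proof.
move=> /integrableP[mu_ iu]; apply/integrableP; split.
  exact: measurableT_comp mu_ (meas_addl x).
have m0 : measurable_fun setT (fun y => `|(u y)%:E|)%E by exact: measurableT_comp.
by have := ge0_integral_shift x m0; rewrite /= => ->.
Qed.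

Lemma Rintegral_shift x (u : E -> R) : measurable_fun setT u ->
  \int[mu]_y u (y + x) = \int[mu]_y u y.
Proof.
move=> mu_; congr fine; rewrite [LHS]integralE [RHS]integralE.
have me : measurable_fun setT (EFin \o u) by exact/measurable_EFinP.
congr (_ - _)%E.
- rewrite -[RHS](ge0_integral_shift x (measurable_funepos me) (fun y => funepos_ge0 (EFin \o u) y)).
  by apply: eq_integral => y _; rewrite !funeposE.
- rewrite -[RHS](ge0_integral_shift x (measurable_funeneg me) (fun y => funeneg_ge0 (EFin \o u) y)).
  by apply: eq_integral => y _; rewrite !funenegE.
Qed.

Lemma cmeas_shift x f : cmeas f -> cmeas (shift x f).
Proof.
by move=> [m1 m2]; split; [exact: measurableT_comp m1 (meas_addl x)|
  exact: measurableT_comp m2 (meas_addl x)].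
Qed.

Lemma L2_shift x f : L2 f -> L2 (shift x f).
Proof. by move=> [mf if_]; split; [exact: cmeas_shift|exact: (rint_shift x if_)]. Qed.

Lemma L12_shift x f : L12 f -> L12 (shift x f).
Proof.
by move=> [[i1 i2] Lf]; split; [split; [exact: (rint_shift x i1)|exact: (rint_shift x i2)]|exact: L2_shift].
Qed.

Lemma ip2_shift x f g : L2 f -> L2 g -> ip2 (shift x f) (shift x g) = ip2 f g.
Proof. by move=> Lf Lg; rewrite -[RHS](Rintegral_shift x)//; exact: rint_meas (rint_ip2 Lf Lg). Qed.

Lemma cint_shift x f : cmeas f -> cint mu (fun y => f (y + x)) = cint mu f.
Proof.
by move=> [m1 m2]; apply: complex_ext; rewrite /= ?(Rintegral_shift x m1) ?(Rintegral_shift x m2).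
Qed.

Lemma F_shift x f : cint_able mu f -> F (shift x f) = modul x (F f).
Proof.
move=> if_; apply/funext => xi; rewrite /modul !FE mulrCA; congr (_ * _).
have ic := cint_able_char xi if_.
rewrite -(cint_shift x (cint_able_meas ic)) -cintZ; last first.
  split; [exact: (rint_shift x ic.1)|exact: (rint_shift x ic.2)].
apply: eq_cint => y; rewrite mulrCA -expNiD /shift; congr (_ * expNi _).
by rewrite dotvDl addrC addrK.
Qed.

Lemma cmeas_modul x g : cmeas g -> cmeas (modul x g).
Proof.
move=> mg; apply: cmeasM => //; apply: cmeas_expNi.
by apply: measurableT_comp => //; exact: meas_dotv.
Qed.

Lemma cnorm_modul x g xi : cnorm (modul x g xi) = cnorm (g xi).
Proof. by rewrite cnormM cnorm_expNi mul1r. Qed.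

Lemma L2_modul x g : L2 g -> L2 (modul x g).
Proof.
move=> [mg ig]; split; first exact: cmeas_modul.
by under eq_fun do rewrite cnorm_modul.
Qed.

Lemma ip2_modul x f g : ip2 (modul x f) (modul x g) = ip2 f g.
Proof.
apply: eq_Rintegral => xi _; rewrite !cE /=.
have := cos2Dsin2 (- dotv x xi); set c := cos _; set t := sin _ => e.
transitivity ((c ^+ 2 + t ^+ 2) * (Re (f xi) * Re (g xi) + Im (f xi) * Im (g xi))); last by rewrite e mul1r.
by ring.
Qed.

Lemma modulB x f g : modul x (f - g) = modul x f - modul x g.
Proof. by apply/funext => xi; rewrite /modul !fctE mulrBr. Qed.

Lemma is_fourier_shift x f g : is_fourier f g -> is_fourier (shift x f) (modul x g).
Proof.
move=> /is_fourierP[Lf Lg [w [Lw wf wg]]]; apply/is_fourierP.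
split; [exact: L2_shift|exact: L2_modul|exists (fun n => shift x (w n)); split].
- by move=> n; exact: L12_shift.
- apply: (eq_hcvg wf) => n; rewrite -[RHS]/(ip2 (shift x (w n - f)) (shift x (w n - f))).
  by rewrite ip2_shift//; exact: L2B (Lw n).2 Lf.
- apply: (eq_hcvg wg) => n; rewrite F_shift; last exact: (Lw n).1.
  by rewrite -modulB; exact: (esym (ip2_modul _ _ _)).
Qed.

End fourier_L2.

(** * Translations as dislocations of L^2 *)

Section euclidean.
Context {R : realType} {d : nat}.
Local Notation E := 'rV[R]_d.
Implicit Types x y : E.

Lemma dotv_ge0 x : 0 <= dotv x x.
Proof. by apply: sumr_ge0 => i _; rewrite -expr2 sqr_ge0. Qed.

Lemma dotvZl (a : R) x y : dotv (a *: x) y = a * dotv x y.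
Proof. by rewrite /dotv mulr_sumr; apply: eq_bigr => i _; rewrite mxE mulrA. Qed.

Lemma dotv_eq0 x y : dotv x x = 0 -> dotv x y = 0.
Proof.
move=> /eqP; rewrite psumr_eq0 => [/allP h|i _]; last by rewrite -expr2 sqr_ge0.
apply: big1 => i _; have := h i (mem_index_enum i).
by rewrite /= -expr2 sqrf_eq0 => /eqP ->; rewrite mul0r.
Qed.

Lemma sqr_dotv_le x y : dotv x y ^+ 2 <= dotv x x * dotv y y.
Proof.
have [x0|xn0] := eqVneq (dotv x x) 0; first by rewrite (dotv_eq0 y x0) x0 mul0r expr0n.
have xp : 0 < dotv x x by rewrite lt0r xn0 dotv_ge0.
have := dotv_ge0 (dotv x y *: x - dotv x x *: y).
rewrite !(dotvDl, dotvDr, dotvNl, dotvNr, dotvZl).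
have -> : dotv x (dotv x y *: x) = dotv x y * dotv x x by rewrite dotvC dotvZl.
have -> : dotv y (dotv x y *: x) = dotv x y * dotv x y by rewrite dotvC dotvZl.
have -> : dotv x (dotv x x *: y) = dotv x x * dotv x y by rewrite dotvC dotvZl [dotv y x]dotvC.
have -> : dotv y (dotv x x *: y) = dotv x x * dotv y y by rewrite dotvC dotvZl.
set A := dotv x x; set B := dotv y y; set C := dotv x y => h.
suff : 0 <= A * (A * B - C ^+ 2) by rewrite pmulr_rge0// subr_ge0.
by apply: le_trans h _; rewrite le_eqVlt; apply/orP; left; apply/eqP; ring.
Qed.

Lemma enorm_ge0 x : 0 <= enorm x. Proof. exact: sqrtr_ge0. Qed.

Lemma sqr_enorm x : enorm x ^+ 2 = dotv x x.
Proof. by rewrite sqr_sqrtr// dotv_ge0. Qed.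

Lemma dotv_le x y : `|dotv x y| <= enorm x * enorm y.
Proof.
rewrite /enorm -sqrtrM ?dotv_ge0// -sqrtr_sqr ler_wsqrtr//; exact: sqr_dotv_le.
Qed.

Lemma enormD x y : enorm (x + y) <= enorm x + enorm y.
Proof.
rewrite -(@ler_pXn2r _ 2)// ?nnegrE ?addr_ge0 ?enorm_ge0//.
rewrite sqr_enorm dotvDl !dotvDr [dotv y x]dotvC sqrrD !sqr_enorm.
have := le_trans (ler_norm _) (dotv_le x y); rewrite mulr2n; lra.
Qed.

Lemma enormN x : enorm (- x) = enorm x.
Proof. by rewrite /enorm dotvNl dotvNr opprK. Qed.

Lemma coor_le_enorm x (i : 'I_d) : `|x ord0 i| <= enorm x.
Proof.
rewrite -sqrtr_sqr ler_wsqrtr// /dotv (bigD1 i)//= expr2 lerDl.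
by apply: sumr_ge0 => j _; rewrite -expr2 sqr_ge0.
Qed.

Lemma enorm_le_sum x : enorm x <= \sum_(i < d) `|x ord0 i|.
Proof.
have s0 : 0 <= \sum_(i < d) `|x ord0 i| by apply: sumr_ge0.
rewrite -(@ler_pXn2r _ 2)// ?nnegrE ?enorm_ge0// sqr_enorm expr2 mulr_suml.
apply: ler_sum => i _; rewrite -[x ord0 i * _]ger0_norm -?expr2 ?sqr_ge0//.
rewrite expr2 normrM ler_wpM2l// (bigD1 i)//= lerDl.
by apply: sumr_ge0.
Qed.

End euclidean.

Lemma cvg_sumr {R : realType} {T : Type} (F : set_system T) {FF : Filter F} (I : Type)
    (r : seq I) (h : I -> T -> R) (l : I -> R) :
  (forall i, h i t @[t --> F] --> l i) ->
  \sum_(i <- r) h i t @[t --> F] --> \sum_(i <- r) l i.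
Proof.
move=> hl; elim: r => [|i r IH].
  by rewrite big_nil; under eq_fun do rewrite big_nil; exact: cvg_cst.
by rewrite big_cons; under eq_fun do rewrite big_cons; exact: cvgD.
Qed.

Section translations.
Context {R : realType} {d : nat}.
Local Notation E := 'rV[R]_d.
Local Notation mu := (@lebesgue_rV R d).
Local Notation H := (L2H mu).
Local Notation L2 := (L2 mu).
Local Notation ip2 := (ip2 mu).
Implicit Types (f g h k : E -> R[i]) (x y xi : E).

Lemma modul_comp x y f : modul x (modul y f) = modul (x + y) f.
Proof.
by apply/funext => xi; rewrite /modul mulrA -expNiD dotvDl opprD.
Qed.

Lemma modul0 f : modul 0 f = f.
Proof.
apply/funext => xi; rewrite /modul (_ : dotv 0 xi = 0) ?oppr0 ?expNi0 ?mul1r//.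
by rewrite /dotv big1// => i _; rewrite mxE mul0r.
Qed.

Lemma enorm_unbounded : (0 < d)%N -> forall M : R, exists x, M <= enorm x.
Proof.
move=> d0 M; exists (const_mx `|M|); apply: le_trans (ler_norm M) _.
by have := coor_le_enorm (const_mx `|M|) (Ordinal d0); rewrite mxE normr_id.
Qed.

Lemma enorm_compact (F : set_system nat) : UltraFilter F ->
  forall (y : nat -> E) (M : R), (\forall l \near F, enorm (y l) <= M) ->
  exists y0, enorm (y l - y0) @[l --> F] --> (0 : R).
Proof.
move=> FF y M yM.
have : forall i : 'I_d, exists p : R, y l ord0 i @[l --> F] --> p.
  move=> i; have [||p _ pP] := @compact_ultra_cvg _ F FF R `[- M, M]%classic (fun l => y l ord0 i).
  - exact: segment_compact.
  - apply: filterS yM => l lM; rewrite /= in_itv /= -ler_norml.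
    exact: le_trans (coor_le_enorm _ _) lM.
  - by exists p.
move=> /choice[p pP]; pose y0 : E := \row_i p i; exists y0.
have : \sum_(i < d) `|y l ord0 i - p i| @[l --> F] --> \sum_(i < d) (0 : R).
  apply: (@cvg_sumr R nat F _ _ _ (fun i l => `|y l ord0 i - p i|) (fun=> 0)) => i.
  have h0 : y l ord0 i - p i @[l --> F] --> (0 : R).
    by rewrite -(subrr (p i)); apply: cvgB; [exact: pP|exact: cvg_cst].
  by have := cvg_norm h0; rewrite normr0 => h1; exact: h1.
rewrite big1// => h; apply/cvgr0Pnorm_le => e e0.
move/cvgr0Pnorm_le: h => /(_ _ e0); apply: filterS => l.
rewrite !ger0_norm ?enorm_ge0 ?sumr_ge0//; apply: le_trans.
apply: le_trans (enorm_le_sum _) _; apply: ler_sum => i _.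
by rewrite !mxE.
Qed.

Lemma cvg_dotv0 (x : nat -> E) xi : enorm (x n) @[n --> \oo] --> (0 : R) ->
  dotv (x n) xi @[n --> \oo] --> (0 : R).
Proof.
move=> h; apply: (@cvg_squeeze0 _ _ (fun n => enorm (x n) * enorm xi)).
  by move=> n; rewrite subr0; exact: dotv_le.
by rewrite -[X in _ --> X](mul0r (enorm xi)); exact: cvgMl.
Qed.

Lemma ip2_modulB x f : L2 f -> ip2 (modul x f - f) (modul x f - f) =
  \int[mu]_xi ((2 - 2 * cos (dotv x xi)) * cnorm (f xi) ^+ 2).
Proof.
move=> Lf; apply: eq_Rintegral => xi _; rewrite !fctE /modul !cE /= cosN sinN opprK sqr_cnorm.
have e := cos2Dsin2 (dotv x xi).
transitivity ((cos (dotv x xi) ^+ 2 + sin (dotv x xi) ^+ 2 + 1 - 2 * cos (dotv x xi)) *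
  (Re (f xi) ^+ 2 + Im (f xi) ^+ 2)); first by ring.
by rewrite e; ring.
Qed.

(** Otherwise dominated convergence would be contradicted along a sequence. *)
Lemma modul_continuous f : L2 f -> forall e : R, 0 < e ->
  exists2 delta : R, 0 < delta & forall x, enorm x < delta ->
    ip2 (modul x f - f) (modul x f - f) <= e.
Proof.
move=> Lf e e0; apply: contrapT => no.
have : forall n : nat, exists x, enorm x < n.+1%:R^-1 /\ e < ip2 (modul x f - f) (modul x f - f).
  move=> n; apply: contrapT => nx; apply: no; exists n.+1%:R^-1; first by rewrite invr_gt0.
  by move=> x xn; rewrite leNgt; apply/negP => ex; apply: nx; exists x.
move=> /choice[x xP].
have x0 : enorm (x n) @[n --> \oo] --> (0 : R).
  apply: (@cvg_squeeze0 _ _ (fun n => n.+1%:R^-1)); last exact: cvg_harmonic.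
  by move=> n; rewrite subr0 ger0_norm ?enorm_ge0// ltW//; exact: (xP n).1.
have c0 : \int[mu]_xi ((2 - 2 * cos (dotv (x n) xi)) * cnorm (f xi) ^+ 2) @[n --> \oo]
    --> \int[mu]_xi (cst 0 xi : R).
  apply: (@Rintegral_cvg _ _ _ _ _ _ (fun xi => 4 * cnorm (f xi) ^+ 2)).
  - move=> n; apply: measurable_funM; last exact: meas_sqr_cnorm Lf.1.
    apply: measurable_funB; first exact: measurable_cst.
    apply: measurable_funM; first exact: measurable_cst.
    apply: measurableT_comp; last exact: meas_dotv.
    by apply: continuous_measurable_fun; exact: continuous_cos.
  - exact: measurable_cst.
  - by apply: rintZ; exact: Lf.2.
  - move=> n xi; rewrite normrM [X in _ * X]ger0_norm ?sqr_ge0// ler_wpM2r ?sqr_ge0//.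
    have := cos_geN1 (dotv (x n) xi); have := cos_le1 (dotv (x n) xi) => c1 c2.
    by rewrite ger0_norm; lra.
  - apply: aeW => xi; have h := cvg_comp _ _ (cvg_dotv0 xi x0) (@continuous_cos R 0).
    rewrite cos0 in h; rewrite -[X in _ --> X](mul0r (cnorm (f xi) ^+ 2)); apply: cvgMl.
    have -> : (0 : R) = 2 - 2 * 1 by ring.
    by apply: cvgB; [exact: cvg_cst|apply: cvgMr; exact: h].
rewrite Rintegral_cst// mul0r in c0.
have : e <= 0; last by rewrite leNgt e0.
apply: (cvgr_to_ge c0); apply: nearW => n.
by rewrite -ip2_modulB// ltW//; exact: (xP n).2.
Qed.

Lemma ip2_fourier f g f' g' : is_fourier f g -> is_fourier f' g' -> ip2 g g' = ip2 f f'.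
Proof.
move=> h h'; have [Lf Lg] := is_fourier_dom h; have [Lf' Lg'] := is_fourier_dom h'.
have := is_fourier_isometry (is_fourierD h h').
have e1 : ip2 (g + g') (g + g') = ip2 g g + 2 * ip2 g g' + ip2 g' g'.
  exact: (ip_sqrD (H := H) Lg Lg').
have e2 : ip2 (f + f') (f + f') = ip2 f f + 2 * ip2 f f' + ip2 f' f'.
  exact: (ip_sqrD (H := H) Lf Lf').
by rewrite e1 e2 (is_fourier_isometry h) (is_fourier_isometry h'); lra.
Qed.

(** Some coordinate of [x] exceeds the side [2 N] of the cube. *)
Lemma ip2_shift_cube (N : nat) x f g : (2 * N%:R) *+ d < enorm x ->
  ip2 (shift x (fun y => (\1_(cube N) y)%:C%C * f y)) (fun y => (\1_(cube N) y)%:C%C * g y) = 0.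
Proof.
move=> xN; have [i xi] : exists i : 'I_d, 2 * N%:R < `|x ord0 i|.
  apply: contrapT => no; move: xN; rewrite ltNge => /negP; apply.
  apply: le_trans (enorm_le_sum x) _.
  rewrite -[X in _ *+ X]card_ord -sumr_const; apply: ler_sum => i _.
  by rewrite leNgt; apply/negP => xi; apply: no; exists i.
rewrite -[RHS](@mul0r _ (fine (mu setT))) -Rintegral_cst//.
apply: eq_Rintegral => y _; rewrite /shift !indicE.
have ind0 (z : R[i]) : (false%:R : R)%:C%C * z = 0 by exact: mul0r.
have [/set_mem yx|_] := boolP (y + x \in cube N); last by rewrite ind0 !mul0r addr0.
have [/set_mem y0|_] := boolP (y \in cube N); last by rewrite ind0 !mulr0 addr0.
have := yx i; have := y0 i; rewrite /= mxE !in_itv /= => /andP[a1 a2] /andP[a3 a4].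
exfalso; move: xi; rewrite ltNge => /negP; apply; rewrite ler_norml; lra.
Qed.

(** On the other side of the transform modulations become translations, and the two
functions are nearly supported in a cube. *)
Lemma modul_vanish f g : L2 f -> L2 g -> forall e : R, 0 < e ->
  exists M, forall x, M <= enorm x -> `|ip2 (modul x f) g| <= e.
Proof.
move=> Lf Lg e e0.
have [f' hf] := is_fourier_surj Lf; have [g' hg] := is_fourier_surj Lg.
have Lf' := (is_fourier_dom hf).1; have Lg' := (is_fourier_dom hg).1.
have mQ n : measurable (cube n : set E) by exact: measurable_ocbox.
have [LfN cf] := hcvg_trunc mQ mem_cube Lf'; have [LgN cg] := hcvg_trunc mQ mem_cube Lg'.
set fN := fun n x => _ in LfN cf; set gN := fun n x => _ in LgN cg.
pose c n := Num.sqrt (ip2 (fN n - f') (fN n - f')) * Num.sqrt (ip2 g' g') +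
  Num.sqrt (ip2 (fN n) (fN n)) * Num.sqrt (ip2 (gN n - g') (gN n - g')).
have c0 : c n @[n --> \oo] --> (0 : R).
  have s1 := hcvg_sqrt cf; have s2 := hcvg_sqrt cg.
  have s3 := cvg_comp _ _ (hcvg_ip (H := H) LfN LfN Lf' Lf' cf cf) (@sqrt_continuous R _).
  have : c n @[n --> \oo] --> 0 * Num.sqrt (ip2 g' g') + Num.sqrt (ip2 f' f') * 0.
    by apply: cvgD; [exact: cvgMl|apply: cvgM; [exact: s3|exact: s2]].
  by rewrite mul0r mulr0 addr0.
have /cvgr0Pnorm_le/(_ e e0)[N _ /(_ N (leqnn N)) /= hN] := c0.
exists ((2 * N%:R) *+ d + 1) => x xM; apply: le_trans hN; apply: le_trans (ler_norm _).
rewrite (ip2_fourier (is_fourier_shift x hf) hg).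
have Ls h : L2 h -> L2 (shift x h) by exact: L2_shift.
have LfN' := LfN N; have LgN' := LgN N.
have LA := L2B LfN' Lf'; have LB := L2B LgN' Lg'.
have z : ip2 (shift x (fN N)) (gN N) = 0 by apply: ip2_shift_cube; lra.
have -> : ip2 (shift x f') g' = - ip2 (shift x (fN N - f')) g' - ip2 (shift x (fN N)) (gN N - g').
  have e1 : ip2 (shift x (fN N - f')) g' = ip2 (shift x (fN N)) g' + ip2 (- shift x f') g'.
    exact: (ipDl (s := H) (Ls _ LfN') (domN (s := H) (Ls _ Lf')) Lg').
  have e2 : ip2 (- shift x f') g' = - ip2 (shift x f') g'.
    exact: (ipNl (H := H) (Ls _ Lf') Lg').
  have e3 : ip2 (shift x (fN N)) (gN N - g') =
      ip2 (shift x (fN N)) (gN N) + ip2 (shift x (fN N)) (- g').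
    exact: (ipDr (H := H) LgN' (domN (s := H) Lg') (Ls _ LfN')).
  have e4 : ip2 (shift x (fN N)) (- g') = - ip2 (shift x (fN N)) g'.
    exact: (ipNr (H := H) (Ls _ LfN') Lg').
  by rewrite e1 e2 e3 e4 z; ring.
rewrite -opprD normrN; apply: le_trans (ler_normD _ _) _; apply: lerD.
  apply: le_trans (norm_ip (H := H) (Ls _ LA) Lg') _.
  by rewrite [ip _ _ _](ip2_shift x LA LA).
apply: le_trans (norm_ip (H := H) (Ls _ LfN') LB) _.
by rewrite [X in Num.sqrt X * _](ip2_shift x LfN' LfN').
Qed.

Definition L2_translations (d0 : (0 < d)%N) : dislocations H E :=
  @Dislocations R (E -> R[i]) H E modul enorm
    L2_modul modulB modul_comp modul0
    (fun x f g _ _ => ip2_modul x f g) enorm_ge0 enormD enormN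
    (enorm_unbounded d0) enorm_compact modul_vanish modul_continuous.

End translations.

(** * L^q norms *)

Lemma cvg_powR {R : realType} (a : nat -> R) (l q : R) : 0 < q -> (forall n, 0 <= a n) ->
  a n @[n --> \oo] --> l -> a n `^ q @[n --> \oo] --> l `^ q.
Proof.
move=> q0 a0 al; have l0 : 0 <= l by apply: (cvgr_to_ge al); exact: nearW.
have [l_eq0|l_neq0] := eqVneq l 0.
  rewrite l_eq0 powR0 ?gt_eqF//; rewrite l_eq0 in al.
  apply/cvgr0Pnorm_le => e e0; have e1 : 0 < e `^ q^-1 by rewrite powR_gt0.
  move/cvgr0Pnorm_le: al => /(_ _ e1); apply: filterS => n.
  rewrite !ger0_norm ?powR_ge0// => an.
  have -> : e = (e `^ q^-1) `^ q by rewrite -powRrM mulVf ?gt_eqF// powRr1// ltW.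
  by apply: ge0_ler_powR; rewrite ?nnegrE// ?ltW.
have lp : 0 < l by rewrite lt0r l_neq0.
have h : expR (q * ln (a n)) @[n --> \oo] --> expR (q * ln l).
  have h1 : q * ln (a n) @[n --> \oo] --> q * ln l.
    by apply: cvgMr; exact: cvg_comp al (continuous_ln lp).
  exact: cvg_comp h1 (@continuous_expR R _).
have -> : l `^ q = expR (q * ln l) by rewrite /powR (negbTE l_neq0).
apply: cvg_trans h; apply: near_eq_cvg.
have /cvgr_gt/(_ 0 lp) := al; apply: filterS => n an.
by rewrite /powR gt_eqF.
Qed.

Section ae_subsequence.
Context {d} {T : measurableType d} {R : realType} (m : {measure set T -> \bar R}).
Local Notation L2 := (L2 m).
Local Notation ip2 := (ip2 m).

Lemma hcvg_ae_subsequence (u : nat -> T -> R[i]) f : (forall n, L2 (u n)) -> L2 f ->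
  hcvg (L2H m) u f -> exists p : nat -> nat, {ae m, forall x,
    Re (u (p k) x) @[k --> \oo] --> Re (f x) /\ Im (u (p k) x) @[k --> \oo] --> Im (f x)}.
Proof.
move=> Lu Lf uf.
have /choice[p pP] : forall k : nat, exists n, ip2 (u n - f) (u n - f) <= 4^-1 * 16^-1 ^+ k.
  move=> k; have e0 : 0 < 4^-1 * 16^-1 ^+ k :> R by rewrite mulr_gt0// exprn_gt0.
  by have [N hN] := hcvg_le uf e0; exists N; exact: hN.
exists p.
have [|l ml lP] := @fast_cauchy_ae _ _ _ m (fun k => u (p k)) (fun k => Lu _).
  move=> k; apply: le_trans (ip_triangle (H := L2H m) (Lu _) Lf (Lu _)) _.
  rewrite (ip_distC (H := L2H m) Lf (Lu _)).
  have := pP k; have := pP k.+1; rewrite exprS.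
  have : 0 < 16^-1 ^+ k :> R by rewrite exprn_gt0.
  set a := 16^-1 ^+ k; rewrite /= => *; lra.
have small j : (\int[m]_x (cnorm (f x - l x) ^+ 2)%:E <= (16^-1 ^+ j : R)%:E)%E.
  apply: (@fatou_le _ _ _ m (fun k x => cnorm (f x - u (p (k + j)%N) x) ^+ 2)).
  - by move=> k; apply: meas_sqr_cnorm; exact: (L2B Lf (Lu _)).1.
  - by apply: meas_sqr_cnorm; apply: cmeasD; [exact: Lf.1|exact: cmeasN].
  - by move=> k x; exact: sqr_ge0.
  - apply: filterS lP => x [cr ci].
    under eq_fun do rewrite sqr_cnorm !cE.
    rewrite sqr_cnorm !cE.
    have crs : Re (u (p (k + j)%N) x) @[k --> \oo] --> Re (l x).
      by rewrite (cvg_shiftn j (fun k => Re (u (p k) x))).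
    have cis : Im (u (p (k + j)%N) x) @[k --> \oo] --> Im (l x).
      by rewrite (cvg_shiftn j (fun k => Im (u (p k) x))).
    by rewrite !expr2; apply: cvgD; apply: cvgM; apply: cvgB => //; exact: cvg_cst.
  - move=> k; rewrite (integral_sqr (L2B Lf (Lu _))) lee_fin.
    have := ip_distC (H := L2H m) Lf (Lu (p (k + j)%N)) => /= e; rewrite [leLHS]e.
    apply: le_trans (pP _) _; rewrite exprD mulrA ler_piMl ?exprn_ge0//.
    apply: mulr_ile1; rewrite ?exprn_ge0// ?invf_le1 ?ler1n//.
    by rewrite exprn_ile1// invf_le1// ler1n.
have mfl : cmeas (fun x => f x - l x) by apply: cmeasD; [exact: Lf.1|exact: cmeasN].
have Lfl : L2 (fun x => f x - l x).
  split => //; apply/ge0_rintP; [exact: meas_sqr_cnorm|by move=> x; exact: sqr_ge0|].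
  exact: le_lt_trans (small 0) (ltry _).
have z : ip2 (fun x => f x - l x) (fun x => f x - l x) = 0.
  apply/le_anti; rewrite [X in _ && X](ip_ge0 (L2H m)) andbT.
  have g : (16^-1 : R) ^+ j @[j --> \oo] --> (0 : R).
    by apply: cvg_expr; rewrite ger0_norm// invf_lt1// ltr1n.
  apply: (cvgr_to_ge g); apply: nearW => j.
  by rewrite -lee_fin -integral_sqr.
apply: filterS2 lP (ip2_ae0 Lfl z) => x [cr ci] /eqP; rewrite subr_eq0 => /eqP fx.
by rewrite fx.
Qed.

End ae_subsequence.

Section Lq.
Context {R : realType} {d : nat}.
Local Notation E := 'rV[R]_d.
Local Notation mu := (@lebesgue_rV R d).
Local Notation L2 := (L2 mu).
Implicit Types (f g h : E -> R[i]) (x y : E) (q : R).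

Lemma meas_powR_cnorm q f : cmeas f -> measurable_fun setT (fun x => cnorm (f x) `^ q).
Proof. by move=> mf; apply: measurableT_comp (measurable_powR q) _; exact: meas_cnorm. Qed.

Lemma cLnorm_ge0 q f : (0 <= cLnorm q%:E f)%E.
Proof. by rewrite cLnormE poweR_ge0. Qed.

Lemma cLnorm_pow q f : 0 < q -> (cLnorm q%:E f `^ q = \int[mu]_x (cnorm (f x) `^ q)%:E)%E.
Proof.
move=> q0; rewrite cLnormE -poweRrM mulVf ?gt_eqF// poweRe1//.
by apply: integral_ge0 => x _; rewrite lee_fin powR_ge0.
Qed.

Lemma cLnorm_leP q f (K : R) : 0 < q -> 0 <= K ->
  (\int[mu]_x (cnorm (f x) `^ q)%:E <= (K `^ q)%:E)%E -> (cLnorm q%:E f <= K%:E)%E.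
Proof.
move=> q0 K0 h; rewrite cLnormE.
have -> : K%:E = ((K `^ q)%:E `^ q^-1)%E.
  by rewrite poweR_EFin -powRrM mulfV ?gt_eqF// powRr1.
apply: gt0_ler_poweR => //; rewrite ?invr_ge0 ?ltW// in_itv /= ?leey ?andbT.
  by apply: integral_ge0 => x _; rewrite lee_fin powR_ge0.
by rewrite lee_fin powR_ge0.
Qed.

Lemma le_cLnorm q f g : 0 < q -> cmeas f -> cmeas g ->
  (forall x, cnorm (f x) <= cnorm (g x)) -> (cLnorm q%:E f <= cLnorm q%:E g)%E.
Proof.
move=> q0 mf mg fg; rewrite !cLnormE.
have i0 (h : E -> R[i]) : (0 <= \int[mu]_x (cnorm (h x) `^ q)%:E)%E.
  by apply: integral_ge0 => x _; rewrite lee_fin powR_ge0.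
have qi : 0 <= q^-1 by rewrite invr_ge0 ltW.
apply: (gt0_ler_poweR qi); [by rewrite in_itv /= i0 leey|by rewrite in_itv /= i0 leey|].
apply: ge0_le_integral => //.
- by move=> x _; rewrite lee_fin powR_ge0.
- by apply/measurable_EFinP; exact: meas_powR_cnorm.
- by apply/measurable_EFinP; exact: meas_powR_cnorm.
- by move=> x _; rewrite lee_fin ge0_ler_powR ?nnegrE ?cnorm_ge0// ltW.
Qed.

Lemma ae_cLnorm q f g : cmeas f -> cmeas g ->
  {ae mu, forall x, f x = g x} -> cLnorm q%:E f = cLnorm q%:E g.
Proof.
move=> mf mg fg; rewrite !cLnormE; apply: (congr1 (fun t : \bar R => t `^ q^-1)%E).
apply: ae_eq_integral => //.
- by apply/measurable_EFinP; exact: meas_powR_cnorm.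
- by apply/measurable_EFinP; exact: meas_powR_cnorm.
- by apply: filterS fg => x ->.
Qed.

Lemma cLnormD q f g : 1 <= q -> cmeas f -> cmeas g ->
  (cLnorm q%:E (fun x => f x + g x)%R <= cLnorm q%:E f + cLnorm q%:E g)%E.
Proof.
move=> q1 mf mg; have q0 : 0 < q by exact: lt_le_trans q1.
pose h x : R[i] := (cnorm (f x) + cnorm (g x))%:C%C.
have mh : cmeas h by apply: cmeas_real; apply: measurable_funD; exact: meas_cnorm.
have hE x : cnorm (h x) = cnorm (f x) + cnorm (g x).
  by rewrite cnorm_real ger0_norm// addr_ge0 ?cnorm_ge0.
apply: (@le_trans _ _ (cLnorm q%:E h)).
  apply: le_cLnorm => //; first exact: cmeasD.
  by move=> x; rewrite hE cnormD.
have -> : cLnorm q%:E h = 'N[mu]_q%:E[EFin \o ((cnorm \o f) \+ (cnorm \o g))%R]%E.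
  by congr ('N[_]_ _ [_])%E; apply/funext => x /=; rewrite hE.
by apply: minkowski_EFin => //; exact: meas_cnorm.
Qed.

Lemma cLnormN q f : cLnorm q%:E (fun x => - f x) = cLnorm q%:E f.
Proof. by congr ('N[_]_ _ [_])%E; apply/funext => x /=; rewrite cnormN. Qed.

Lemma cLnorm_shift q x f : cmeas f -> cLnorm q%:E (shift x f) = cLnorm q%:E f.
Proof.
move=> mf; rewrite !cLnormE; apply: (congr1 (fun t : \bar R => t `^ q^-1)%E).
apply: (ge0_integral_shift x (f := fun y => (cnorm (f y) `^ q)%:E)).
  by apply/measurable_EFinP; exact: meas_powR_cnorm.
by move=> y; rewrite lee_fin powR_ge0.
Qed.

(** Fatou, along a subsequence that converges almost everywhere. *)
Lemma hcvg_cLnorm_le q (u : nat -> E -> R[i]) f (K : R) : 0 < q -> 0 <= K ->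
  (forall n, L2 (u n)) -> L2 f -> hcvg (L2H mu) u f ->
  (forall n, (cLnorm q%:E (u n) <= K%:E)%E) -> (cLnorm q%:E f <= K%:E)%E.
Proof.
move=> q0 K0 Lu Lf uf uK; have [p pP] := hcvg_ae_subsequence Lu Lf uf.
apply: cLnorm_leP => //.
apply: (@fatou_le _ _ _ mu (fun k x => cnorm (u (p k) x) `^ q)).
- by move=> k; apply: meas_powR_cnorm; exact: (Lu _).1.
- by apply: meas_powR_cnorm; exact: Lf.1.
- by move=> k x; exact: powR_ge0.
- apply: filterS pP => x [cr ci]; apply: cvg_powR => //; first by move=> n; exact: cnorm_ge0.
  have : Re (u (p k) x) ^+ 2 + Im (u (p k) x) ^+ 2 @[k --> \oo] --> Re (f x) ^+ 2 + Im (f x) ^+ 2.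
    by rewrite !expr2; under eq_fun do rewrite !expr2; apply: cvgD; apply: cvgM.
  move=> h; have := cvg_comp _ _ h (@sqrt_continuous R _).
  rewrite cnormE => h'; apply: (cvg_ext h') => k /=; exact: (esym (cnormE _)).
- move=> k; rewrite -cLnorm_pow// -poweR_EFin; apply: gt0_ler_poweR => //; first exact: ltW.
  + by rewrite in_itv /= cLnorm_ge0 leey.
  + by rewrite in_itv /= lee_fin K0 leey.
Qed.

(** Interpolation between L^2 and L^oo: split off the factor [|f|^(q-2)]. *)
Lemma integral_powR_le q f (K : R) : 2 <= q -> L2 f -> (forall x, cnorm (f x) <= K) ->
  (\int[mu]_x (cnorm (f x) `^ q)%:E <= (K `^ (q - 2) * ip2 mu f f)%:E)%E.
Proof.
move=> q2 Lf fK; have K0 : 0 <= K by exact: le_trans (cnorm_ge0 _) (fK 0).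
rewrite EFinM -(integral_sqr Lf) -ge0_integralZl//; first last.
- by rewrite lee_fin powR_ge0.
- by move=> x _; rewrite lee_fin sqr_ge0.
- by apply/measurable_EFinP; exact: meas_sqr_cnorm Lf.1.
apply: ge0_le_integral => //.
- by move=> x _; rewrite lee_fin powR_ge0.
- by apply/measurable_EFinP; apply: meas_powR_cnorm; exact: Lf.1.
- apply/measurable_EFinP; apply: measurable_funM; first exact: measurable_cst.
  exact: meas_sqr_cnorm Lf.1.
- move=> x _; rewrite -EFinM lee_fin.
  have -> : q = (q - 2) + 2 by rewrite subrK.
  have [->|c0] := eqVneq (cnorm (f x)) 0.
    rewrite powR0; last by rewrite subrK gt_eqF// (lt_le_trans _ q2).
    by rewrite expr0n /= mulr0.
  rewrite powRD ?c0 ?implybT// powR2 ?cnorm_ge0// addrK ler_wpM2r ?sqr_ge0//.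
  by apply: ge0_ler_powR; rewrite ?nnegrE ?cnorm_ge0// subr_ge0.
Qed.

(** Meaningful on [Lq] only, since [fine] sends an infinite norm to zero. *)
Definition nq q f : R := fine (cLnorm q%:E f).

Definition Lq q f := cmeas f /\ (cLnorm q%:E f < +oo)%E.

Lemma nqE q f : Lq q f -> (nq q f)%:E = cLnorm q%:E f.
Proof. by move=> [_ fq]; rewrite fineK// ge0_fin_numE ?cLnorm_ge0. Qed.

Lemma nq_ge0 q f : 0 <= nq q f.
Proof. by apply: fine_ge0; exact: cLnorm_ge0. Qed.

Lemma LqD q f g : 1 <= q -> Lq q f -> Lq q g -> Lq q (fun x => f x + g x).
Proof.
move=> q1 [mf fq] [mg gq]; split; first exact: cmeasD.
by apply: le_lt_trans (cLnormD q1 mf mg) _; rewrite lte_add_pinfty.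
Qed.

Lemma LqN q f : Lq q f -> Lq q (fun x => - f x).
Proof. by move=> [mf fq]; split; [exact: cmeasN|rewrite cLnormN]. Qed.

Lemma LqB q f g : 1 <= q -> Lq q f -> Lq q g -> Lq q (fun x => f x - g x).
Proof. by move=> q1 Lf /LqN; exact: LqD. Qed.

Lemma nqD q f g : 1 <= q -> Lq q f -> Lq q g -> nq q (fun x => f x + g x) <= nq q f + nq q g.
Proof.
move=> q1 Lf Lg; rewrite -lee_fin EFinD !nqE//; last exact: LqD.
by apply: cLnormD => //; [exact: Lf.1|exact: Lg.1].
Qed.

Lemma nqN q f : nq q (fun x => - f x) = nq q f.
Proof. by rewrite /nq cLnormN. Qed.

Lemma nq_dist q f g : 1 <= q -> Lq q f -> Lq q g ->
  `|nq q f - nq q g| <= nq q (fun x => f x - g x).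
Proof.
move=> q1 Lf Lg.
have e1 : f = fun x => (f x - g x) + g x by apply/funext => x; rewrite subrK.
have e2 : g = fun x => - (f x - g x) + f x by apply/funext => x; rewrite opprB subrK.
have h1 := nqD q1 (LqB q1 Lf Lg) Lg; have h2 := nqD q1 (LqN (LqB q1 Lf Lg)) Lf.
rewrite -e1 in h1; rewrite -e2 nqN in h2.
rewrite ler_norml; lra.
Qed.

Lemma nq_pow q f : 0 < q -> Lq q f ->
  ((nq q f `^ q)%:E = \int[mu]_x (cnorm (f x) `^ q)%:E)%E.
Proof. by move=> q0 Lf; rewrite -poweR_EFin nqE// cLnorm_pow. Qed.

Lemma nq_shift q x f : cmeas f -> nq q (shift x f) = nq q f.
Proof. by move=> mf; rewrite /nq cLnorm_shift. Qed.

Lemma Lq_le q f g : 0 < q -> cmeas f -> Lq q g -> (forall x, cnorm (f x) <= cnorm (g x)) ->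
  Lq q f /\ nq q f <= nq q g.
Proof.
move=> q0 mf [mg gq] fg; have h := le_cLnorm q0 mf mg fg.
have Lf : Lq q f by split => //; exact: le_lt_trans h gq.
by split => //; rewrite -lee_fin !nqE.
Qed.

Lemma nq_le q f (K : R) : cmeas f -> (cLnorm q%:E f <= K%:E)%E -> Lq q f /\ nq q f <= K.
Proof.
move=> mf fK; have Lf : Lq q f by split => //; exact: le_lt_trans fK (ltry _).
by split => //; rewrite -lee_fin nqE.
Qed.

End Lq.

(** * The anisotropic weight *)

Lemma sum_sig1 {R : realType} {n : nat} (dd : 'I_n -> nat) (F : 'I_n -> R) :
  \sum_(i < \sum_(j < n) dd j) F (tagnat.sig1 i) = \sum_(j < n) F j *+ dd j.
Proof.
rewrite (reindex _ tagnat.rank_bij_on) /=.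
rewrite (eq_bigr (fun p : {j & 'I_(dd j)} => F (tag p))) => [|p _]; last first.
  by rewrite /tagnat.sig1 tagnat.rankK.
rewrite -(sig_big_dep xpredT (fun _ => xpredT) (fun j _ => F j)) /=.
by apply: eq_bigr => j _; rewrite sumr_const card_ord.
Qed.

Section weight.
Context {R : realType} {n : nat} (dd : 'I_n -> nat) (s : 'I_n -> R).
Local Notation d := (\sum_(j < n) dd j)%N.
Local Notation E := 'rV[R]_(\sum_(j < n) dd j).
Local Notation mu := (@lebesgue_rV R d).
Local Notation bn := (@block_norm R n dd).
Local Notation L2 := (L2 mu).
Local Notation ip2 := (ip2 mu).
Implicit Types (f g : E -> R[i]) (xi : E).

(** The sum of the squared symbols of the H^s norm. *)
Definition wt xi : R := 1 + \sum_(j < n) (bn j xi `^ s j) ^+ 2.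
Definition W xi : R := Num.sqrt (wt xi).

Lemma meas_block j : measurable_fun setT (bn j).
Proof.
have mS : measurable_fun setT (fun xi : E => \sum_(i < d | tagnat.sig1 i == j) xi ord0 i ^+ 2).
  apply: meas_sum => i; apply: measurable_funX; exact: meas_coor.
apply: measurableT_comp mS.
by apply: continuous_measurable_fun; exact: sqrt_continuous.
Qed.

Lemma meas_block_powR j : measurable_fun setT (fun xi => bn j xi `^ s j).
Proof. by apply: measurableT_comp (measurable_powR (s j)) _; exact: meas_block. Qed.

Lemma meas_wt : measurable_fun setT wt.
Proof.
apply: measurable_funD; first exact: measurable_cst.
by apply: meas_sum => j; apply: measurable_funX; exact: meas_block_powR.
Qed.

Lemma meas_W : measurable_fun setT W.
Proof.
apply: measurableT_comp meas_wt.
by apply: continuous_measurable_fun; exact: sqrt_continuous.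
Qed.

Lemma wt_ge1 xi : 1 <= wt xi.
Proof. by rewrite lerDl sumr_ge0// => j _; exact: sqr_ge0. Qed.

Lemma sqr_W xi : W xi ^+ 2 = wt xi.
Proof. by rewrite sqr_sqrtr// (le_trans _ (wt_ge1 xi)). Qed.

Lemma W_ge1 xi : 1 <= W xi.
Proof. by rewrite -sqrtr1 ler_wsqrtr// wt_ge1. Qed.

Lemma W_gt0 xi : 0 < W xi. Proof. exact: lt_le_trans (W_ge1 xi). Qed.

Lemma meas_Winv : measurable_fun setT (fun xi => (W xi)^-1).
Proof.
have -> : (fun xi => (W xi)^-1) = fun xi => W xi `^ (-1).
  by apply/funext => xi; rewrite powR_inv1// ltW// W_gt0.
by apply: measurableT_comp (measurable_powR (-1)) meas_W.
Qed.

Lemma Winv_le1 xi : `|(W xi)^-1| <= 1.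
Proof. by rewrite ger0_norm ?invr_ge0 ?(ltW (W_gt0 _))// invf_le1 ?W_gt0// W_ge1. Qed.

Lemma coor_le_block xi (i : 'I_d) : `|xi ord0 i| <= bn (tagnat.sig1 i) xi.
Proof.
rewrite -sqrtr_sqr ler_wsqrtr// (bigD1 i)//= lerDl.
by apply: sumr_ge0 => k _; exact: sqr_ge0.
Qed.

Definition rmul (a : E -> R) f : E -> R[i] := fun xi => (a xi)%:C%C * f xi.

Lemma L2_rmul (a : E -> R) f (K : R) : measurable_fun setT a -> (forall xi, `|a xi| <= K) ->
  L2 f -> L2 (rmul a f).
Proof.
move=> ma aK Lf; apply: (@L2M _ _ _ mu f _ K) => //; first exact: cmeas_real.
by move=> xi; rewrite cnorm_real.
Qed.

(** Functions of H^s are parametrised by their weighted spectra [f = W * u^], which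
run through all of L^2 and carry the norm; [unweight f] is then [u^]. *)
Definition unweight f := rmul (fun xi => (W xi)^-1) f.

Lemma L2_unweight f : L2 f -> L2 (unweight f).
Proof. by move=> Lf; exact: L2_rmul meas_Winv Winv_le1 Lf. Qed.

Definition low (k : nat) : set E := [set xi | wt xi < 2 ^+ k].

Lemma measurable_low k : measurable (low k).
Proof.
rewrite -[low k]setTI; have -> : low k = wt @^-1` `]-oo, 2 ^+ k[%classic.
  by apply/seteqP; split => xi; rewrite /low /= in_itv.
by apply: meas_wt => //; exact: measurable_itv.
Qed.

Lemma low_near xi : \forall k \near \oo, low k xi.
Proof.
have [N hN] : exists N : nat, wt xi < 2 ^+ N.
  exists (Num.truncn (wt xi)).+1; apply: lt_trans (truncnS_gt (wt xi)) _.
  by rewrite -natrX ltr_nat; exact: ltn_expl.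
exists N => // k /= Nk; apply: lt_le_trans hN _.
by rewrite ler_eXn2l// ltr1n.
Qed.

Hypothesis s0 : forall j, 0 < s j.

(** The growth exponent of the measure of [low k]; it equals [d / (2 s)]. *)
Definition theta : R := \sum_(i < d) (2 * s (tagnat.sig1 i))^-1.

(** Each coordinate is bounded through the symbol of its own block. *)
Lemma low_sub_box k : low k `<=`
  ocbox (fun i => - (2 `^ (k%:R * (2 * s (tagnat.sig1 i))^-1)))
        (fun i => 2 `^ (k%:R * (2 * s (tagnat.sig1 i))^-1)).
Proof.
move=> xi /= lk i; rewrite /= in_itv /=; set si := s (tagnat.sig1 i).
have si0 : 0 < si by exact: s0.
have h1 : (bn (tagnat.sig1 i) xi `^ si) ^+ 2 < 2 ^+ k.
  apply: le_lt_trans lk; rewrite /wt (bigD1 (tagnat.sig1 i))//= -/si.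
  have : 0 <= \sum_(j < n | j != tagnat.sig1 i) (bn j xi `^ s j) ^+ 2.
    by apply: sumr_ge0 => j _; exact: sqr_ge0.
  by rewrite -/si; lra.
have b0 : 0 <= bn (tagnat.sig1 i) xi by exact: sqrtr_ge0.
have h2 : bn (tagnat.sig1 i) xi < 2 `^ (k%:R * (2 * si)^-1).
  rewrite ltNge; apply/negP => h; move: h1; rewrite ltNge => /negP; apply.
  rewrite -powR2 ?powR_ge0// -powRrM.
  have -> : 2 ^+ k = (2 `^ (k%:R * (2 * si)^-1)) `^ (si * 2) :> R.
    rewrite -powRrM -powR_mulrn//; congr (_ `^ _).
    by field; rewrite gt_eqF.
  apply: ge0_ler_powR => //; rewrite ?nnegrE ?powR_ge0// mulr_ge0// ltW//.
have := le_lt_trans (coor_le_block xi i) h2; rewrite ltr_norml => /andP[-> /ltW ->].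
by [].
Qed.

Lemma mu_low_le k : (mu (low k) <= (2 ^+ d * 2 `^ (k%:R * theta))%:E)%E.
Proof.
apply: le_trans (le_measure mu _ _ (@low_sub_box k)) _.
- by rewrite inE; exact: measurable_low.
- by rewrite inE; exact: measurable_ocbox.
rewrite [leLHS](lebesgue_rV_ocbox _ _) lee_fin le_eqVlt; apply/orP; left; apply/eqP.
rewrite (eq_bigr (fun i : 'I_d => 2 * 2 `^ (k%:R * (2 * s (tagnat.sig1 i))^-1))) => [|i _].
  rewrite big_split /= prodr_const card_ord; congr (_ * _).
  rewrite /theta mulr_sumr.
  elim/big_rec2: _ => [|i x y _ ->]; first by rewrite powRr0.
  by rewrite powRD// pnatr_eq0 implybT.
have := powR_ge0 (2 : R) (k%:R * (2 * s (tagnat.sig1 i))^-1) => p0.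
by rewrite opprK max_l ?addr_ge0//; ring.
Qed.

Lemma low_lty k : (mu (low k) < +oo)%E.
Proof. by apply: le_lt_trans (mu_low_le k) _; exact: ltry. Qed.

Lemma thetaE (sb : R) : 0 < sb -> d%:R / sb = \sum_(j < n) (dd j)%:R / s j ->
  theta = d%:R / (2 * sb).
Proof.
move=> sb0 h; rewrite /theta (sum_sig1 dd (fun j => (2 * s j)^-1)).
transitivity (2^-1 * (d%:R / sb)); last by field; rewrite gt_eqF.
rewrite h mulr_sumr; apply: eq_bigr => j _.
by rewrite -mulr_natr; field; rewrite gt_eqF.
Qed.

End weight.

(** * Littlewood-Paley decomposition and the Sobolev embedding *)

Section inverse_transform.
Context {R : realType} {d : nat}.
Local Notation E := 'rV[R]_d.
Local Notation mu := (@lebesgue_rV R d).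
Local Notation F := (@fourier_integral R d).
Local Notation cd := (@cd R d).
Local Notation L2 := (L2 mu).
Local Notation ip2 := (ip2 mu).
Implicit Types (f g : E -> R[i]) (x xi : E).

Definition Finv g : E -> R[i] := cj (F (cj g)).

Lemma FinvB f g : cint_able mu f -> cint_able mu g -> Finv (f - g) = Finv f - Finv g.
Proof. by move=> if_ ig; rewrite /Finv cjB FB ?cjB//; exact: cint_ableJ. Qed.

Lemma ip2_le_pointwise f g (c : R) : L2 f -> L2 g ->
  (forall x, cnorm (g x) ^+ 2 <= c * cnorm (f x) ^+ 2) -> ip2 g g <= c * ip2 f f.
Proof.
move=> Lf Lg h; rewrite !ip2_self -RintegralZl//; last exact: Lf.2.
apply: le_Rintegral => //; first exact: Lg.2.
exact: (rintZ c Lf.2).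
Qed.

(** Bernstein: Cauchy-Schwarz over the support of the spectrum. *)
Lemma Finv_sup (A : set E) g x : measurable A -> (mu A < +oo)%E -> L12 g ->
  (forall xi, ~ A xi -> g xi = 0) ->
  cnorm (Finv g x) <= cd * (Num.sqrt (fine (mu A)) * Num.sqrt (ip2 g g)).
Proof.
move=> mA Af [ig Lg] gA; rewrite cnormJ.
apply: le_trans (F_bound x (cint_ableJ ig)) _; rewrite ler_pM2l ?cd_gt0//.
pose a xi : R[i] := (\1_A xi)%:C%C; pose b xi : R[i] := (cnorm (g xi))%:C%C.
have La : L2 a.
  apply: (L2_le _ (rint_indic mA Af)); first by apply: cmeas_real; exact: measurable_indic.
  move=> xi; rewrite cnorm_real indicE.
  by case: (_ \in _); rewrite ?normr1 ?expr1n// normr0 expr0n.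
have Lb : L2 b.
  apply: (L2_le _ Lg.2); first by apply: cmeas_real; exact: meas_cnorm Lg.1.
  by move=> xi; rewrite cnorm_real ger0_norm ?cnorm_ge0.
have -> : \int[mu]_y cnorm ((g y)^*) = ip2 a b.
  apply: eq_Rintegral => xi _; rewrite cnormJ /= mul0r addr0 indicE.
  have [_|/negP nA] := boolP (xi \in A); first by rewrite mul1r.
  by rewrite gA ?cnorm0 ?mul0r// => Axi; apply: nA; exact/mem_set.
apply: le_trans (ler_norm _) _; apply: le_trans (norm_ip (H := L2H mu) La Lb) _.
rewrite le_eqVlt; apply/orP; left; apply/eqP; congr (Num.sqrt _ * Num.sqrt _).
  rewrite [LHS]ip2_self -(setIT A) -integral_indic//.
  congr fine; apply: eq_integral => xi _; rewrite cnorm_real indicE.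
  by case: (_ \in _); rewrite ?normr1 ?expr1n// normr0 expr0n.
rewrite [LHS]ip2_self [RHS]ip2_self; apply: eq_Rintegral => xi _.
by rewrite cnorm_real ger0_norm ?cnorm_ge0.
Qed.

End inverse_transform.

Section sobolev.
Context {R : realType} {n : nat} (dd : 'I_n -> nat) (s : 'I_n -> R).
Local Notation d := (\sum_(j < n) dd j)%N.
Local Notation E := 'rV[R]_(\sum_(j < n) dd j).
Local Notation mu := (@lebesgue_rV R d).
Local Notation cd := (@cd R d).
Local Notation L2 := (L2 mu).
Local Notation ip2 := (ip2 mu).
Local Notation low := (@low R n dd s).
Local Notation W := (@W R n dd s).
Local Notation wt := (@wt R n dd s).
Local Notation unweight := (@unweight R n dd s).
Local Notation theta := (@theta R n dd s).
Implicit Types (f g u : E -> R[i]) (x xi : E).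
Hypothesis s0 : forall j, 0 < s j.

Definition lowf (k : nat) f : E -> R[i] := rmul \1_(low k) (unweight f).
Definition plow (k : nat) f : E -> R[i] := Finv (lowf k f).

Lemma L12_lowf k f : L2 f -> L12 (lowf k f).
Proof.
move=> Lf; apply: L12_trunc; [exact: measurable_low|exact: low_lty|exact: L2_unweight].
Qed.

Lemma is_fourier_plow k f : L2 f -> is_fourier (plow k f) (lowf k f).
Proof. by move=> /(L12_lowf k); exact: is_fourier_Finv. Qed.

Lemma L2_plow k f : L2 f -> L2 (plow k f).
Proof. by move=> /(is_fourier_plow k)/is_fourier_dom[]. Qed.

Lemma hcvg_plow f u : L2 f -> is_fourier u (unweight f) -> hcvg (L2H mu) (plow^~ f) u.
Proof.
move=> Lf fu; have Lu := (is_fourier_dom fu).1.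
have [_ h] := hcvg_trunc (@measurable_low R n dd s) (@low_near R n dd s) (L2_unweight s Lf).
apply: (eq_hcvg h) => k.
exact: (is_fourier_dist (is_fourier_plow k Lf) fu).
Qed.

Lemma wt_unweight_le (f : E -> R[i]) k xi : ~ low k xi ->
  cnorm (unweight f xi) ^+ 2 <= 2^-1 ^+ k * cnorm (f xi) ^+ 2.
Proof.
move=> /negP; rewrite -leNgt => wk.
rewrite cnormM exprMn ler_wpM2r ?sqr_ge0// cnorm_real real_normK ?num_real//.
rewrite !exprVn sqr_W lef_pV2// posrE ?exprn_gt0//.
exact: lt_le_trans ltr01 (wt_ge1 s xi).
Qed.

(** The localisation of a weighted spectrum to [2^k <= wt < 2^(k+1)], with [W]
divided out again, as it is in [lowf]. *)
Definition shellf k f := lowf k.+1 f - lowf k f.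

Lemma low_subS k xi : low k xi -> low k.+1 xi.
Proof. by move=> h; apply: lt_le_trans h _; rewrite ler_eXn2l ?ltr1n. Qed.

Lemma shellf_le k f xi : cnorm (shellf k f xi) ^+ 2 <= 2^-1 ^+ k * cnorm (f xi) ^+ 2.
Proof.
have p0 : 0 <= 2^-1 ^+ k * cnorm (f xi) ^+ 2 by rewrite mulr_ge0 ?sqr_ge0 ?exprn_ge0.
rewrite /shellf /lowf /rmul !fctE !indicE.
have [h|/negP h] := boolP (xi \in low k).
  rewrite (mem_set (low_subS (set_mem h))) subrr cnorm0 expr0n //.
have nh : ~ low k xi by move=> l; apply: h; exact/mem_set.
have z : (false%:R : R)%:C%C * unweight f xi = 0 by exact: mul0r.
rewrite z subr0; case: (_ \in _); last by rewrite z cnorm0 expr0n.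
by rewrite mul1r; exact: wt_unweight_le.
Qed.

Lemma shellf_out k f xi : ~ low k.+1 xi -> shellf k f xi = 0.
Proof.
move=> nl; rewrite /shellf /lowf /rmul !fctE !indicE (memNset nl) memNset.
  by rewrite subrr.
by move=> /low_subS.
Qed.

Lemma L12_shellf k f : L2 f -> L12 (shellf k f).
Proof.
move=> Lf; have [i1 l1] := L12_lowf k.+1 Lf; have [i2 l2] := L12_lowf k Lf.
by split; [exact: cint_ableB|exact: L2B].
Qed.

Lemma Finv_shellf k f : L2 f -> Finv (shellf k f) = plow k.+1 f - plow k f.
Proof. by move=> Lf; rewrite FinvB//; [exact: (L12_lowf _ Lf).1..]. Qed.

Lemma ip2_shellf k f : L2 f -> ip2 (shellf k f) (shellf k f) <= 2^-1 ^+ k * ip2 f f.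
Proof.
move=> Lf; apply: ip2_le_pointwise => //; first exact: (L12_shellf k Lf).2.
exact: shellf_le.
Qed.

Variable q : R.
Hypothesis q2 : 2 < q.

(** The exponent of decay of the shells in L^q: the weight gains [1/2], and
Bernstein costs [theta * (1/2 - 1/q)].  It is positive exactly when [q] is
subcritical, [1/q > 1/2 - s/d]. *)
Definition gam : R := 2^-1 - theta * (2^-1 - q^-1).
Definition rho : R := 2 `^ (- gam).
Definition bernstein_cst : R := cd * Num.sqrt (2 ^+ d * 2 `^ theta).
Definition sobolev_cst : R := bernstein_cst `^ ((q - 2) / q).

Lemma bernstein_cst_gt0 : 0 < bernstein_cst.
Proof. by rewrite mulr_gt0 ?cd_gt0// sqrtr_gt0 mulr_gt0 ?powR_gt0 ?exprn_gt0. Qed.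

Lemma shell_sup k f x (M : R) : 0 < M -> L2 f -> ip2 f f <= M ^+ 2 ->
  cnorm (Finv (shellf k f) x) <= bernstein_cst * M * 2 `^ (k%:R * ((theta - 1) / 2)).
Proof.
move=> M0 Lf fM.
apply: le_trans (Finv_sup x (@measurable_low R n dd s k.+1) (@low_lty R n dd s s0 k.+1) (L12_shellf k Lf) _) _.
  by move=> xi; exact: shellf_out.
rewrite /bernstein_cst -!mulrA ler_pM2l ?cd_gt0// -sqrtrM ?fine_ge0//.
have p0 (a : R) : 0 < 2 `^ a by rewrite powR_gt0.
rewrite -(@ler_pXn2r _ 2)// ?nnegrE ?sqrtr_ge0 ?mulr_ge0 ?sqrtr_ge0 ?(ltW M0) ?(ltW (p0 _))//.
have i0 : 0 <= ip2 (shellf k f) (shellf k f) by exact: (ip_ge0 (L2H mu)).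
rewrite sqr_sqrtr; last by rewrite mulr_ge0// fine_ge0.
rewrite !exprMn sqr_sqrtr ?mulr_ge0 ?exprn_ge0 ?(ltW (p0 _))//.
have a1 : fine (mu (low k.+1)) <= 2 ^+ d * 2 `^ (k.+1%:R * theta).
  have := @mu_low_le R n dd s s0 k.+1; rewrite -[X in (X <= _)%E]fineK ?lee_fin//.
  by rewrite ge0_fin_numE// low_lty.
have a2 : ip2 (shellf k f) (shellf k f) <= 2^-1 ^+ k * M ^+ 2.
  by apply: le_trans (ip2_shellf k Lf) _; rewrite ler_wpM2l ?exprn_ge0.
apply: le_trans (ler_pM _ i0 a1 a2) _; first exact: fine_ge0.
rewrite le_eqVlt; apply/orP; left; apply/eqP.
have two : (2 : R) != 0 by [].
have -> : (2^-1 : R) ^+ k = 2 `^ (- k%:R) by rewrite powR_invn// exprVn.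
have -> : (2 `^ (k%:R * ((theta - 1) / 2))) ^+ 2 = 2 `^ (k%:R * ((theta - 1) / 2) * 2).
  by rewrite -powR2 ?(ltW (p0 _))// -powRrM.
have -> : 2 `^ (k.+1%:R * theta) = 2 `^ theta * 2 `^ (k%:R * theta).
  by rewrite -powRD ?two ?implybT//; congr (_ `^ _); rewrite -natr1; ring.
have -> : 2 `^ (k%:R * ((theta - 1) / 2) * 2) = 2 `^ (k%:R * theta) * 2 `^ (- k%:R).
  by rewrite -powRD ?two ?implybT//; congr (_ `^ _); field.
ring.
Qed.

(** Interpolate between the sup norm and the L^2 norm of the shell; all powers of 2
collect into [rho ^+ k]. *)
Lemma shell_cLnorm k f (M : R) : 0 < M -> L2 f -> ip2 f f <= M ^+ 2 ->
  (cLnorm q%:E (plow k.+1 f - plow k f)%R <= (sobolev_cst * M * rho ^+ k)%:E)%E.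
Proof.
move=> M0 Lf fM; have q0 : 0 < q by exact: lt_trans q2.
have p0 (a : R) : 0 < 2 `^ a by rewrite powR_gt0.
have c1 := bernstein_cst_gt0.
rewrite -Finv_shellf//; have L12s := L12_shellf k Lf.
have hs := is_fourier_Finv L12s; have Ls := (is_fourier_dom hs).1.
apply: cLnorm_leP => //.
  by rewrite !mulr_ge0 ?powR_ge0 ?(ltW M0)// exprn_ge0// powR_ge0.
apply: le_trans (integral_powR_le (ltW q2) Ls (fun x => shell_sup k x M0 Lf fM)) _.
rewrite lee_fin -(is_fourier_isometry hs).
have a2 : ip2 (shellf k f) (shellf k f) <= 2^-1 ^+ k * M ^+ 2.
  by apply: le_trans (ip2_shellf k Lf) _; rewrite ler_wpM2l ?exprn_ge0.
apply: le_trans (ler_wpM2l (powR_ge0 _ _) a2) _.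
rewrite le_eqVlt; apply/orP; left; apply/eqP.
have two : (2 : R) != 0 by [].
have -> : (2^-1 : R) ^+ k = 2 `^ (- k%:R) by rewrite powR_invn// exprVn.
rewrite -(powR2 (ltW M0)) /rho -powR_mulrn ?powR_ge0// -powRrM.
rewrite (@powRM _ (bernstein_cst * M)) ?(@powRM _ bernstein_cst M) ?mulr_ge0 ?(ltW c1) ?(ltW M0) ?powR_ge0//.
rewrite (@powRM _ (sobolev_cst * M)) ?(@powRM _ sobolev_cst M) ?mulr_ge0 ?(ltW M0) ?powR_ge0//.
rewrite /sobolev_cst -!powRrM divfK ?gt_eqF//.
have -> : M `^ q = M `^ (q - 2) * M `^ 2 by rewrite -powRD ?gt_eqF ?implybT// subrK.
have -> : 2 `^ (- gam * k%:R * q) = 2 `^ (k%:R * ((theta - 1) / 2) * (q - 2)) * 2 `^ (- k%:R).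
  rewrite -powRD ?two ?implybT//; congr (_ `^ _); rewrite /gam; field.
  by rewrite gt_eqF.
ring.
Qed.

Hypothesis gam0 : 0 < gam.

Lemma rho_gt0 : 0 < rho. Proof. by rewrite powR_gt0. Qed.

Lemma rho_lt1 : rho < 1.
Proof.
rewrite /rho powRN invf_lt1 ?powR_gt0//.
have h : (1 : R) `^ gam < 2 `^ gam by apply: gt0_ltr_powR; rewrite ?nnegrE// ltr1n.
by rewrite powR1 in h.
Qed.

Lemma plow_tail N m f (M : R) : 0 < M -> L2 f -> ip2 f f <= M ^+ 2 ->
  (cLnorm q%:E (plow (N + m) f - plow N f)%R <=
   (sobolev_cst * M * (rho ^+ N * (1 - rho ^+ m) / (1 - rho)))%:E)%E.
Proof.
move=> M0 Lf fM; have q1 : 1 <= q by apply: ltW; apply: lt_trans q2; rewrite ltr1n.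
have r1 := rho_lt1; have r0 := rho_gt0; have r1' : 1 - rho != 0 by rewrite subr_eq0 gt_eqF.
elim: m => [|m IH].
  rewrite addn0 subrr expr0 subrr mulr0 mul0r mulr0.
  rewrite cLnormE (_ : (\int[mu]_x _)%E = 0%E) ?poweR0r ?invr_neq0 ?gt_eqF ?(lt_le_trans _ q1)//.
  apply: etrans (@integral0 _ _ _ mu setT); apply: eq_integral => x _.
  by rewrite cnorm0 powR0// gt_eqF// (lt_le_trans _ q1).
have mp k : cmeas (plow k f) by exact: (L2_plow k Lf).1.
have -> : plow (N + m.+1) f - plow N f =
    (plow (N + m).+1 f - plow (N + m) f) + (plow (N + m) f - plow N f).
  by rewrite addnS addrA subrK.
apply: le_trans (@cLnormD _ _ q (plow (N + m).+1 f - plow (N + m) f)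
  (plow (N + m) f - plow N f) q1 _ _) _.
- exact: cmeasD (mp _) (cmeasN (mp _)).
- exact: cmeasD (mp _) (cmeasN (mp _)).
apply: le_trans (leeD (shell_cLnorm _ M0 Lf fM) IH) _.
rewrite -EFinD lee_fin -mulrDr le_eqVlt; apply/orP; left; apply/eqP.
by congr (_ * _); rewrite exprD exprS; field.
Qed.

Lemma sobolev_cst_ge0 : 0 <= sobolev_cst. Proof. exact: powR_ge0. Qed.

(** The tail is the limit in L^2 of finite sums of shells, whose L^q norms are
bounded by a geometric series. *)
Lemma high_cLnorm N f u (M : R) : 0 < M -> L2 f -> ip2 f f <= M ^+ 2 ->
  is_fourier u (unweight f) ->
  (cLnorm q%:E (u - plow N f)%R <= (sobolev_cst * M / (1 - rho) * rho ^+ N)%:E)%E.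
Proof.
move=> M0 Lf fM fu; have Lu := (is_fourier_dom fu).1.
have r1 := rho_lt1; have r0 := rho_gt0; have q0 : 0 < q by exact: lt_trans q2.
have K0 : 0 <= sobolev_cst * M / (1 - rho) * rho ^+ N.
  by rewrite mulr_ge0 ?exprn_ge0 ?divr_ge0 ?mulr_ge0 ?sobolev_cst_ge0// ?subr_ge0 ltW.
have Lp k := L2_plow k Lf.
apply: (hcvg_cLnorm_le (u := fun m => plow (N + m) f - plow N f)) => //.
- by move=> m; exact: L2B.
- exact: L2B.
- have h1 := hcvg_plow Lf fu.
  have h2 : hcvg (L2H mu) (fun m => plow (N + m) f) u.
    exact: (hcvg_addn N h1).
  apply: (eq_hcvg h2) => m.
  rewrite (_ : plow (N + m) f - plow N f - (u - plow N f) = plow (N + m) f - u)//.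
  by rewrite opprB addrA subrK.
- move=> m; apply: le_trans (plow_tail N m M0 Lf fM) _; rewrite lee_fin.
  rewrite [leRHS](_ : _ = sobolev_cst * M * (rho ^+ N / (1 - rho))); last by ring.
  rewrite ler_wpM2l ?mulr_ge0 ?sobolev_cst_ge0 ?(ltW M0)// ler_pM2r ?invr_gt0 ?subr_gt0//.
  by rewrite ler_piMr ?exprn_ge0 ?(ltW r0)// gerBl exprn_ge0// ltW.
Qed.

Lemma plow0 f x : plow 0 f x = 0.
Proof.
have low0 : lowf 0 f = fun=> 0.
  apply/funext => xi; rewrite /lowf /rmul indicE memNset ?mul0r//.
  by rewrite /low /= expr0 => /(le_lt_trans (wt_ge1 s xi)); rewrite ltxx.
rewrite /plow low0 /Finv /cj FE.
rewrite (_ : cint _ _ = 0) ?mulr0; first by apply: complex_ext; rewrite /= ?oppr0.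
apply: complex_ext => /=.
- rewrite -[RHS](@mul0r _ (fine (mu setT))) -Rintegral_cst//.
  by apply: eq_Rintegral => y _; rewrite /= oppr0 !mul0r subr0.
- rewrite -[RHS](@mul0r _ (fine (mu setT))) -Rintegral_cst//.
  by apply: eq_Rintegral => y _; rewrite /= oppr0 !mul0r addr0.
Qed.

(** The Sobolev embedding: as the weight is at least one, there is nothing below
level 0, and the tail is the whole function. *)
Lemma sobolev f u (M : R) : 0 < M -> L2 f -> ip2 f f <= M ^+ 2 ->
  is_fourier u (unweight f) -> (cLnorm q%:E u <= (sobolev_cst * M / (1 - rho))%:E)%E.
Proof.
move=> M0 Lf fM fu; have := high_cLnorm 0 M0 Lf fM fu.
rewrite expr0 mulr1; congr (_ <= _)%E; congr ('N[_]_ _ [_])%E.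
by apply/funext => x /=; rewrite !fctE plow0 subr0.
Qed.

End sobolev.

(** * Detecting concentration *)

Section dominated_Lq.
Context {R : realType} {d : nat}.
Local Notation E := 'rV[R]_d.
Local Notation mu := (@lebesgue_rV R d).
Implicit Types (f g u : E -> R[i]) (q : R).

Lemma nq_root q f : 0 < q -> nq q f = (nq q f `^ q) `^ q^-1.
Proof. by move=> q0; rewrite -powRrM mulfV ?gt_eqF// powRr1// nq_ge0. Qed.

Lemma nq_cvg0 q (u : nat -> E -> R[i]) (g : E -> R) : 0 < q ->
  (forall l, cmeas (u l)) -> rint mu g -> (forall l x, cnorm (u l x) `^ q <= g x) ->
  (forall x, cnorm (u l x) @[l --> \oo] --> (0 : R)) ->
  (forall l, Lq q (u l)) /\ nq q (u l) @[l --> \oo] --> (0 : R).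
Proof.
move=> q0 mu_ ig ug u0.
have iu l : rint mu (fun x => cnorm (u l x) `^ q).
  apply: (rint_le _ ig); first exact: meas_powR_cnorm.
  by move=> x; rewrite ger0_norm ?powR_ge0.
have Lu l : Lq q (u l).
  split => //; rewrite cLnormE; apply: poweR_lty.
  by rewrite -EFin_Rintegral// ltry.
split => //.
have h : \int[mu]_x (cnorm (u l x) `^ q) @[l --> \oo] --> \int[mu]_x (cst 0 x : R).
  apply: (@Rintegral_cvg _ _ _ _ _ _ g) => //.
  - by move=> l; exact: meas_powR_cnorm.
  - by move=> l x; rewrite ger0_norm ?powR_ge0.
  - apply: aeW => x; have h0 := cvg_powR q0 (fun l => cnorm_ge0 (u l x)) (u0 x).
    by rewrite powR0 ?gt_eqF// in h0.
rewrite Rintegral_cst// mul0r in h.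
have h2 : nq q (u l) `^ q @[l --> \oo] --> (0 : R).
  apply: (cvg_ext h) => l; apply: EFin_inj.
  by rewrite nq_pow// EFin_Rintegral.
have qi : 0 < q^-1 by rewrite invr_gt0.
have h3 := cvg_powR qi (fun l => powR_ge0 (nq q (u l)) q) h2.
rewrite powR0 ?gt_eqF// in h3.
by apply: (cvg_ext h3) => l; rewrite -nq_root.
Qed.

Lemma rint_Lq q f : 0 < q -> Lq q f -> rint mu (fun x => cnorm (f x) `^ q).
Proof.
move=> q0 Lf; apply/ge0_rintP; first exact: meas_powR_cnorm Lf.1.
  by move=> x; exact: powR_ge0.
by rewrite -nq_pow// ltry.
Qed.

Definition chop (A : set E) f : E -> R[i] := fun x => (\1_A x)%:C%C * f x.

Lemma cmeas_chop (A : set E) f : measurable A -> cmeas f -> cmeas (chop A f).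
Proof. by move=> mA mf; apply: cmeasM => //; apply: cmeas_real; exact: measurable_indic. Qed.

Lemma chop_in (A : set E) f x : A x -> chop A f x = f x.
Proof. by move=> Ax; rewrite /chop indicE mem_set// mul1r. Qed.

Lemma chop_out (A : set E) f x : ~ A x -> chop A f x = 0.
Proof. by move=> Ax; rewrite /chop indicE memNset// mul0r. Qed.

Lemma cnorm_chop (A : set E) f x : cnorm (chop A f x) <= cnorm (f x).
Proof.
have [Ax|Ax] := pselect (A x); first by rewrite chop_in.
by rewrite chop_out// cnorm0 cnorm_ge0.
Qed.

Lemma Lq_chop q (A : set E) f : 0 < q -> measurable A -> Lq q f -> Lq q (chop A f).
Proof.
move=> q0 mA Lf; have [] := Lq_le q0 (cmeas_chop mA Lf.1) Lf; last by [].
exact: cnorm_chop.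
Qed.

Lemma chop_setC (A : set E) f x : chop A f x + chop (~` A) f x = f x.
Proof.
have [Ax|nAx] := pselect (A x).
  by rewrite chop_in// chop_out ?addr0// => /(_ Ax).
by rewrite chop_out// chop_in// add0r.
Qed.

Lemma nq_chop_cube q f : 0 < q -> Lq q f ->
  nq q (chop (~` cube N) f) @[N --> \oo] --> (0 : R).
Proof.
move=> q0 Lf.
have mC N : measurable (~` (cube N : set E)) by apply: measurableC; exact: measurable_ocbox.
have [||_ h] := @nq_cvg0 q (fun N => chop (~` cube N) f) (fun x => cnorm (f x) `^ q) q0
  (fun N => cmeas_chop (mC N) Lf.1) (rint_Lq q0 Lf) _ _.
- move=> N x; apply: ge0_ler_powR; rewrite ?nnegrE ?cnorm_ge0 ?cnorm_chop//; exact: ltW.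
- move=> x; apply: cvg_near_cst; apply: filterS (mem_cube x) => N xN.
  by rewrite chop_out ?cnorm0// => /(_ xN).
- exact: h.
Qed.

Lemma nq_disjoint q (A : set E) f g : 1 <= q -> measurable A -> Lq q f -> Lq q g ->
  nq q (fun x => chop A f x + chop (~` A) g x) `^ q =
  nq q (chop A f) `^ q + nq q (chop (~` A) g) `^ q.
Proof.
move=> q1 mA Lf Lg; have q0 : 0 < q by exact: lt_le_trans q1.
have mC := measurableC mA.
have L1 := Lq_chop q0 mA Lf; have L2 := Lq_chop q0 mC Lg; have L3 := LqD q1 L1 L2.
apply: EFin_inj; rewrite EFinD !nq_pow// -ge0_integralD//; first last.
- by apply/measurable_EFinP; exact: meas_powR_cnorm L2.1.
- by move=> x _; rewrite lee_fin powR_ge0.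
- by apply/measurable_EFinP; exact: meas_powR_cnorm L1.1.
- by move=> x _; rewrite lee_fin powR_ge0.
apply: eq_integral => x _; rewrite -EFinD; congr EFin.
have [Ax|nAx] := pselect (A x).
  rewrite [chop (~` A) g x]chop_out => [|/(_ Ax)//].
  by rewrite addr0 cnorm0 powR0 ?addr0// gt_eqF.
by rewrite [chop A f x]chop_out// add0r cnorm0 powR0 ?add0r// gt_eqF.
Qed.

End dominated_Lq.

Section detection.
Context {R : realType} {n : nat} (dd : 'I_n -> nat) (s : 'I_n -> R).
Local Notation d := (\sum_(j < n) dd j)%N.
Local Notation E := 'rV[R]_(\sum_(j < n) dd j).
Local Notation mu := (@lebesgue_rV R d).
Local Notation cd := (@cd R d).
Local Notation L2 := (L2 mu).
Local Notation ip2 := (ip2 mu).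
Local Notation low := (@low R n dd s).
Local Notation W := (@W R n dd s).
Local Notation unweight := (@unweight R n dd s).
Local Notation plow := (@plow R n dd s).
Local Notation lowf := (@lowf R n dd s).
Implicit Types (f g u : E -> R[i]) (x xi : E).
Hypothesis s0 : forall j, 0 < s j.

(** The vectors that represent the real and imaginary parts of the evaluation of
[plow N f] at the origin. *)
Definition lowsym (N : nat) xi : R := cd * (\1_(low N) xi * (W xi)^-1).
Definition rep_re (N : nat) xi : R[i] := (lowsym N xi)%:C%C.
Definition rep_im (N : nat) xi : R[i] := Complex 0 (lowsym N xi).

Lemma plowE N f x : L2 f ->
  plow N f x = cint mu (fun xi => modul x f xi * (lowsym N xi)%:C%C).
Proof.
move=> Lf; have [ig _] := L12_lowf s0 N Lf.
have ic := cint_able_char x (cint_ableJ ig).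
transitivity ((fourier_integral (cj (lowf N f)) x)^*); first by [].
rewrite FE cJM conjc_real -(cintJ ic) -(cintZ _ (cint_ableJ ic)).
apply: eq_cint => xi; rewrite cJM conjcK -expNiN dotvC /modul /lowsym.
rewrite -[lowf N f xi]/((\1_(low N) xi)%:C%C * (((W xi)^-1)%:C%C * f xi)) !rmorphM /=; ring.
Qed.

Lemma plow_Re N f x : L2 f -> Re (plow N f x) = ip2 (modul x f) (rep_re N).
Proof. by move=> Lf; rewrite plowE//; apply: eq_Rintegral => xi _; rewrite !cE /=; ring. Qed.

Lemma plow_Im N f x : L2 f -> Im (plow N f x) = ip2 (modul x f) (rep_im N).
Proof. by move=> Lf; rewrite plowE//; apply: eq_Rintegral => xi _; rewrite !cE /=; ring. Qed.

Lemma meas_lowsym N : measurable_fun setT (lowsym N).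
Proof.
apply: measurable_funM; first exact: measurable_cst.
by apply: measurable_funM; [apply: measurable_indic; exact: measurable_low|exact: meas_Winv].
Qed.

Lemma sqr_lowsym_le N xi : lowsym N xi ^+ 2 <= cd ^+ 2 * \1_(low N) xi.
Proof.
rewrite exprMn ler_wpM2l ?sqr_ge0// indicE; case: (_ \in _); last by rewrite mul0r expr0n.
rewrite mul1r -real_normK ?num_real//.
by apply: exprn_ile1 => //; exact: Winv_le1.
Qed.

Lemma rint_low N : rint mu (fun xi => cd ^+ 2 * \1_(low N) xi).
Proof. by apply: rintZ; apply: rint_indic; [exact: measurable_low|exact: low_lty]. Qed.

Lemma L2_rep_re N : L2 (rep_re N).
Proof.
apply: (L2_le _ (rint_low N)); first by apply: cmeas_real; exact: meas_lowsym.
by move=> xi; rewrite cnorm_real real_normK ?num_real// sqr_lowsym_le.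
Qed.

Lemma L2_rep_im N : L2 (rep_im N).
Proof.
apply: (L2_le _ (rint_low N)).
  by split => /=; [exact: measurable_cst|exact: meas_lowsym].
by move=> xi; rewrite sqr_cnorm /= expr0n add0r sqr_lowsym_le.
Qed.

Lemma ip2_lowf N f : L2 f -> ip2 (lowf N f) (lowf N f) <= ip2 f f.
Proof.
move=> Lf; rewrite -[leRHS]mul1r; apply: ip2_le_pointwise => //.
  exact: (L12_lowf s0 N Lf).2.
move=> xi; rewrite mul1r ler_sqr ?nnegrE ?cnorm_ge0//.
apply: le_trans (cnorm_chop (low N) (unweight f) xi) _.
by rewrite cnormM cnorm_real ler_piMl ?cnorm_ge0// Winv_le1.
Qed.

Lemma plow_sup N : exists2 K : R, 0 <= K & forall f x, L2 f ->
  cnorm (plow N f x) <= K * Num.sqrt (ip2 f f).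
Proof.
exists (cd * Num.sqrt (fine (mu (low N)))).
  by rewrite mulr_ge0 ?sqrtr_ge0// ltW// cd_gt0.
move=> f x Lf.
apply: le_trans (Finv_sup x (@measurable_low R n dd s N) (@low_lty R n dd s s0 N) (L12_lowf s0 N Lf) _) _.
  by move=> xi nl; exact: chop_out.
rewrite mulrA ler_wpM2l ?mulr_ge0 ?sqrtr_ge0 ?(ltW cd_gt0)//.
by apply: ler_wsqrtr; exact: ip2_lowf.
Qed.

(** Values of low-frequency parts are inner products with fixed vectors. *)
Lemma plow_cvg0 N (v : nat -> E -> R[i]) x : (forall l, L2 (v l)) ->
  (forall h, L2 h -> ip2 (v l) h @[l --> \oo] --> (0 : R)) ->
  cnorm (plow N (v l) x) @[l --> \oo] --> (0 : R).
Proof.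
move=> Lv v0.
have adj h : L2 h -> ip2 (modul x (v l)) h @[l --> \oo] --> (0 : R).
  move=> Lh; apply: (cvg_ext (v0 _ (L2_modul (- x) Lh))) => l.
  by rewrite -(ip2_modul x) modul_comp subrr modul0.
apply: (@cvg_squeeze0 _ _ (fun l => `|Re (plow N (v l) x)| + `|Im (plow N (v l) x)|)).
  by move=> l; rewrite subr0 ger0_norm ?cnorm_ge0// cnorm_le_ReIm.
pose proof (cvg_norm (adj _ (L2_rep_re N))) as h1.
pose proof (cvg_norm (adj _ (L2_rep_im N))) as h2.
rewrite normr0 in h1 h2; rewrite -[X in _ --> X](addr0 0).
apply: cvgD; [apply: (cvg_ext h1) => l|apply: (cvg_ext h2) => l].
  by rewrite plow_Re.
by rewrite plow_Im.
Qed.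

(** Inverse transforms are determined up to null sets; this chooses one. *)
Definition Phi f : E -> R[i] := xget (fun=> 0) [set u | is_fourier u (unweight f)].

Lemma PhiP f : L2 f -> is_fourier (Phi f) (unweight f).
Proof. by move=> /(L2_unweight s)/is_fourier_surj h; exact: xgetPex h. Qed.

Lemma L2_Phi f : L2 f -> L2 (Phi f).
Proof. by move=> /PhiP/is_fourier_dom[]. Qed.

Variable q : R.
Hypothesis q2 : 2 < q.
Hypothesis gam0 : 0 < @gam R n dd s q.
Local Notation rho := (@rho R n dd s q).
Local Notation sobolev_cst := (@sobolev_cst R n dd s q).

Let q0 : 0 < q. Proof. exact: lt_trans q2. Qed.
Let q1 : 1 <= q. Proof. by apply: ltW; apply: lt_trans q2; rewrite ltr1n. Qed.

Lemma bound_sqr (M : R) : exists2 M' : R, 0 < M' & M <= M' ^+ 2.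
Proof.
exists (`|M| + 1); first by rewrite ltr_wpDl.
have := ler_norm M; have := normr_ge0 M => *; nra.
Qed.

Lemma Lq_spectrum f u : L2 f -> is_fourier u (unweight f) -> Lq q u.
Proof.
move=> Lf fu; have [M M0 fM] := bound_sqr (ip2 f f).
have [mu_ _] := (is_fourier_dom fu).1.
by have [] := nq_le mu_ (sobolev s0 q2 gam0 M0 Lf fM fu).
Qed.

Lemma nq_bounded (M : R) : exists K : R, forall f, L2 f -> ip2 f f <= M -> nq q (Phi f) <= K.
Proof.
have [M' M0 MM] := bound_sqr M; eexists => f Lf fM; have fu := PhiP Lf.
exact: (nq_le (is_fourier_dom fu).1.1 (sobolev s0 q2 gam0 M0 Lf (le_trans fM MM) fu)).2.
Qed.

Lemma tail_small (M e : R) : 0 < M -> 0 < e -> exists N, forall f u, L2 f -> ip2 f f <= M ^+ 2 ->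
  is_fourier u (unweight f) -> Lq q (u - plow N f) /\ nq q (u - plow N f) <= e.
Proof.
move=> M0 e0; have r1 := rho_lt1 gam0; have r0 := @rho_gt0 R n dd s q.
have g : sobolev_cst * M / (1 - rho) * rho ^+ N @[N --> \oo] --> (0 : R).
  rewrite -[X in _ --> X](mulr0 (sobolev_cst * M / (1 - rho))); apply: cvgMr.
  by apply: cvg_expr; rewrite gtr0_norm.
have /cvgr0Pnorm_le/(_ e e0)[N _ /(_ N (leqnn N)) /= hN] := g.
exists N => f u Lf fM fu.
apply: nq_le.
  by apply: cmeasD; [exact: (is_fourier_dom fu).1.1|apply: cmeasN; exact: (L2_plow s0 N Lf).1].
apply: le_trans (high_cLnorm s0 q2 gam0 N M0 Lf fM fu) _.
by rewrite lee_fin; apply: le_trans (ler_norm _) hN.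
Qed.

(** The tail being uniformly small, a function with a large L^q norm has a
low-frequency part with a large L^q norm.  As its L^2 norm is bounded, that part
is large at some point, and a value at a point is a pair of inner products with
a translate. *)
Lemma nq_detects (d0 : (0 < d)%N) : detects (L2_translations d0) (fun f => nq q (Phi f)).
Proof.
move=> M r r0; have [M' M0 MM] := bound_sqr M.
have r20 : 0 < r / 2 by rewrite divr_gt0.
have [N hN] := tail_small M0 r20.
pose A := r / 2; have A0 : 0 < A by rewrite divr_gt0.
pose k := (A `^ q / (2 * M' ^+ 2)) `^ (q - 2)^-1.
have M20 : 0 < 2 * M' ^+ 2 by rewrite mulr_gt0// exprn_gt0.
have k0 : 0 < k by rewrite powR_gt0// divr_gt0// powR_gt0.
exists (k ^+ 2), (rep_re N), (rep_im N); split; [exact: exprn_gt0|exact: L2_rep_re|exact: L2_rep_im|].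
move=> f Lf fM rf; apply: contrapT => no.
have small x : cnorm (plow N f x) <= k.
  rewrite leNgt; apply/negP => kx; apply: no; exists x.
  rewrite -[ip _ _ _](plow_Re N x Lf) -[X in _ + X ^+ 2](plow_Im N x Lf) -sqr_cnorm.
  by rewrite ler_sqr ?nnegrE ?cnorm_ge0 ?(ltW k0)// ltW.
have fM' := le_trans fM MM; have fu := PhiP Lf.
have [Lt tN] := hN f _ Lf fM' fu; have LqU := Lq_spectrum Lf fu.
have Lp := L2_plow s0 N Lf.
have Lqp : Lq q (plow N f).
  have := LqB q1 LqU Lt; congr Lq; apply/funext => x; by rewrite !fctE opprB addrC subrK.
have Ap : A <= nq q (plow N f).
  have := nq_dist q1 LqU Lqp; rewrite ler_norml => /andP[_ h].
  move: h tN rf; rewrite /A -[fun x => _]/(Phi f - plow N f); lra.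
have : A `^ q <= k `^ (q - 2) * M' ^+ 2.
  apply: (@le_trans _ _ (nq q (plow N f) `^ q)).
    by apply: ge0_ler_powR; rewrite ?nnegrE ?nq_ge0 ?(ltW A0) ?(ltW q0).
  rewrite -lee_fin nq_pow//; apply: le_trans (integral_powR_le (ltW q2) Lp small) _.
  rewrite lee_fin ler_wpM2l ?powR_ge0// -(is_fourier_isometry (is_fourier_plow s0 N Lf)).
  exact: le_trans (ip2_lowf N Lf) fM'.
have q20 : q - 2 != 0 by rewrite gt_eqF// subr_gt0.
rewrite /k -powRrM mulVf// powRr1; last by rewrite divr_ge0 ?powR_ge0// ltW.
have := powR_gt0 q A0; set B := A `^ q => B0.
have -> : B / (2 * M' ^+ 2) * M' ^+ 2 = B / 2 by field; rewrite gt_eqF.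
lra.
Qed.

(** Up to small errors in L^q, replace [U] by its restriction to a large cube, and
[V l] by the restriction of its low-frequency part to the complement: inside the
cube the low-frequency parts are bounded and tend pointwise to zero.  The new
functions have disjoint supports. *)
Lemma decoupling (M : R) (v V : nat -> E -> R[i]) f U (A B : R) :
  (forall l, L2 (v l)) -> (forall l, ip2 (v l) (v l) <= M) ->
  (forall h, L2 h -> ip2 (v l) h @[l --> \oo] --> (0 : R)) ->
  (forall l, is_fourier (V l) (unweight (v l))) -> L2 f -> is_fourier U (unweight f) ->
  nq q (U + V l) @[l --> \oo] --> A -> nq q (V l) @[l --> \oo] --> B ->
  A `^ q = B `^ q + nq q U `^ q.
Proof.
move=> Lv vM v0 fV Lf fU cA cB; have [M' M0 MM] := bound_sqr M.
have LqU := Lq_spectrum Lf fU; have LqV l := Lq_spectrum (Lv l) (fV l).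
have step (e : R) : 0 < e -> exists a b c : R,
    [/\ 0 <= a, 0 <= b, 0 <= c, a `^ q = b `^ q + c `^ q &
        [/\ `|a - A| <= e, `|b - B| <= e & `|c - nq q U| <= e]].
  move=> e0; have e6 : 0 < e / 6 by rewrite divr_gt0.
  have [N hN] := tail_small M0 e6.
  have /cvgr0Pnorm_le/(_ _ e6)[K _ /(_ K (leqnn K)) /= hK] := nq_chop_cube q0 LqU.
  rewrite ger0_norm ?nq_ge0// in hK.
  have mQ : measurable (cube K : set E) by exact: measurable_ocbox.
  have mC := measurableC mQ.
  pose p l := plow N (v l).
  have Lp l : L2 (p l) by exact: L2_plow.
  have [C C0 pC] := plow_sup N.
  have tl l := hN _ _ (Lv l) (le_trans (vM l) MM) (fV l).
  have Lqp l : Lq q (p l).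
    have := LqB q1 (LqV l) (tl l).1; congr Lq; apply/funext => x; by rewrite !fctE opprB addrC subrK.
  have CM l x : cnorm (p l x) <= C * M'.
    apply: le_trans (pC _ x (Lv l)) _; rewrite ler_wpM2l//.
    rewrite -[M']ger0_norm ?(ltW M0)// -sqrtr_sqr ler_wsqrtr//; exact: le_trans (vM l) MM.
  have [_ hp] : (forall l, Lq q (chop (cube K) (p l))) /\
      nq q (chop (cube K) (p l)) @[l --> \oo] --> (0 : R).
    apply: (@nq_cvg0 _ _ q _ (fun x => (C * M') `^ q * \1_(cube K) x) q0).
    - by move=> l; apply: cmeas_chop => //; exact: (Lp l).1.
    - by apply: rintZ; apply: rint_indic => //; exact: ocbox_lty.
    - move=> l x; have [xK|xK] := pselect (cube K x).
        rewrite chop_in// indicE mem_set// mulr1.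
        by apply: ge0_ler_powR; rewrite ?nnegrE ?cnorm_ge0 ?(ltW q0)// mulr_ge0// ltW.
      by rewrite chop_out// cnorm0 powR0 ?gt_eqF// indicE memNset// mulr0.
    - move=> x; apply: (@cvg_squeeze0 _ _ (fun l => cnorm (p l x))).
        by move=> l; rewrite subr0 ger0_norm ?cnorm_ge0// cnorm_chop.
      exact: plow_cvg0.
  have [l [l1 l2 l3]] : exists l, [/\ nq q (chop (cube K) (p l)) <= e / 6,
      `|nq q (U + V l) - A| <= e / 6 & `|nq q (V l) - B| <= e / 6].
    have /cvgr0Pnorm_le/(_ _ e6)[L1 _ h1] := hp.
    have /cvgrPdist_le/(_ _ e6)[L2 _ h2] := cA.
    have /cvgrPdist_le/(_ _ e6)[L3 _ h3] := cB.
    exists (L1 + L2 + L3)%N; split.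
    - have := h1 (L1 + L2 + L3)%N; rewrite /= ger0_norm ?nq_ge0//; apply.
      by rewrite -addnA leq_addr.
    - by rewrite distrC; apply: h2; rewrite /= addnAC leq_addl.
    - by rewrite distrC; apply: h3; rewrite /= leq_addl.
  have [Lt tN] := tl l.
  have L1 := Lq_chop q0 mQ LqU; have L2 := Lq_chop q0 mC (Lqp l).
  have L3 := Lq_chop q0 mC LqU; have L4 := Lq_chop q0 mQ (Lqp l).
  exists (nq q (fun x => chop (cube K) U x + chop (~` cube K) (p l) x)),
    (nq q (chop (~` cube K) (p l))), (nq q (chop (cube K) U)); split; try exact: nq_ge0.
    by rewrite addrC [LHS]nq_disjoint// addrC.
  have eU x := chop_setC (cube K) U x; have ep x := chop_setC (cube K) (p l) x.
  have LqUV := LqD q1 LqU (LqV l).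
  have d1 := nq_dist q1 (LqD q1 L1 L2) LqUV.
  have d2 := nq_dist q1 L2 (LqV l); have d3 := nq_dist q1 L1 LqU.
  have b3 : nq q (fun x => chop (cube K) U x - U x) <= e / 6.
    apply: le_trans hK; rewrite -nqN le_eqVlt; apply/orP; left; apply/eqP; congr nq.
    by apply/funext => x; rewrite -{1}(eU x); ring.
  have b2 : nq q (fun x => chop (~` cube K) (p l) x - V l x) <= e / 6 + e / 6.
    have -> : (fun x => chop (~` cube K) (p l) x - V l x) =
        fun x => - (V l - p l) x + - chop (cube K) (p l) x.
      by apply/funext => x; rewrite !fctE -[in RHS](ep x); ring.
    apply: le_trans (nqD q1 (LqN Lt) (LqN L4)) _; rewrite !nqN; exact: lerD.
  have b1 : nq q (fun x => chop (cube K) U x + chop (~` cube K) (p l) x - (U x + V l x)) <=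
      e / 6 + (e / 6 + e / 6).
    have -> : (fun x => chop (cube K) U x + chop (~` cube K) (p l) x - (U x + V l x)) =
        fun x => (chop (cube K) U x - U x) + (chop (~` cube K) (p l) x - V l x).
      by apply/funext => x; ring.
    by apply: le_trans (nqD q1 (LqB q1 L1 LqU) (LqB q1 L2 (LqV l))) _; exact: lerD.
  have t1 (a b c x y : R) : `|a - b| <= x -> `|b - c| <= y -> `|a - c| <= x + y.
    by move=> h1 h2; rewrite -(subrKA b a); apply: le_trans (ler_normD _ _) (lerD h1 h2).
  split.
  - by apply: le_trans (t1 _ _ _ _ _ (le_trans d1 b1) l2) _; lra.
  - by apply: le_trans (t1 _ _ _ _ _ (le_trans d2 b2) l3) _; lra.
  - by apply: le_trans (le_trans d3 b3) _; lra.
have /choice[a ha] : forall m : nat, exists a, exists b c : R,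
    [/\ 0 <= a, 0 <= b, 0 <= c, a `^ q = b `^ q + c `^ q &
        [/\ `|a - A| <= m.+1%:R^-1, `|b - B| <= m.+1%:R^-1 & `|c - nq q U| <= m.+1%:R^-1]].
  by move=> m; apply: step; rewrite invr_gt0.
have /choice[b hb] := ha; have /choice[c hc] := hb.
have lim (z : nat -> R) (Z : R) : (forall m, `|z m - Z| <= m.+1%:R^-1) -> z m @[m --> \oo] --> Z.
  by move=> h; apply: cvg_squeeze0 h _; exact: cvg_harmonic.
have la : a m @[m --> \oo] --> A by apply: lim => m; have [_ _ _ _ []] := hc m.
have lb : b m @[m --> \oo] --> B by apply: lim => m; have [_ _ _ _ []] := hc m.
have lc : c m @[m --> \oo] --> nq q U by apply: lim => m; have [_ _ _ _ []] := hc m.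
have pa : a m `^ q @[m --> \oo] --> A `^ q.
  by apply: cvg_powR => // m; have [] := hc m.
have pb : b m `^ q @[m --> \oo] --> B `^ q.
  by apply: cvg_powR => // m; have [] := hc m.
have pc : c m `^ q @[m --> \oo] --> nq q U `^ q.
  by apply: cvg_powR => // m; have [] := hc m.
apply: (lim_uniq pa); apply: (cvg_ext (cvgD pb pc)) => m.
by have [_ _ _ -> _] := hc m.
Qed.

End detection.

(** * Anisotropic Sobolev functions and their weighted spectra *)

Lemma rint_sum {d} {T : measurableType d} {R : realType} (m : {measure set T -> \bar R})
    (I : Type) (r : seq I) (u : I -> T -> R) : (forall i, rint m (u i)) ->
  rint m (fun x => \sum_(i <- r) u i x).
Proof.
move=> iu; elim: r => [|i r IH].
  by under eq_fun do rewrite big_nil; exact: integrable0.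
by under eq_fun do rewrite big_cons; exact: rintD.
Qed.

Lemma limn_esup_near_le {R : realType} (a b : nat -> R) (t : R) :
  (\forall l \near \oo, a l <= b l + t) ->
  (limn_esup (fun l => (a l)%:E) <= limn_esup (fun l => (b l)%:E) + t%:E)%E.
Proof.
move=> ab; rewrite -leeBlDr//; apply: le_ereal_inf_tmp => _ [A Aoo <-].
rewrite leeBlDr//; set A' := A `&` [set l | a l <= b l + t].
have A'oo : \oo A' by apply: filterI.
apply: (@le_trans _ _ (ereal_sup [set (a l)%:E | l in A'])).
  by apply: ereal_inf_lbound; exists A'.
apply: ge_ereal_sup => _ [l [Al abl] <-].
apply: (@le_trans _ _ ((b l)%:E + t%:E)%E); first by rewrite -EFinD lee_fin.
by rewrite leeD2r//; apply: ereal_sup_ubound; exists l.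
Qed.

Lemma limn_esup_shift {R : realType} (a b : nat -> R) (t : R) :
  a l - b l @[l --> \oo] --> t ->
  (limn_esup (fun l => (a l)%:E) = limn_esup (fun l => (b l)%:E) + t%:E)%E.
Proof.
move=> abt; apply/le_anti/andP; split.
  apply/lee_addgt0Pr => e e0; rewrite -addeA -EFinD; apply: limn_esup_near_le.
  have /cvgrPdist_le/(_ e e0) := abt; apply: filterS => l.
  rewrite ler_norml => /andP[h _]; lra.
rewrite -leeBrDr//; apply/lee_addgt0Pr => e e0; rewrite -addeA -EFinN -EFinD.
apply: limn_esup_near_le.
have /cvgrPdist_le/(_ e e0) := abt; apply: filterS => l.
rewrite ler_norml => /andP[_ h]; lra.
Qed.

Section spectra.
Context {R : realType} {n : nat} (dd : 'I_n -> nat) (s : 'I_n -> R).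
Local Notation d := (\sum_(j < n) dd j)%N.
Local Notation E := 'rV[R]_(\sum_(j < n) dd j).
Local Notation mu := (@lebesgue_rV R d).
Local Notation H := (L2H mu).
Local Notation L2 := (L2 mu).
Local Notation ip2 := (ip2 mu).
Local Notation W := (@W R n dd s).
Local Notation wt := (@wt R n dd s).
Local Notation unweight := (@unweight R n dd s).
Local Notation Phi := (@Phi R n dd s).
Local Notation bn := (@block_norm R n dd).
Implicit Types (f g u v : E -> R[i]) (x xi : E).

Lemma ae_ip2 f g : L2 f -> L2 g -> {ae mu, forall x, f x = g x} -> ip2 f f = ip2 g g.
Proof.
move=> Lf Lg fg; apply: EFin_inj; rewrite -!integral_sqr//; apply: ae_eq_integral => //.
- by apply/measurable_EFinP; exact: meas_sqr_cnorm Lf.1.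
- by apply/measurable_EFinP; exact: meas_sqr_cnorm Lg.1.
- by apply: filterS fg => x ->.
Qed.

Lemma ip2_null_ae f g : L2 f -> L2 g -> ip2 (f - g) (f - g) = 0 -> {ae mu, forall x, f x = g x}.
Proof.
move=> Lf Lg h; have := ip2_ae0 (L2B Lf Lg) h; apply: filterS => x /eqP.
by rewrite subr_eq0 => /eqP.
Qed.

Lemma L2_ae f g : L2 f -> cmeas g -> {ae mu, forall x, f x = g x} -> L2 g.
Proof.
move=> Lf mg fg; split => //; apply/ge0_rintP; first exact: meas_sqr_cnorm.
  by move=> x; exact: sqr_ge0.
apply: le_lt_trans (ltry (ip2 f f)); rewrite -integral_sqr// le_eqVlt.
apply/orP; left; apply/eqP; apply: ae_eq_integral => //.
- by apply/measurable_EFinP; exact: meas_sqr_cnorm.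
- by apply/measurable_EFinP; exact: meas_sqr_cnorm Lf.1.
- by apply: filterS fg => x ->.
Qed.

Lemma is_fourier_unique u v g : is_fourier u g -> is_fourier v g -> {ae mu, forall x, u x = v x}.
Proof.
move=> hu hv; apply: ip2_null_ae; [exact: (is_fourier_dom hu).1|exact: (is_fourier_dom hv).1|].
rewrite -(is_fourier_dist hu hv) subrr.
exact: (ip0l (H := H) (dom0 H)).
Qed.

Lemma is_fourier_unique_r u g h : is_fourier u g -> is_fourier u h -> {ae mu, forall x, g x = h x}.
Proof.
move=> hg hh; apply: ip2_null_ae; [exact: (is_fourier_dom hg).2|exact: (is_fourier_dom hh).2|].
rewrite (is_fourier_dist hg hh) subrr.
exact: (ip0l (H := H) (dom0 H)).
Qed.

(** The value chosen by [multiplier] need not be the [v] at hand, but it has the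
same transform almost everywhere. *)
Lemma multiplierP (m u g : E -> R[i]) : is_fourier u g -> cmeas m -> L2 (fun xi => m xi * g xi) ->
  L2 (multiplier m u) /\ ip2 (multiplier m u) (multiplier m u) =
    ip2 (fun xi => m xi * g xi) (fun xi => m xi * g xi).
Proof.
move=> ug mm Lmg; have [v hv] := is_fourier_surj Lmg.
have : is_multiplier m u (multiplier m u).
  by apply: (@xgetPex _ _ [set v | is_multiplier m u v]); exists v; exists g.
move=> [g' ug' hm]; have [Lm Lmg'] := is_fourier_dom hm.
split => //; rewrite -(is_fourier_isometry hm); apply: ae_ip2 => //.
by apply: filterS (is_fourier_unique_r ug' ug) => xi ->.
Qed.

Lemma cLnorm2_sqr f : L2 f -> (cLnorm 2%:E f ^+ 2 = (ip2 f f)%:E)%E.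
Proof. by move=> Lf; rewrite cLnorm2E// -EFin_expe sqr_sqrtr//; exact: (ip_ge0 H). Qed.

Definition spec u f := L2 f /\ is_fourier u (unweight f).

Lemma spec_Phi f : L2 f -> spec (Phi f) f.
Proof. by move=> Lf; split => //; exact: PhiP. Qed.

Lemma unweightD f g : unweight (f + g) = unweight f + unweight g.
Proof. by apply/funext => xi; rewrite fctE [LHS]mulrDr. Qed.

Lemma unweightZ (c : R[i]) f : unweight (fun xi => c * f xi) = fun xi => c * unweight f xi.
Proof. by apply/funext => xi; rewrite [LHS]mulrCA. Qed.

Lemma unweight_modul x f : unweight (modul x f) = modul x (unweight f).
Proof. by apply/funext => xi; rewrite [LHS]mulrCA. Qed.

Lemma specD u v f g : spec u f -> spec v g -> spec (u + v) (f + g).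
Proof.
move=> [Lf uf] [Lg vg]; split; first exact: L2D.
by rewrite unweightD; exact: is_fourierD.
Qed.

Lemma specZ (c : R[i]) u f : spec u f -> spec (fun x => c * u x) (fun xi => c * f xi).
Proof.
move=> [Lf uf]; split; first exact: L2Z.
by rewrite unweightZ; exact: is_fourierZ.
Qed.

Lemma specB u v f g : spec u f -> spec v g -> spec (u - v) (f - g).
Proof.
move=> hu /(specZ (-1)) hv; have := specD hu hv; congr spec.
  by apply/funext => x; rewrite !fctE mulN1r.
by apply/funext => x; rewrite !fctE mulN1r.
Qed.

Lemma spec0 : spec 0 0.
Proof.
have h := spec_Phi (L20 mu); have := specB h h.
by rewrite (_ : Phi _ - _ = 0) ?subrr// (_ : (fun=> 0) - _ = 0) ?subrr.
Qed.

Lemma spec_shift x u f : spec u f -> spec (shift x u) (modul x f).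
Proof.
move=> [Lf uf]; split; first exact: L2_modul.
by rewrite unweight_modul; exact: is_fourier_shift.
Qed.

Lemma spec_L2 u f : spec u f -> L2 u.
Proof. by move=> [_ /is_fourier_dom[]]. Qed.

Lemma spec_unique u v f : spec u f -> spec v f -> {ae mu, forall x, u x = v x}.
Proof. by move=> [_ hu] [_ hv]; exact: is_fourier_unique hu hv. Qed.

Lemma Dsymbol_unweight_L2 j f : L2 f -> L2 (fun xi => Dsymbol s j xi * unweight f xi).
Proof.
move=> Lf; apply: (L2_le _ Lf.2).
  apply: cmeasM; last exact: (L2_unweight s Lf).1.
  by apply: cmeas_real; exact: meas_block_powR.
move=> xi; rewrite cnormM exprMn cnorm_real real_normK ?num_real//.
rewrite cnormM exprMn cnorm_real real_normK ?num_real// exprVn sqr_W mulrA ler_piMl ?sqr_ge0//.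
rewrite ler_pdivrMr ?mul1r; last exact: lt_le_trans ltr01 (wt_ge1 s xi).
rewrite /wt (bigD1 j)//= addrCA lerDl addr_ge0// sumr_ge0// => k _; exact: sqr_ge0.
Qed.

(** The squared symbols of the norm add up to the weight. *)
Lemma spec_Hs_norm u f : spec u f -> Hs_norm s u = (Num.sqrt (ip2 f f))%:E.
Proof.
move=> [Lf uf]; have LD j := Dsymbol_unweight_L2 j Lf; have Lg := L2_unweight s Lf.
have mP j := multiplierP uf (cmeas_real (@meas_block_powR R n dd s j)) (LD j).
rewrite /Hs_norm cLnorm2_sqr; last exact: (is_fourier_dom uf).1.
rewrite (eq_bigr (fun j => (ip2 (fun xi => Dsymbol s j xi * unweight f xi)
    (fun xi => Dsymbol s j xi * unweight f xi))%:E)) => [|j _]; last first.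
  by have [Lm e] := mP j; rewrite -[RHS](congr1 EFin e) -cLnorm2_sqr.
rewrite sumEFin -EFinD poweR_EFin powR12_sqrt; last first.
  by rewrite addr_ge0 ?sumr_ge0//; [exact: (ip_ge0 H)|move=> j _; exact: (ip_ge0 H)].
congr (Num.sqrt _)%:E; rewrite -(is_fourier_isometry uf).
apply: EFin_inj; rewrite EFinD -sumEFin -!integral_sqr//.
rewrite (eq_bigr (fun j => \int[mu]_xi (cnorm (Dsymbol s j xi * unweight f xi) ^+ 2)%:E)%E) => [|j _]; last first.
  by rewrite integral_sqr.
have ms (g : E -> R[i]) : L2 g -> measurable_fun setT (fun xi => (cnorm (g xi) ^+ 2)%:E).
  by move=> Lg'; apply/measurable_EFinP; exact: meas_sqr_cnorm Lg'.1.
rewrite -ge0_integral_sum//; last 2 first.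
- by move=> j; exact: ms (LD j).
- by move=> j xi _; rewrite lee_fin sqr_ge0.
rewrite -ge0_integralD//; last 4 first.
- by move=> xi _; rewrite lee_fin sqr_ge0.
- exact: ms.
- by move=> xi _; apply: sume_ge0 => j _; rewrite lee_fin sqr_ge0.
- by apply: emeasurable_sum => j; exact: ms (LD j).
apply: eq_integral => xi _; rewrite sumEFin -EFinD; congr EFin.
have w0 : wt xi != 0 by rewrite gt_eqF// (lt_le_trans ltr01 (wt_ge1 s xi)).
rewrite (eq_bigr (fun j => (bn j xi `^ s j) ^+ 2 * cnorm (unweight f xi) ^+ 2)) => [|j _]; last first.
  by rewrite cnormM exprMn cnorm_real real_normK ?num_real.
rewrite -mulr_suml -[X in X + _]mul1r -mulrDl -/(wt xi).
by rewrite cnormM exprMn cnorm_real real_normK ?num_real// exprVn sqr_W mulrA divff// mul1r.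
Qed.

Lemma spec_Hs u f : spec u f -> Hs s u.
Proof.
move=> [Lf uf]; split; first by apply/Lp2P; exact: (is_fourier_dom uf).1.
move=> j; have [v hv] := is_fourier_surj (Dsymbol_unweight_L2 j Lf).
by exists v; exists (unweight f).
Qed.

Lemma Hs_spec u : Hs s u -> exists f, spec u f.
Proof.
move=> [/Lp2P Lu hu]; have [g ug] := is_fourier_exists Lu; have Lg := (is_fourier_dom ug).2.
have LD j : L2 (fun xi => Dsymbol s j xi * g xi).
  have [v [g' ug' /is_fourier_dom[_ Lg']]] := hu j; apply: (L2_ae Lg').
    by apply: cmeasM; [apply: cmeas_real; exact: meas_block_powR|exact: Lg.1].
  by apply: filterS (is_fourier_unique_r ug' ug) => xi ->.
exists (rmul W g); have mW := @meas_W R n dd s.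
have e : unweight (rmul W g) = g.
  apply/funext => xi; rewrite [LHS]mulrA -rmorphM /= mulVf ?mul1r//.
  by rewrite gt_eqF// W_gt0.
split; last by rewrite e.
have iS : rint mu (fun xi => cnorm (g xi) ^+ 2 + \sum_(j < n) cnorm (Dsymbol s j xi * g xi) ^+ 2).
  apply: rintD; first exact: Lg.2.
  by apply: (@rint_sum _ _ _ mu _ _ (fun j xi => cnorm (Dsymbol s j xi * g xi) ^+ 2)) => j; exact: (LD j).2.
apply: (L2_le _ iS); first by apply: cmeasM; [exact: cmeas_real|exact: Lg.1].
move=> xi; rewrite cnormM exprMn cnorm_real real_normK ?num_real// sqr_W /wt mulrDl mul1r lerD2l.
rewrite mulr_suml le_eqVlt; apply/orP; left; apply/eqP; apply: eq_bigr => j _.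
by rewrite cnormM exprMn cnorm_real real_normK ?num_real.
Qed.

(** The real and imaginary parts of a bounded functional are real-linear and bounded
in the weighted spectrum, hence inner products by Riesz; they do not depend on
the inverse transform chosen, because the bound annihilates null functions. *)
Lemma spec_weak0 (v : nat -> E -> R[i]) (f : nat -> E -> R[i]) :
  (forall l, spec (v l) (f l)) ->
  (forall h, L2 h -> ip2 (f l) h @[l --> \oo] --> (0 : R)) ->
  Hs_weak_cvg s v (fun=> 0).
Proof.
move=> vf f0; split => [l||phi [phi_lin [C phiC]]]; first exact: spec_Hs (vf l).
  exact: spec_Hs spec0.
have linD a b (u w : E -> R[i]) : Hs s u -> Hs s w ->
   phi (fun x => a * u x + b * w x) = a * phi u + b * phi w.
  move=> Hu Hw; have H0 := spec_Hs spec0.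
  have z : phi 0 = 0.
    have := phi_lin 1 0 0 H0 H0.
    rewrite (_ : (fun x => _) = 0); last by apply/funext => x; rewrite mulr0 addr0.
    by rewrite mul1r => /eqP; rewrite -subr_eq0 opprD addNKr oppr_eq0 => /eqP.
  have Hbw : Hs s (fun x => b * w x).
    by have [g /(specZ b)/spec_Hs] := Hs_spec Hw.
  rewrite phi_lin//; congr (_ + _).
  have := phi_lin b w 0 Hw H0; rewrite z addr0 => <-.
  by congr phi; apply/funext => x; rewrite addr0.
have phi_le u g : spec u g -> cnorm (phi u) <= `|C| * Num.sqrt (ip2 g g).
  move=> ug; have := phiC u (spec_Hs ug); rewrite (spec_Hs_norm ug) -EFinM lee_fin.
  move=> h; apply: le_trans h _; rewrite ler_wpM2r ?sqrtr_ge0//; exact: ler_norm.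
have phi_eq u w g : spec u g -> spec w g -> phi u = phi w.
  move=> ug wg; have Hu := spec_Hs ug; have Hw := spec_Hs wg.
  have : cnorm (phi (u - w)) <= 0.
    have := phi_le _ _ (specB ug wg).
    by rewrite subrr [ip2 0 0](ip0l (H := H) (dom0 H)) sqrtr0 mulr0.
  move=> h; have : cnorm (phi (u - w)) = 0 by apply/le_anti; rewrite h cnorm_ge0.
  move/cnorm_eq0; rewrite (_ : u - w = fun x => 1 * u x + (-1) * w x).
    by rewrite linD// mul1r mulN1r => /eqP; rewrite subr_eq0 => /eqP.
  by apply/funext => x; rewrite mul1r mulN1r.
have part (p : R[i] -> R) : (forall z w, p (z + w) = p z + p w) ->
    (forall (a : R) z, p (a%:C%C * z) = a * p z) -> (forall z, `|p z| <= cnorm z) ->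
    p (phi (v l)) @[l --> \oo] --> (0 : R).
  move=> pD pZ pn.
  have [||||h Lh hP] := @riesz_representation _ _ H (fun g => p (phi (Phi g))) (C ^+ 2).
  - exact: sqr_ge0.
  - move=> g k Lg Lk; have sg := spec_Phi Lg; have sk := spec_Phi Lk.
    rewrite (phi_eq _ _ _ (spec_Phi (L2D Lg Lk)) (specD sg sk)) -pD; congr p.
    rewrite (_ : Phi g + Phi k = fun x => 1 * Phi g x + 1 * Phi k x).
      by rewrite linD ?mul1r//; [exact: spec_Hs sg|exact: spec_Hs sk].
    by apply/funext => x; rewrite !mul1r.
  - move=> a g Lg; have sg := spec_Phi Lg.
    rewrite (phi_eq _ _ _ (spec_Phi (L2Z a%:C%C Lg)) (specZ a%:C%C sg)) -pZ; congr p.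
    rewrite (_ : (fun x => _) = fun x => a%:C%C * Phi g x + 0 * Phi g x).
      by rewrite linD ?mul0r ?addr0//; exact: spec_Hs sg.
    by apply/funext => x; rewrite mul0r addr0.
  - move=> g Lg; have := phi_le _ _ (spec_Phi Lg).
    rewrite -[p _ ^+ 2]real_normK ?num_real// => h.
    have := le_trans (pn _) h; rewrite -(@ler_pXn2r _ 2) ?nnegrE ?mulr_ge0 ?sqrtr_ge0//.
    rewrite exprMn sqr_sqrtr ?real_normK ?num_real//; exact: (ip_ge0 H).
  apply: (cvg_ext (f0 h Lh)) => l.
  rewrite (phi_eq _ _ _ (vf l) (spec_Phi (vf l).1)) (hP _ (vf l).1) /=.
  exact: (ipC H).
have phi0 : phi (fun=> 0) = 0.
  apply: cnorm_eq0; apply/le_anti; rewrite cnorm_ge0 andbT.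
  by have := phi_le _ _ spec0; rewrite [ip2 0 0](ip0l (H := H) (dom0 H)) sqrtr0 mulr0.
have cr := part (@complex.Re R) (@ReD R) (fun a z => _) (@Re_le_cnorm R).
have ci := part (@complex.Im R) (@ImD R) (fun a z => _) (@Im_le_cnorm R).
have {}cr : Re (phi (v l)) @[l --> \oo] --> (0 : R).
  by apply: cr => a z; rewrite !cE /=; ring.
have {}ci : Im (phi (v l)) @[l --> \oo] --> (0 : R).
  by apply: ci => a z; rewrite !cE /=; ring.
apply: (@cvg_squeeze0 _ _ (fun l => `|Re (phi (v l))| + `|Im (phi (v l))|)).
  by move=> l; rewrite !subr0 phi0 subr0 ger0_norm ?cnorm_ge0// cnorm_le_ReIm.
pose proof (cvg_norm cr) as h1; pose proof (cvg_norm ci) as h2.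
rewrite normr0 in h1 h2; rewrite -[X in _ --> X](addr0 0).
by apply: cvgD.
Qed.

(** Each term of the bound on an admissible symbol is at most [W]. *)
Lemma admissible_le (m : E -> R[i]) : admissible_symbol s m ->
  exists2 K : R, 0 <= K & forall xi, cnorm (m xi * ((W xi)^-1)%:C%C) <= K.
Proof.
move=> [_ [C mC]]; exists (`|C| * (1 + n%:R)); first by rewrite mulr_ge0// addr_ge0.
move=> xi; rewrite cnormM cnorm_real ger0_norm ?invr_ge0 ?(ltW (W_gt0 _ _))//.
rewrite ler_pdivrMr ?W_gt0//; apply: le_trans (mC xi) _.
have S0 : 0 <= 1 + \sum_(j < n) bn j xi `^ s j.
  by rewrite addr_ge0// sumr_ge0// => j _; exact: powR_ge0.
apply: (@le_trans _ _ (`|C| * (1 + \sum_(j < n) bn j xi `^ s j))).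
  by rewrite ler_wpM2r// ler_norm.
rewrite -mulrA ler_wpM2l// mulrDl mul1r; apply: lerD; first exact: W_ge1.
rewrite -[n in n%:R]card_ord mulr_natl -sumr_const; apply: ler_sum => j _.
rewrite -[leLHS]ger0_norm ?powR_ge0// -sqrtr_sqr; apply: ler_wsqrtr.
rewrite /wt (bigD1 j)//= addrCA lerDl addr_ge0// sumr_ge0// => k _; exact: sqr_ge0.
Qed.

Lemma multiplier_spec (m u f : E -> R[i]) : admissible_symbol s m -> spec u f ->
  (cLnorm 2%:E (multiplier m u) ^+ 2 =
   (ip2 (fun xi => (m xi * ((W xi)^-1)%:C%C) * f xi)
        (fun xi => (m xi * ((W xi)^-1)%:C%C) * f xi))%:E)%E.
Proof.
move=> am [Lf uf]; have [K K0 mK] := admissible_le am.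
have e : (fun xi => m xi * unweight f xi) = fun xi => (m xi * ((W xi)^-1)%:C%C) * f xi.
  by apply/funext => xi; rewrite [LHS]mulrA.
have L : L2 (fun xi => m xi * unweight f xi).
  rewrite e; apply: (@L2M _ _ _ mu f _ K) => //.
  by apply: cmeasM; [exact: am.1|apply: cmeas_real; exact: meas_Winv].
by have [Lm eq] := multiplierP uf am.1 L; rewrite cLnorm2_sqr// eq e.
Qed.

Lemma ip2_symbol (m f g : E -> R[i]) :
  ip2 (fun xi => m xi * f xi) (fun xi => m xi * g xi) =
  ip2 f (fun xi => (cnorm (m xi) ^+ 2)%:C%C * g xi).
Proof. by apply: eq_Rintegral => xi _; rewrite sqr_cnorm !cE /=; ring. Qed.

End spectra.

(** * The profile decomposition *)

Lemma cvg_EFin_seq {R : realType} (a : nat -> R) (l : R) :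
  a n @[n --> \oo] --> l -> (a n)%:E @[n --> \oo] --> l%:E.
Proof. by move=> h; exact: cvg_EFin (nearW _ _) h. Qed.

Section limits.
Context {R : realType} {n : nat} {dd : 'I_n -> nat} {s : 'I_n -> R} {q : R}.
Local Notation d := (\sum_(j < n) dd j)%N.
Local Notation E := 'rV[R]_(\sum_(j < n) dd j).
Local Notation mu := (@lebesgue_rV R d).
Local Notation H := (L2H mu).
Local Notation L2 := (L2 mu).
Local Notation ip2 := (ip2 mu).
Local Notation Phi := (@Phi R n dd s).
Hypothesis s0 : forall j, 0 < s j.
Hypothesis q2 : 2 < q.
Hypothesis gam0 : 0 < @gam R n dd s q.

(* The output of the abstract decomposition for the spectra [g]. *)
Variables (g : nat -> E -> R[i]) (Uf : nat -> E -> R[i]) (x : nat -> nat -> E) (B : R).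
Hypothesis Lg : forall l, L2 (g l).
Hypothesis gB : forall l, ip2 (g l) (g l) <= B.
Hypothesis LU : forall k, L2 (Uf k).
Definition rf k l : E -> R[i] := g l - \sum_(j < k) modul (x j l) (Uf j).
Hypothesis rweak : forall j k, (j < k)%N -> forall h, L2 h ->
  ip2 (modul (- x j l) (rf k l)) h @[l --> \oo] --> (0 : R).

Lemma L2_rf k l : L2 (rf k l).
Proof.
apply: (domB (H := H) (Lg l)); apply: (big_ind (dom H)) => [|f h|j _].
- exact: (dom0 H).
- exact: (domD (s := H)).
- exact: L2_modul.
Qed.

Lemma rfS k l : rf k l = rf k.+1 l + modul (x k l) (Uf k).
Proof. by rewrite /rf big_ord_recr /= opprD addrA subrK. Qed.

Lemma rf_bounded k : exists M : R, forall l, ip2 (rf k l) (rf k l) <= M.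
Proof.
elim: k => [|k [M hM]]; first by exists B => l; rewrite /rf big_ord0 subr0.
exists (2 * M + 2 * ip2 (Uf k) (Uf k)) => l.
have -> : rf k.+1 l = rf k l + - modul (x k l) (Uf k) by rewrite (rfS k l) addrK.
have Lm := L2_modul (x k l) (LU k).
apply: le_trans (ip_sqrD_le (H := H) (L2_rf k l) (domN (s := H) Lm)) _.
have -> : ip H (- modul (x k l) (Uf k)) (- modul (x k l) (Uf k)) = ip2 (Uf k) (Uf k).
  by rewrite (ipNl (H := H) Lm (domN (s := H) Lm)) (ipNr (H := H) Lm Lm) opprK [LHS]ip2_modul.
by have := hM l => /= h; lra.
Qed.

(** Translated back, the [k]-th remainder is the [k]-th profile plus the translate
of the next remainder, which is weakly null: they decouple. *)
Lemma nq_profile (r : nat -> nat -> E -> R[i]) (nu : nat -> R) k :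
  (forall k l, spec s (r k l) (rf k l)) ->
  (forall k l, r k l = r k.+1 l + shift (x k l) (Phi (Uf k))) ->
  (forall k, nq q (r k l) @[l --> \oo] --> nu k) ->
  nu k `^ q = nu k.+1 `^ q + nq q (Phi (Uf k)) `^ q.
Proof.
move=> sr rS rnu; have [M rM] := rf_bounded k.+1.
have Lv l := L2_modul (- x k l) (L2_rf k.+1 l).
have sv l := spec_shift (- x k l) (sr k.+1 l).
have mr k' l : cmeas (r k' l) by exact: (spec_L2 (sr k' l)).1.
apply: (decoupling s0 q2 gam0 Lv (M := M) (V := fun l => shift (- x k l) (r k.+1 l))
  (f := Uf k)) => //.
- by move=> l; rewrite ip2_modul.
- exact: rweak.
- by move=> l; exact: (sv l).2.
- exact: PhiP.
- apply: (cvg_ext (rnu k)) => l; rewrite -(nq_shift q (- x k l) (mr k l)) (rS k l).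
  congr nq; apply/funext => y; rewrite /shift !fctE addrC; congr (_ + _).
  by rewrite /shift addrNK.
- by apply: (cvg_ext (rnu k.+1)) => l; rewrite nq_shift.
Qed.

(** The cross terms are inner products of a weakly null sequence with the product of
[|m|^2] and a profile. *)
Lemma symbol_profile (m : E -> R[i]) (K : R) k : cmeas m -> (forall xi, cnorm (m xi) <= K) ->
  ip2 (fun xi => m xi * rf 0 l xi) (fun xi => m xi * rf 0 l xi) -
  ip2 (fun xi => m xi * rf k l xi) (fun xi => m xi * rf k l xi) @[l --> \oo] -->
  \sum_(j < k) ip2 (fun xi => m xi * Uf j xi) (fun xi => m xi * Uf j xi).
Proof.
move=> mm mK; pose T f : E -> R[i] := fun xi => m xi * f xi.
have LT f : L2 f -> L2 (T f) by move=> Lf; exact: L2M Lf mm mK.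
have LT2 f : L2 f -> L2 (fun xi => (cnorm (m xi) ^+ 2)%:C%C * f xi).
  move=> Lf; apply: (@L2M _ _ _ mu f _ (K ^+ 2)) => //.
    by apply: cmeas_real; exact: meas_sqr_cnorm.
  move=> xi; rewrite cnorm_real ger0_norm ?sqr_ge0// ler_sqr ?nnegrE ?cnorm_ge0//.
  exact: le_trans (cnorm_ge0 _) (mK xi).
elim: k => [|k IH].
  by rewrite big_ord0; under eq_fun do rewrite subrr; exact: cvg_cst.
have step : ip2 (T (rf k l)) (T (rf k l)) - ip2 (T (rf k.+1 l)) (T (rf k.+1 l)) @[l --> \oo]
    --> ip2 (T (Uf k)) (T (Uf k)).
  have c0 : 2 * ip2 (modul (- x k l) (rf k.+1 l)) (fun xi => (cnorm (m xi) ^+ 2)%:C%C * Uf k xi)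
      @[l --> \oo] --> 2 * (0 : R).
    by apply: cvgMr; apply: rweak => //; exact: LT2.
  have c1 : 2 * ip2 (modul (- x k l) (rf k.+1 l)) (fun xi => (cnorm (m xi) ^+ 2)%:C%C * Uf k xi)
      + ip2 (T (Uf k)) (T (Uf k)) @[l --> \oo] --> 2 * (0 : R) + ip2 (T (Uf k)) (T (Uf k)).
    by apply: cvgD; [exact: c0|exact: cvg_cst].
  rewrite mulr0 add0r in c1; apply: (cvg_ext c1) => l.
  have Lr := L2_rf k.+1 l; have Lm := L2_modul (x k l) (LU k).
  have -> : T (rf k l) = T (rf k.+1 l) + T (modul (x k l) (Uf k)).
    by apply/funext => xi; rewrite /T (rfS k l) [in LHS]fctE mulrDr.
  have -> : ip2 (T (rf k.+1 l) + T (modul (x k l) (Uf k))) (T (rf k.+1 l) + T (modul (x k l) (Uf k))) =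
    ip2 (T (rf k.+1 l)) (T (rf k.+1 l)) + 2 * ip2 (T (rf k.+1 l)) (T (modul (x k l) (Uf k))) +
    ip2 (T (modul (x k l) (Uf k))) (T (modul (x k l) (Uf k))).
    exact: (ip_sqrD (H := H) (LT _ Lr) (LT _ Lm)).
  have -> : ip2 (T (modul (x k l) (Uf k))) (T (modul (x k l) (Uf k))) = ip2 (T (Uf k)) (T (Uf k)).
    rewrite -[RHS](ip2_modul (x k l)); congr (ip2 _ _); apply/funext => xi; exact: mulrCA.
  have -> : ip2 (T (rf k.+1 l)) (T (modul (x k l) (Uf k))) =
      ip2 (modul (- x k l) (rf k.+1 l)) (fun xi => (cnorm (m xi) ^+ 2)%:C%C * Uf k xi).
    rewrite ip2_symbol -[LHS](ip2_modul (- x k l)); congr (ip2 _ _).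
    rewrite -[RHS]modul0 -(addNr (x k l)) -modul_comp; congr modul.
    by apply/funext => xi; exact: mulrCA.
  by ring.
rewrite big_ord_recr /=; apply: (cvg_ext (cvgD IH step)) => l.
by rewrite !fctE /T; ring.
Qed.

End limits.

(* The profiles U^1, U^2, ... of the text are numbered from 0 here, so that
   U^1, ..., U^k are [U j] for j < k; likewise for the index l. *)
Theorem proposition4p1 (R : realType) (n : nat) (dd : 'I_n -> nat)
    (s : 'I_n -> R) (q sb : R)
    (u : nat -> 'rV[R]_(\sum_(j < n) dd j) -> R[i]) :
  (0 < n)%N -> (forall j, (0 < dd j)%N) -> (forall j, 0 < s j) ->
  2 < q -> 0 < sb ->
  (\sum_(j < n) dd j)%N%:R / sb = \sum_(j < n) (dd j)%:R / s j ->
  1 / 2 - sb / (\sum_(j < n) dd j)%N%:R < 1 / q ->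
  Hs_bounded s u ->
  exists sub : nat -> nat,
  exists U : nat -> 'rV[R]_(\sum_(j < n) dd j) -> R[i],
  exists x : nat -> nat -> 'rV[R]_(\sum_(j < n) dd j),
  let r k l y := u (sub l) y - \sum_(j < k) U j (y + x j l) in
  {homo sub : a b / (a < b)%N} /\
  Hs_bounded s U /\
  (forall k j, (j < k)%N ->
     Hs_weak_cvg s (fun l y => r k l (y - x j l)) (fun=> 0)) /\
  (exists2 rho : nat -> R,
     forall k, (0 < k)%N ->
       (cLnorm q%:E (r k l) @[l --> \oo] --> (rho k)%:E)%E &
     rho k @[k --> \oo] --> 0) /\
  (forall j k, j <> k -> enorm (x j l - x k l) @[l --> \oo] --> +oo) /\
  (forall k, (0 < k)%N -> exists a b : R,
     [/\ (cLnorm q%:E (u (sub l)) `^ q @[l --> \oo] --> a%:E)%E,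
         (cLnorm q%:E (r k l) `^ q @[l --> \oo] --> b%:E)%E &
         (a%:E = b%:E + \sum_(j < k) cLnorm q%:E (U j) `^ q)%E]) /\
  (forall k, (0 < k)%N -> forall m, admissible_symbol s m ->
     (limn_esup (fun l => cLnorm 2%:E (multiplier m (u (sub l))) ^+ 2) =
      limn_esup (fun l => cLnorm 2%:E (multiplier m (r k l)) ^+ 2) +
      \sum_(j < k) cLnorm 2%:E (multiplier m (U j)) ^+ 2)%E).
Proof.
move=> n0 dd0 s0 q2 sb0 dsb qsb [Hu [M uM]].
set d := (\sum_(j < n) dd j)%N in u dsb qsb Hu uM *.
pose mu := @lebesgue_rV R d.
have d0 : (0 < d)%N by rewrite /d (bigD1 (Ordinal n0))//= ltn_addr.
have q0 : 0 < q by exact: lt_trans q2.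
have gam0 : 0 < gam dd s q.
  rewrite /gam (thetaE s0 sb0 dsb) subr_gt0.
  have dR : 0 < d%:R :> R by rewrite ltr0n.
  have c0 : 0 < d%:R / (2 * sb) by rewrite divr_gt0// mulr_gt0.
  have h : 2^-1 - q^-1 < sb / d%:R by move: qsb; rewrite !div1r; lra.
  apply: (@lt_le_trans _ _ (d%:R / (2 * sb) * (sb / d%:R))); first by rewrite ltr_pM2l.
  by rewrite le_eqVlt; apply/orP; left; apply/eqP; field; rewrite !gt_eqF.
have /choice[f uf] : forall l, exists f, spec s (u l) f by move=> l; exact: Hs_spec.
have fM l : ip2 mu (f l) (f l) <= M ^+ 2.
  have := uM l; rewrite (spec_Hs_norm (uf l)) lee_fin => h.
  rewrite -[leLHS]sqr_sqrtr; last exact: (ip_ge0 (L2H mu)).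
  by rewrite ler_sqr ?nnegrE ?sqrtr_ge0// (le_trans _ h) ?sqrtr_ge0.
have [sub [Uf [x [nu [[subh UB rw xd] [nuc nu0]]]]]] :=
  @profile_decomposition _ _ _ _ (L2_translations d0) (fun f => nq q (Phi s f)) f (M ^+ 2)
    (fun l => (uf l).1) fM (fun f => nq_ge0 q (Phi s f)) (nq_bounded s0 q2 gam0)
    (nq_detects s0 q2 gam0 d0).
have LU k : L2 mu (Uf k) := (UB k).1.
have UM k : ip2 mu (Uf k) (Uf k) <= M ^+ 2.
  apply: le_trans (UB k.+1).2; rewrite big_ord_recr /= lerDr sumr_ge0// => j _.
  exact: (ip_ge0 (L2H mu)).
have Lg l : L2 mu (f (sub l)) := (uf (sub l)).1.
pose U j := Phi s (Uf j); have sU j : spec s (U j) (Uf j) by exact: spec_Phi.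
exists sub, U, x => r.
pose rs := rf (fun l => f (sub l)) Uf x.
have sr k l : spec s (r k l) (rs k l).
  have -> : r k l = u (sub l) - \sum_(j < k) shift (x j l) (U j).
    by apply/funext => y; rewrite /r !fctE fct_sumE.
  apply: specB (uf _) _; apply: (big_rec2 (fun v h => spec s v h)); first exact: spec0.
  by move=> j v h _; apply: specD; exact: spec_shift.
have LqR k l : Lq q (r k l) := Lq_spectrum s0 q2 gam0 (sr k l).1 (sr k l).2.
have rnu k : nq q (r k l) @[l --> \oo] --> nu k.
  apply: (cvg_ext (nuc k)) => l; congr fine; apply: ae_cLnorm.
  - exact: (L2_Phi s (sr k l).1).1.
  - exact: (LqR k l).1.
  - exact: spec_unique (spec_Phi s (sr k l).1) (sr k l).
have nuE k l : cLnorm q%:E (r k l) = (nq q (r k l))%:E by rewrite nqE.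
have LqU j : Lq q (U j) := Lq_spectrum s0 q2 gam0 (sU j).1 (sU j).2.
have r0 l : r 0 l = u (sub l) by apply/funext => y; rewrite /r big_ord0 subr0.
have rS k l : r k l = r k.+1 l + shift (x k l) (U k).
  by apply/funext => y; rewrite fctE /r big_ord_recr /= opprD addrA subrK.
have nuS k : nu k `^ q = nu k.+1 `^ q + nq q (U k) `^ q.
  exact: (@nq_profile _ _ _ _ _ s0 q2 gam0 _ _ _ _ Lg (fun l => fM (sub l)) LU rw r nu k sr rS rnu).
have powc k : (cLnorm q%:E (r k l) `^ q @[l --> \oo] --> (nu k `^ q)%:E)%E.
  have h := cvg_powR q0 (fun l => nq_ge0 q (r k l)) (rnu k).
  have h' : (nq q (r k l) `^ q)%:E @[l --> \oo] --> (nu k `^ q)%:E.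
    exact: (cvg_EFin_seq h).
  by apply: (cvg_ext h') => l; rewrite nuE poweR_EFin.
split; first exact: subh.
split.
  split => [l|]; first exact: spec_Hs (sU l).
  exists (Num.sqrt (M ^+ 2)) => l; rewrite (spec_Hs_norm (sU l)) lee_fin.
  by apply: ler_wsqrtr; exact: UM.
split.
  move=> k j jk; apply: (@spec_weak0 _ _ _ _ _ (fun l => modul (- x j l) (rs k l))).
    by move=> l; exact: spec_shift (sr k l).
  by move=> h Lh; exact: rw.
split.
  exists nu => // k _.
  have h' : (nq q (r k l))%:E @[l --> \oo] --> (nu k)%:E.
    exact: (cvg_EFin_seq (rnu k)).
  by apply: (cvg_ext h') => l; rewrite nuE.
split; first exact: xd.
split.
  move=> k _; exists (nu 0 `^ q), (nu k `^ q); split.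
  - by apply: (cvg_ext (powc 0)) => l; rewrite r0.
  - exact: powc.
  - rewrite (eq_bigr (fun j : 'I_k => (nq q (U j) `^ q)%:E)) => [|j _]; last first.
      by rewrite -poweR_EFin nqE.
    rewrite sumEFin -EFinD; congr EFin.
    elim: k => [|k IH]; first by rewrite big_ord0 addr0.
    by rewrite IH big_ord_recr /= nuS addrAC addrA.
move=> k _ m am; have [K K0 mK] := admissible_le am.
pose w xi : R[i] := m xi * ((W s xi)^-1)%:C%C.
have mw : cmeas w by apply: cmeasM; [exact: am.1|apply: cmeas_real; exact: meas_Winv].
pose a i l := ip2 mu (fun xi => w xi * rs i l xi) (fun xi => w xi * rs i l xi).
have aE i : (fun l => (cLnorm 2%:E (multiplier m (r i l)) ^+ 2)%E) = fun l => (a i l)%:E.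
  by apply/funext => l; exact: (multiplier_spec am (sr i l)).
have -> : (fun l => (cLnorm 2%:E (multiplier m (u (sub l))) ^+ 2)%E) = fun l => (a 0%N l)%:E.
  by rewrite -aE; apply/funext => l; rewrite r0.
rewrite aE (eq_bigr (fun j : 'I_k => (ip2 mu (fun xi => w xi * Uf j xi)
  (fun xi => w xi * Uf j xi))%:E)) => [|j _]; last exact: (multiplier_spec am (sU j)).
rewrite sumEFin; apply: limn_esup_shift.
exact: (@symbol_profile _ _ _ _ _ _ Lg LU rw _ _ _ mw mK).
Qed.
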